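(* Let $X$ (respectively $\eta$) be a surface given, as described in the context, by a holomorphic function $g$ with $g'\neq0$, a nonzero real constant $c$ and a differentiable function $h$, so that $X=Y-\frac{2(h+c)}{S}\eta$ with $Y=\pi_-^{-1}\circ g$ and $\eta=\nabla_Lh+hY$. Then $X$ is a rotational $H_2$-surface (respectively $\eta$ is a rotational Laguerre minimal surface) if and only if $g(z)=e^z$ and $$h(u,v)=\frac{a_2+c_1u+e^{2u}(a_3+c_2u)}{1+e^{2u}},\qquad z=u+iv,\quad a_2,a_3,c_1,c_2\in\mathbb{R}.$$ In this case, the surfaces $X$ and $\eta$ can be locally parameterized by $$X(u,v)=\big(\tilde M(u)\cos v,\;\tilde M(u)\sin v,\;\tilde N(u)\big),\qquad \eta(u,v)=\big(\tilde M_1(u)\cos v,\;\tilde M_1(u)\sin v,\;\tilde N_1(u)\big),$$ where $$\tilde M(u)=\frac{2e^u\big[q_1q_2-2a_2q_3-2c(q_4+q_5)\big]}{q_6-2c_1e^{2u}q_7+e^{4u}q_8},\qquad \tilde N(u)=\frac{c_1^2\big(1-e^{2u}(1-2u)^2\big)+2c_1e^{2u}r_1+e^{2u}r_2}{r_3-2c_1e^{2u}r_4+e^{4u}r_5},$$ $$\tilde M_1(u)=\frac{e^{-u}\Big(e^{2u}\big(2a_2+2a_3+c_2-c_2e^{2u}+2c_2u\big)+c_1\big(1+e^{2u}(2u-1)\big)\Big)}{2(1+e^{2u})},$$ $$\tilde N_1(u)=\frac{a_2+c_1(u-1)-e^{2u}(a_3+c_2+c_2u)}{1+e^{2u}},$$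 with $$q_1=c_1(1-2u)+c_2e^{2u},\quad q_2=c_1+e^{2u}(2a_3+c_2+2c_2u),\quad q_3=c_1+e^{2u}(2a_3+2c+c_2+2c_2u),$$ $$q_4=e^{2u}(2a_3+c_2-c_2e^{2u}+2c_2u),\quad q_5=c_1\big(1+e^{2u}(2u-1)\big),$$ $$q_6=4a_2^2e^{2u}-4a_2c_2e^{4u}+c_1^2\big(1+e^{2u}(1-2u)^2\big),$$ $$q_7=-2a_3+a_2(2-4u)+c_2\big(-1-2u+e^{2u}(2u-1)\big),$$ $$q_8=4a_3^2+4a_3(c_2+2c_2u)+c_2^2\big(e^{2u}+(1+2u)^2\big),$$ $$r_1=2a_3+4c+c_2-c_2e^{2u}+a_2(2-4u)-4cu+2c_2u+2c_2e^{2u}u,$$ $$r_2=-4a_2^2+a_2(4c_2e^{2u}-8c)+e^{2u}\Big(4a_3^2+4a_3(2c+c_2+2c_2u)+c_2\big(8c(u+1)+c_2((1+2u)^2-e^{2u})\big)\Big),$$ $$r_3=4a_2^2e^{2u}-4a_2c_2e^{4u}+c_1^2\big(1+e^{2u}(1-2u)^2\big),$$ $$r_4=-2a_3+a_2(2-4u)+c_2\big(e^{2u}(2u-1)-1-2u\big),$$ $$r_5=4a_3^2+4a_3(c_2+2c_2u)+c_2^2\big(e^{2u}+(1+2u)^2\big).$$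
   Context: Setting. Identify $\mathbb{R}^2=\mathbb{C}$ and $\mathbb{R}^3=\mathbb{C}\times\mathbb{R}$. Let $g:\mathbb{C}\to\mathbb{C}_\infty$ be holomorphic with $g'\neq0$, let $\pi_-^{-1}:\mathbb{C}\to\mathbb{S}^2\setminus\{-e_3\}$ be the inverse of stereographic projection, let $U\subset\mathbb{R}^2$ be open, $T=1+|g|^2$, and $Y=\pi_-^{-1}\circ g=\frac1T(2g,\,2-T):U\to\mathbb{S}^2$. Then $L_{ij}=\langle Y_{,i},Y_{,j}\rangle=\frac{4|g'|^2}{T^2}\delta_{ij}$. An immersion $X:\Sigma\to\mathbb{R}^3$ of a Riemann surface $\Sigma$ with Gauss map $N$ and $\langle X,N\rangle\neq1$ everywhere can be locally parameterized by $X=Y-\frac{2(h+c)}{S}\eta$, where $c$ is a nonzero real constant, $h:U\to\mathbb{R}$ is a nowhere-vanishing differentiable function, and $$\eta=\nabla_Lh+hY,\qquad \nabla_L h=\frac{T^2}{4|g'|^2}(h_{,1}Y_{,1}+h_{,2}Y_{,2}),\qquad S=\langle\eta,\eta\rangle=|\nabla_Lh|^2+h^2;$$ in these coordinates the Gauss map is $N=Y-\frac{2h}{S}\eta$. The map $\eta:U\to\mathbb{R}^3$ defines a surface with unit normal $Y$. Curvatures. Let $\Psi=\langle X,N\rangle$ (support function), $R=\frac{1-|X|^2}{2(\Psi-1)}$ (radius function of the sphere congruence having $X$ and the unit sphere as envelopes; one has $h=-\frac{c}{R+1}$), let $k_1,k_2$ be the principal curvatures (eigenvalues of $-dN$), $s_i=\frac{1+k_i}{1-k_iR}$,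 and $H_S=\frac12(s_1+s_2)$ (spherical mean curvature). $X$ is an $H_2$-surface if $\Delta_\sigma\left[\frac{H_S}{\Psi-1}\right]=0$, where $\sigma=I+2R\,II+R^2\,III$ and $I,II,III$ are the fundamental forms of $X$: $I=\langle dX,dX\rangle$, $II=\langle -dN,dX\rangle$, $III=\langle dN,dN\rangle$. Laguerre minimal surface: a surface in $\mathbb{R}^3$ that is a critical point of $\int\frac{H^2-K}{K}\,dA$, with Euler–Lagrange equation $\Delta_{III}\left(\frac{H}{K}\right)=0$, where $H,K$ are the mean and Gaussian curvatures and $\Delta_{III}$ is the Laplacian of the third fundamental form.
   Formalization: g=e^z and the formula for h are required only in a suitable local conformal parameter z=u+iv; ''rotational'' means about the e_3-axis; σ is taken as I-2R II+R^2 III, i.e. |dX+R dN|^2, as the sign +2R II with II=<-dN,dX> makes the claim false; U is connected and h smooth. *)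

(* Defs.v *)
From Stdlib Require Import Reals.
From Coquelicot Require Import Coquelicot.
Open Scope R_scope.

(** * Calculus on open subsets of the plane

    R^2 is identified with C, which Coquelicot defines as R * R. *)

Definition D1 (f : C -> R) (z : C) : R := Derive (fun t => f (t, snd z)) (fst z).
Definition D2 (f : C -> R) (z : C) : R := Derive (fun t => f (fst z, t)) (snd z).

Definition ex_partials (f : C -> R) (z : C) : Prop :=
  ex_derive (fun t => f (t, snd z)) (fst z) /\
  ex_derive (fun t => f (fst z, t)) (snd z).

Fixpoint Ck_on (k : nat) (V : C -> Prop) (f : C -> R) : Prop :=
  match k with
  | O => forall z, V z -> continuous f z
  | S k' => (forall z, V z -> ex_partials f z) /\
            Ck_on k' V (D1 f) /\ Ck_on k' V (D2 f)
  end.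

Definition smooth_on (V : C -> Prop) (f : C -> R) : Prop := forall k, Ck_on k V f.

Definition smooth1_on (J : R -> Prop) (f : R -> R) : Prop :=
  forall n x, J x -> ex_derive_n f n x.

(** [V] is meant to be open.  Smoothness is automatic for a complex
    differentiable function on an open set (Goursat, Cauchy); it is recorded
    here so that holomorphic maps are in particular smooth maps of the plane. *)
Definition holomorphic_on (V : C -> Prop) (f : C -> C) : Prop :=
  (forall z, V z -> ex_derive f z) /\
  smooth_on V (fun z => Re (f z)) /\ smooth_on V (fun z => Im (f z)).

Definition connected (U : C -> Prop) : Prop :=
  forall A B : C -> Prop, open A -> open B ->
    (forall z, U z -> A z \/ B z) ->
    (forall z, U z -> ~ (A z /\ B z)) ->
    (forall z, U z -> A z) \/ (forall z, U z -> B z).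

Definition conformal_chart (V : C -> Prop) (zeta : C -> C) : Prop :=
  open V /\ holomorphic_on V zeta /\
  (forall z, V z -> C_derive zeta z <> 0%C) /\
  (forall z w, V z -> V w -> zeta z = zeta w -> z = w).

Definition real_chart (V : C -> Prop) (u v : C -> R) : Prop :=
  open V /\ smooth_on V u /\ smooth_on V v /\
  (forall z, V z -> D1 u z * D2 v z - D2 u z * D1 v z <> 0) /\
  (forall z w, V z -> V w -> u z = u w -> v z = v w -> z = w).

Definition cexp (z : C) : C := (exp (Re z) * cos (Im z), exp (Re z) * sin (Im z)).

(** * Maps to the Riemann sphere; [None] is the point at infinity *)

Definition Csphere : Type := option C.

(** [g] is holomorphic near [z0] as a map to the sphere and its differential at
    [z0] does not vanish; near a pole this is expressed in the chart [1 / g]. *)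
Definition holo_immersion_at (g : C -> Csphere) (z0 : C) : Prop :=
  exists (V : C -> Prop) (f : C -> C),
    open V /\ V z0 /\ holomorphic_on V f /\ C_derive f z0 <> 0%C /\
    ((forall z, V z -> g z = Some (f z)) \/
     (forall z, V z -> (f z = 0%C -> g z = None) /\
                       (f z <> 0%C -> g z = Some (/ f z)%C))).

(** * Vectors in R^3 and vector-valued maps *)

Definition V3 : Type := (R * R * R)%type.
Definition vx (p : V3) : R := fst (fst p).
Definition vy (p : V3) : R := snd (fst p).
Definition vz (p : V3) : R := snd p.
Definition vadd (p q : V3) : V3 := (vx p + vx q, vy p + vy q, vz p + vz q).
Definition vscal (a : R) (p : V3) : V3 := (a * vx p, a * vy p, a * vz p).
Definition dot (p q : V3) : R := vx p * vx q + vy p * vy q + vz p * vz q.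

Definition vD1 (F : C -> V3) (z : C) : V3 :=
  (D1 (fun w => vx (F w)) z, D1 (fun w => vy (F w)) z, D1 (fun w => vz (F w)) z).
Definition vD2 (F : C -> V3) (z : C) : V3 :=
  (D2 (fun w => vx (F w)) z, D2 (fun w => vy (F w)) z, D2 (fun w => vz (F w)) z).

Definition immersion_on (U : C -> Prop) (X : C -> V3) : Prop :=
  forall z, U z -> forall a b : R,
    vadd (vscal a (vD1 X z)) (vscal b (vD2 X z)) = (0, 0, 0) -> a = 0 /\ b = 0.

(** * Fundamental forms and curvatures of a surface [X] with unit normal [N] *)

Record form := Form { f11 : R; f12 : R; f22 : R }.

Definition fdet (s : form) : R := f11 s * f22 s - f12 s ^ 2.

Definition fadd (s t : form) : form :=
  Form (f11 s + f11 t) (f12 s + f12 t) (f22 s + f22 t).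
Definition fscal (a : R) (s : form) : form := Form (a * f11 s) (a * f12 s) (a * f22 s).

Definition formI (X : C -> V3) (z : C) : form :=
  Form (dot (vD1 X z) (vD1 X z)) (dot (vD1 X z) (vD2 X z)) (dot (vD2 X z) (vD2 X z)).

Definition formII (X N : C -> V3) (z : C) : form :=
  Form (- dot (vD1 N z) (vD1 X z)) (- dot (vD1 N z) (vD2 X z))
       (- dot (vD2 N z) (vD2 X z)).

Definition formIII (N : C -> V3) (z : C) : form := formI N z.

(** Half the trace and the determinant of the matrix I^-1 II of -dN. *)
Definition mean_curv (X N : C -> V3) (z : C) : R :=
  let I := formI X z in let II := formII X N z in
  (f22 I * f11 II - 2 * f12 I * f12 II + f11 I * f22 II) / (2 * fdet I).
Definition gauss_curv (X N : C -> V3) (z : C) : R :=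
  fdet (formII X N z) / fdet (formI X z).

(** The eigenvalues of -dN: the roots of t^2 - 2 H t + K. *)
Definition k1 (X N : C -> V3) (z : C) : R :=
  mean_curv X N z + sqrt (mean_curv X N z ^ 2 - gauss_curv X N z).
Definition k2 (X N : C -> V3) (z : C) : R :=
  mean_curv X N z - sqrt (mean_curv X N z ^ 2 - gauss_curv X N z).

(** Laplace-Beltrami operator of a metric [s]. *)
Definition laplacian (s : C -> form) (f : C -> R) (z : C) : R :=
  / sqrt (fdet (s z)) *
  (D1 (fun w => (f22 (s w) * D1 f w - f12 (s w) * D2 f w) / sqrt (fdet (s w))) z +
   D2 (fun w => (f11 (s w) * D2 f w - f12 (s w) * D1 f w) / sqrt (fdet (s w))) z).

(** * H2-surfaces and Laguerre minimal surfaces *)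

Definition support (X N : C -> V3) (z : C) : R := dot (X z) (N z).

Definition radius (X N : C -> V3) (z : C) : R :=
  (1 - dot (X z) (X z)) / (2 * (support X N z - 1)).

Definition s1 (X N : C -> V3) (z : C) : R :=
  (1 + k1 X N z) / (1 - k1 X N z * radius X N z).
Definition s2 (X N : C -> V3) (z : C) : R :=
  (1 + k2 X N z) / (1 - k2 X N z * radius X N z).

Definition spherical_mean_curv (X N : C -> V3) (z : C) : R :=
  (s1 X N z + s2 X N z) / 2.

(** [sigma] is the form |dX + R dN|^2 = I + 2 R <dN, dX> + R^2 III attached to the
    sphere congruence with centres X + R N.  As [formII] is <-dN, dX> (the sign
    for which k1, k2 are the eigenvalues of -dN and for which the s_i have
    denominators 1 - k_i R), the middle term carries a minus sign; "I + 2 R II +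
    R^2 III" is the same form written with II = <dN, dX>. *)
Definition sigma (X N : C -> V3) (z : C) : form :=
  fadd (formI X z)
    (fadd (fscal (- 2 * radius X N z) (formII X N z))
          (fscal (radius X N z ^ 2) (formIII N z))).

Definition H2_surface (U : C -> Prop) (X N : C -> V3) : Prop :=
  forall z, U z ->
    laplacian (sigma X N)
      (fun w => spherical_mean_curv X N w / (support X N w - 1)) z = 0.

(** The Euler-Lagrange equation of the integral of (H^2 - K) / K dA. *)
Definition laguerre_minimal (U : C -> Prop) (X N : C -> V3) : Prop :=
  forall z, U z ->
    laplacian (formIII N) (fun w => mean_curv X N w / gauss_curv X N w) z = 0.

(** Surface of revolution about the e3-axis: near every point there are local
    coordinates (u, v) of the surface in which it is a rotated profile curve. *)
Definition rotational (U : C -> Prop) (X : C -> V3) : Prop :=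
  forall z0, U z0 ->
    exists (V : C -> Prop) (u v : C -> R) (J : R -> Prop) (m n : R -> R),
      V z0 /\ (forall z, V z -> U z) /\ real_chart V u v /\
      open J /\ (forall z, V z -> J (u z)) /\ smooth1_on J m /\ smooth1_on J n /\
      (forall z, V z -> X z = (m (u z) * cos (v z), m (u z) * sin (v z), n (u z))).

(** * The surfaces attached to the data (g, c, h) *)

Definition stereo_inv (w : Csphere) : V3 :=
  match w with
  | Some w => let T := 1 + Cmod w ^ 2 in (2 * Re w / T, 2 * Im w / T, (2 - T) / T)
  | None => (0, 0, -1)
  end.

Definition Ymap (g : C -> Csphere) (z : C) : V3 := stereo_inv (g z).

Definition formL (g : C -> Csphere) (z : C) : form := formI (Ymap g) z.

(** Where g is finite, f11 (formL g z) = 4 |g'|^2 / T^2; unlike that expression it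
    also makes sense at the poles of g. *)
Definition gradL (g : C -> Csphere) (h : C -> R) (z : C) : V3 :=
  vscal (/ f11 (formL g z))
    (vadd (vscal (D1 h z) (vD1 (Ymap g) z)) (vscal (D2 h z) (vD2 (Ymap g) z))).

Definition eta (g : C -> Csphere) (h : C -> R) (z : C) : V3 :=
  vadd (gradL g h z) (vscal (h z) (Ymap g z)).

Definition Sfun (g : C -> Csphere) (h : C -> R) (z : C) : R :=
  dot (eta g h z) (eta g h z).

Definition Xmap (g : C -> Csphere) (c : R) (h : C -> R) (z : C) : V3 :=
  vadd (Ymap g z) (vscal (- (2 * (h z + c) / Sfun g h z)) (eta g h z)).

(** The Gauss map of [Xmap g c h]. *)
Definition Nmap (g : C -> Csphere) (h : C -> R) (z : C) : V3 :=
  vadd (Ymap g z) (vscal (- (2 * h z / Sfun g h z)) (eta g h z)).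

(** * The explicit solution *)

Definition h_rot (a2 a3 c1 c2 u : R) : R :=
  (a2 + c1 * u + exp (2 * u) * (a3 + c2 * u)) / (1 + exp (2 * u)).

(** "g(z) = e^z and h(u,v) = h_rot u, z = u + iv": this holds for a suitable local
    conformal parameter zeta = u + iv of the surface, the constants being the same
    for all of them.  (A conformal change of parameter changes g and h but not
    the surfaces X and eta.) *)
Definition rot_data (U : C -> Prop) (g : C -> Csphere) (h : C -> R) : Prop :=
  exists a2 a3 c1 c2 : R, forall z0, U z0 ->
    exists (V : C -> Prop) (zeta : C -> C),
      V z0 /\ (forall z, V z -> U z) /\ conformal_chart V zeta /\
      (forall z, V z -> g z = Some (cexp (zeta z)) /\
                        h z = h_rot a2 a3 c1 c2 (Re (zeta z))).

Section Profile.
Variables a2 a3 c1 c2 c u : R.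

Let E := exp (2 * u).
Let E4 := exp (4 * u).

Definition q1 : R := c1 * (1 - 2 * u) + c2 * E.
Definition q2 : R := c1 + E * (2 * a3 + c2 + 2 * c2 * u).
Definition q3 : R := c1 + E * (2 * a3 + 2 * c + c2 + 2 * c2 * u).
Definition q4 : R := E * (2 * a3 + c2 - c2 * E + 2 * c2 * u).
Definition q5 : R := c1 * (1 + E * (2 * u - 1)).
Definition q6 : R :=
  4 * a2 ^ 2 * E - 4 * a2 * c2 * E4 + c1 ^ 2 * (1 + E * (1 - 2 * u) ^ 2).
Definition q7 : R :=
  - 2 * a3 + a2 * (2 - 4 * u) + c2 * (- 1 - 2 * u + E * (2 * u - 1)).
Definition q8 : R :=
  4 * a3 ^ 2 + 4 * a3 * (c2 + 2 * c2 * u) + c2 ^ 2 * (E + (1 + 2 * u) ^ 2).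
Definition r1 : R :=
  2 * a3 + 4 * c + c2 - c2 * E + a2 * (2 - 4 * u) - 4 * c * u + 2 * c2 * u
  + 2 * c2 * E * u.
Definition r2 : R :=
  - 4 * a2 ^ 2 + a2 * (4 * c2 * E - 8 * c)
  + E * (4 * a3 ^ 2 + 4 * a3 * (2 * c + c2 + 2 * c2 * u)
         + c2 * (8 * c * (u + 1) + c2 * ((1 + 2 * u) ^ 2 - E))).
Definition r3 : R :=
  4 * a2 ^ 2 * E - 4 * a2 * c2 * E4 + c1 ^ 2 * (1 + E * (1 - 2 * u) ^ 2).
Definition r4 : R :=
  - 2 * a3 + a2 * (2 - 4 * u) + c2 * (E * (2 * u - 1) - 1 - 2 * u).
Definition r5 : R :=
  4 * a3 ^ 2 + 4 * a3 * (c2 + 2 * c2 * u) + c2 ^ 2 * (E + (1 + 2 * u) ^ 2).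

Definition Mt : R :=
  2 * exp u * (q1 * q2 - 2 * a2 * q3 - 2 * c * (q4 + q5))
  / (q6 - 2 * c1 * E * q7 + E4 * q8).
Definition Nt : R :=
  (c1 ^ 2 * (1 - E * (1 - 2 * u) ^ 2) + 2 * c1 * E * r1 + E * r2)
  / (r3 - 2 * c1 * E * r4 + E4 * r5).
Definition M1t : R :=
  exp (- u) * (E * (2 * a2 + 2 * a3 + c2 - c2 * E + 2 * c2 * u)
               + c1 * (1 + E * (2 * u - 1))) / (2 * (1 + E)).
Definition N1t : R :=
  (a2 + c1 * (u - 1) - E * (a3 + c2 + c2 * u)) / (1 + E).
End Profile.

(** The surface with profile curve (m, n), in the parameter z = u + iv. *)
Definition revolve (m n : R -> R) (z : C) : V3 :=
  (m (Re z) * cos (Im z), m (Re z) * sin (Im z), n (Re z)).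

(* Main.v *)
Require Import Defs.
From Stdlib Require Import Reals Lra Psatz Classical.
From Coquelicot Require Import Coquelicot.
Open Scope R_scope.

(** Let a_ij = <eta_,j, Y_,i> and E = |Y_,1|^2.  Since eta has normal Y, <eta, Y> = h and
    <eta, Y_,i> = h_,i, the matrix a is symmetric and, as Y is conformal, has trace
    Lap h + 2 E h.  The shape operator of eta is -E a^-1, so H/K = - tr a / (2 E).  The
    reflection in the plane orthogonal to eta carries Y to N; in the image of the frame
    (Y_,1, Y_,2), dX and dN are affine functions of a, which gives sigma = (1 + R)^2 E |dz|^2
    and H_S / (Psi - 1) = tr a / (2 c E).  So both conditions say that F = Lap h / E + 2 h is
    harmonic.

    If X or eta is rotational, then so are its normal and h; hence Y is invariant under the
    infinitesimal rotation, its height y is never 1 or -1, and grad h is parallel to grad y.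
    With the harmonic function u = ln ((1 - y) / (1 + y)) / 2, so that y = - tanh u,
    everything becomes an ODE in u: F'' = 0 and F = h'' cosh^2 u + 2 h.  The solutions
    are the functions h_rot.  The ODE is solved by exhibiting functions with zero gradient, so
    that only the connectedness of U is needed.  Finally u = ln |g|, and a local branch of
    log g is the required conformal parameter. *)

(** * Calculus in the plane *)

(** Two obstacles shape the argument. [rotational] supplies only local charts with unrelated profile
    curves, so no global profile is available. What is common to all charts is the infinitesimal
    rotation: at each point there is a nonzero tangent direction along which the surface and its
    normal both move by [rot3]. Likewise the level sets of u in U need not be connected, so h cannot
    be treated as a function of u on all of U. Dependence on u is therefore expressed by parallel
    gradients, differentiation in u by the proportionality factor, and integration constants by
    expressions with vanishing gradient. This gives constants valid on all of U at once, as
    [rot_data] demands, although log g exists only locally. The values g = infinity cause no trouble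
    because everything is computed from Y, which is smooth there; g itself returns only when the
    local logarithm is taken, where its values 0 and infinity are already excluded. *)

Definition pd (f : C -> R) (z : C) (a b : R) : Prop :=
  is_derive (fun t => f (t, snd z)) (fst z) a /\
  is_derive (fun t => f (fst z, t)) (snd z) b.

(** [Derive] is total, so equations for [D1] and [D2] alone carry no differentiability. Derivatives
    of composite expressions are therefore computed as a [pd], which keeps existence and value
    together, and read off here. *)
Lemma pd_D (f : C -> R) (z : C) (a b : R) : pd f z a b -> D1 f z = a /\ D2 f z = b.
Proof. intros [H1 H2]. split; now apply is_derive_unique. Qed.

Lemma pd_ex (f : C -> R) (z : C) (a b : R) : pd f z a b -> ex_partials f z.
Proof. intros [H1 H2]. split; eexists; eassumption. Qed.

Lemma ex_pd (f : C -> R) (z : C) : ex_partials f z -> pd f z (D1 f z) (D2 f z).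
Proof. intros [H1 H2]. split; apply Derive_correct; assumption. Qed.

Lemma pd_eq (f : C -> R) (z : C) (a b a' b' : R) :
  pd f z a b -> a = a' -> b = b' -> pd f z a' b'.
Proof. intros H <- <-; exact H. Qed.

Lemma locally_lines (z : C) (P : C -> Prop) : locally z P ->
  locally (fst z) (fun t => P (t, snd z)) /\ locally (snd z) (fun t => P (fst z, t)).
Proof.
  intros [e He].
  split; exists e; intros t Ht; apply He; split; simpl; auto; apply ball_center.
Qed.

Lemma pd_ext_loc (f g : C -> R) (z : C) (a b : R) :
  locally z (fun w => f w = g w) -> pd f z a b -> pd g z a b.
Proof.
  intros H [H1 H2]. destruct (locally_lines z _ H) as [L1 L2].
  split; [apply (is_derive_ext_loc (fun t => f (t, snd z)))
         |apply (is_derive_ext_loc (fun t => f (fst z, t)))]; assumption.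
Qed.

Lemma pd_ext (f g : C -> R) (z : C) (a b : R) :
  (forall w, f w = g w) -> pd f z a b -> pd g z a b.
Proof. intros H. apply pd_ext_loc. apply filter_forall, H. Qed.

Lemma D_ext_loc (f g : C -> R) (z : C) :
  locally z (fun w => f w = g w) -> D1 f z = D1 g z /\ D2 f z = D2 g z.
Proof.
  intros H. destruct (locally_lines z _ H) as [L1 L2].
  split; apply Derive_ext_loc; assumption.
Qed.

Lemma pd_const (c : R) (z : C) : pd (fun _ => c) z 0 0.
Proof. split; apply (is_derive_const (K := R_AbsRing) (V := R_NormedModule)). Qed.

Lemma pd_plus (f g : C -> R) (z : C) (a b a' b' : R) :
  pd f z a b -> pd g z a' b' -> pd (fun w => f w + g w) z (a + a') (b + b').
Proof.
  intros [H1 H2] [G1 G2].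
  split; apply (is_derive_plus (K := R_AbsRing) (V := R_NormedModule)); assumption.
Qed.

Lemma pd_opp (f : C -> R) (z : C) (a b : R) :
  pd f z a b -> pd (fun w => - f w) z (- a) (- b).
Proof.
  intros [H1 H2].
  split; apply (is_derive_opp (K := R_AbsRing) (V := R_NormedModule)); assumption.
Qed.

Lemma pd_minus (f g : C -> R) (z : C) (a b a' b' : R) :
  pd f z a b -> pd g z a' b' -> pd (fun w => f w - g w) z (a - a') (b - b').
Proof. intros H G. apply pd_plus; [|apply pd_opp]; assumption. Qed.

Lemma pd_mult (f g : C -> R) (z : C) (a b a' b' : R) :
  pd f z a b -> pd g z a' b' ->
  pd (fun w => f w * g w) z (a * g z + f z * a') (b * g z + f z * b').
Proof.
  intros [H1 H2] [G1 G2]. destruct z as [x y].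
  split;
    [apply (is_derive_mult (K := R_AbsRing) (fun t => f (t, y)) (fun t => g (t, y)) x)
    |apply (is_derive_mult (K := R_AbsRing) (fun t => f (x, t)) (fun t => g (x, t)) y)];
    try assumption; intros; apply Rmult_comm.
Qed.

Lemma pd_comp (F : R -> R) (f : C -> R) (z : C) (l a b : R) :
  is_derive F (f z) l -> pd f z a b -> pd (fun w => F (f w)) z (l * a) (l * b).
Proof.
  intros HF [H1 H2]. destruct z as [x y].
  split;
    (eapply (is_derive_ext_loc (K := R_AbsRing));
     [apply filter_forall; intros t; reflexivity|]).
  - rewrite Rmult_comm. apply (is_derive_comp F (fun t => f (t, y)) x); assumption.
  - rewrite Rmult_comm. apply (is_derive_comp F (fun t => f (x, t)) y); assumption.
Qed.

Lemma pd_inv (f : C -> R) (z : C) (a b : R) :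
  f z <> 0 -> pd f z a b ->
  pd (fun w => / f w) z (- / f z ^ 2 * a) (- / f z ^ 2 * b).
Proof.
  intros Hf H. apply (pd_comp Rinv f); [|exact H].
  auto_derive; [exact Hf|]. field; exact Hf.
Qed.

Lemma pd_div (f g : C -> R) (z : C) (a b a' b' : R) :
  g z <> 0 -> pd f z a b -> pd g z a' b' ->
  pd (fun w => f w / g w) z
     ((a * g z - f z * a') / g z ^ 2) ((b * g z - f z * b') / g z ^ 2).
Proof.
  intros Hg H G. eapply pd_eq; [apply pd_mult; [exact H|apply pd_inv; [exact Hg|exact G]]| |];
    cbv beta; field; exact Hg.
Qed.

Lemma pd_fst (z : C) : pd fst z 1 0.
Proof.
  split; simpl; [apply (is_derive_id (K := R_AbsRing))
                |apply (is_derive_const (K := R_AbsRing) (V := R_NormedModule))].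
Qed.

(** * Continuously differentiable and smooth functions on open sets *)

Lemma C1_filterdiff (V : C -> Prop) (f : R * R -> R) (z : R * R) :
  open V -> V z -> Ck_on 1 V f ->
  filterdiff (K := R_AbsRing) (U := prod_NormedModule R_AbsRing R_NormedModule R_NormedModule)
    (V := R_NormedModule) f (locally z)
    (fun u => plus (scal (fst u) (D1 f z)) (scal (snd u) (D2 f z))).
Proof.
  intros HV Hz [He [H1 _]]. destruct z as [x y].
  apply (filterdiff_ext (K := R_AbsRing)
    (U := prod_NormedModule R_AbsRing R_NormedModule R_NormedModule)
    (V := R_NormedModule) (fun u => f (fst u, snd u))); [intros [? ?]; reflexivity|].
  apply (is_derive_filterdiff (fun s t => f (s, t)) x y (fun s t => D1 f (s, t))).
  - apply (filter_imp V); [|exact (HV _ Hz)].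
    intros w Hw. destruct (He w Hw) as [E1 _]. apply (Derive_correct (fun t => f (t, snd w)) (fst w) E1).
  - destruct (He _ Hz) as [_ E2]. apply (Derive_correct (fun t => f (x, t)) y E2).
  - apply (continuous_ext (D1 f)); [intros [? ?]; reflexivity|]. apply H1, Hz.
Qed.

Lemma C1_continuous (V : C -> Prop) (f : C -> R) (z : C) :
  open V -> V z -> Ck_on 1 V f -> continuous f z.
Proof.
  intros HV Hz Hf.
  apply (filterdiff_continuous (U := prod_NormedModule R_AbsRing R_NormedModule R_NormedModule)
    (V := R_NormedModule)).
  eexists. exact (C1_filterdiff V f z HV Hz Hf).
Qed.

Lemma C1_linear_approx (V : C -> Prop) (f : C -> R) (z : C) :
  open V -> V z -> Ck_on 1 V f -> forall e : posreal,
  locally z (fun w => Rabs (f w - f z - ((fst w - fst z) * D1 f z + (snd w - snd z) * D2 f z))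
                      <= e * Cmod (w - z)%C).
Proof.
  intros HV Hz Hf e. destruct (C1_filterdiff V f z HV Hz Hf) as [_ H].
  generalize (H z (fun P HP => HP) e). apply filter_imp. intros w Hw.
  replace (Cmod (w - z)%C)
    with (norm (K := R_AbsRing) (V := prod_NormedModule R_AbsRing R_NormedModule R_NormedModule)
            (minus w z)); [exact Hw|].
  unfold Cmod, norm; simpl; unfold prod_norm, norm; simpl; unfold abs; simpl.
  rewrite !Rmult_1_r, <- !Rabs_mult, !Rabs_right by nra. reflexivity.
Qed.

Lemma Ck_sub (k : nat) (V W : C -> Prop) (f : C -> R) :
  (forall z, W z -> V z) -> Ck_on k V f -> Ck_on k W f.
Proof.
  intros HW. revert f. induction k as [|k IH]; simpl; [auto|].
  intros f [H1 [H2 H3]]. auto.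
Qed.

Lemma Ck_ext (k : nat) (V : C -> Prop) (f g : C -> R) : open V ->
  (forall z, V z -> f z = g z) -> Ck_on k V f -> Ck_on k V g.
Proof.
  intros HV. revert f g. induction k as [|k IH]; simpl; intros f g Hfg.
  - intros H z Hz. apply (continuous_ext_loc g f); [|auto].
    apply (filter_imp V); [exact Hfg|exact (HV _ Hz)].
  - intros [H1 [H2 H3]].
    assert (L : forall z, V z -> locally z (fun w => f w = g w)).
    { intros z Hz. apply (filter_imp V); [exact Hfg|exact (HV _ Hz)]. }
    split; [|split].
    + intros z Hz. eapply pd_ex, (pd_ext_loc f); [auto|apply ex_pd; auto].
    + apply (IH (D1 f)); [|assumption]. intros z Hz. apply D_ext_loc; auto.
    + apply (IH (D2 f)); [|assumption]. intros z Hz. apply D_ext_loc; auto.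
Qed.

(** [Ck_on] records continuity only for the derivatives of top order. The base case is that
    continuous partial derivatives imply total differentiability and hence continuity. *)
Lemma Ck_pred (k : nat) (V : C -> Prop) (f : C -> R) :
  open V -> Ck_on (S k) V f -> Ck_on k V f.
Proof.
  intros HV. revert f. induction k as [|k IH]; intros f Hf.
  - intros z Hz. eapply C1_continuous; eassumption.
  - destruct Hf as [H1 [H2 H3]]. split; [exact H1|split; apply IH; assumption].
Qed.

Lemma Ck_const (k : nat) (V : C -> Prop) (c : R) : open V -> Ck_on k V (fun _ => c).
Proof.
  intros HV. revert c. induction k as [|k IH]; intros c; simpl.
  - intros z _. apply continuous_const.
  - split; [intros z _; eapply pd_ex, pd_const|].
    split; (apply (Ck_ext k V (fun _ => 0)); [exact HV| |apply IH]);
      intros z _; destruct (pd_D _ _ _ _ (pd_const c z)); auto.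
Qed.

Lemma Ck_plus (k : nat) (V : C -> Prop) (f g : C -> R) : open V ->
  Ck_on k V f -> Ck_on k V g -> Ck_on k V (fun z => f z + g z).
Proof.
  intros HV. revert f g. induction k as [|k IH]; simpl; intros f g.
  - intros Hf Hg z Hz. apply (continuous_plus (V := R_NormedModule)); auto.
  - intros [F1 [F2 F3]] [G1 [G2 G3]].
    assert (P : forall z, V z -> pd (fun w => f w + g w) z (D1 f z + D1 g z) (D2 f z + D2 g z)).
    { intros z Hz. apply pd_plus; apply ex_pd; auto. }
    split; [intros z Hz; eapply pd_ex, P, Hz|].
    split; [apply (Ck_ext k V (fun z => D1 f z + D1 g z))
           |apply (Ck_ext k V (fun z => D2 f z + D2 g z))]; auto;
      intros z Hz; destruct (pd_D _ _ _ _ (P z Hz)); auto.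
Qed.

Lemma Ck_mult (k : nat) (V : C -> Prop) (f g : C -> R) : open V ->
  Ck_on k V f -> Ck_on k V g -> Ck_on k V (fun z => f z * g z).
Proof.
  intros HV. revert f g. induction k as [|k IH]; intros f g Hf Hg.
  - intros z Hz. apply (continuous_mult (K := R_AbsRing)); auto.
  - assert (f' := Ck_pred _ _ _ HV Hf). assert (g' := Ck_pred _ _ _ HV Hg).
    destruct Hf as [F1 [F2 F3]]. destruct Hg as [G1 [G2 G3]].
    assert (P : forall z, V z -> pd (fun w => f w * g w) z
      (D1 f z * g z + f z * D1 g z) (D2 f z * g z + f z * D2 g z)).
    { intros z Hz. apply pd_mult; apply ex_pd; auto. }
    split; [intros z Hz; eapply pd_ex, P, Hz|].
    split; [apply (Ck_ext k V (fun z => D1 f z * g z + f z * D1 g z))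
           |apply (Ck_ext k V (fun z => D2 f z * g z + f z * D2 g z))]; auto using Ck_plus;
      intros z Hz; destruct (pd_D _ _ _ _ (P z Hz)); auto.
Qed.

(** The partial derivatives of [/ f] are products of [/ f], [/ f], a constant and a partial
    derivative of [f], so the induction closes with [Ck_mult]. *)
Lemma Ck_comp_inv (k : nat) (V : C -> Prop) (f : C -> R) : open V ->
  (forall z, V z -> f z <> 0) -> Ck_on k V f -> Ck_on k V (fun z => / f z).
Proof.
  intros HV Hn. induction k as [|k IH]; intros Hf.
  - intros z Hz. apply (continuous_comp f Rinv); [apply Hf, Hz|].
    apply continuity_pt_filterlim, continuity_pt_inv; [apply continuity_pt_id|apply Hn, Hz].
  - assert (f' := IH (Ck_pred _ _ _ HV Hf)). destruct Hf as [F1 [F2 F3]].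
    assert (P : forall z, V z -> pd (fun w => / f w) z
      (-1 * (/ f z * / f z) * D1 f z) (-1 * (/ f z * / f z) * D2 f z)).
    { intros z Hz. eapply pd_eq; [apply pd_inv; [apply Hn, Hz|apply ex_pd; auto]| |];
        field; apply Hn, Hz. }
    split; [intros z Hz; eapply pd_ex, P, Hz|].
    split; [apply (Ck_ext k V (fun z => -1 * (/ f z * / f z) * D1 f z))
           |apply (Ck_ext k V (fun z => -1 * (/ f z * / f z) * D2 f z))];
      auto using Ck_mult, Ck_const; intros z Hz; destruct (pd_D _ _ _ _ (P z Hz)); auto.
Qed.

(** Raises the order by one when the derivative [G] of [F] is already understood along [f]: [ln] and
    [atan] reduce to inverses, [exp] to itself. *)
Lemma Ck_comp_deriv (k : nat) (V : C -> Prop) (F G : R -> R) (f : C -> R) : open V ->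
  (forall z, V z -> is_derive F (f z) (G (f z))) ->
  Ck_on (S k) V f -> Ck_on k V (fun z => G (f z)) -> Ck_on (S k) V (fun z => F (f z)).
Proof.
  intros HV HF [F1 [F2 F3]] HG.
  assert (P : forall z, V z -> pd (fun w => F (f w)) z (G (f z) * D1 f z) (G (f z) * D2 f z)).
  { intros z Hz. apply pd_comp; [apply HF, Hz|apply ex_pd; auto]. }
  split; [intros z Hz; eapply pd_ex, P, Hz|].
  split; [apply (Ck_ext k V (fun z => G (f z) * D1 f z))
         |apply (Ck_ext k V (fun z => G (f z) * D2 f z))]; auto using Ck_mult;
    intros z Hz; destruct (pd_D _ _ _ _ (P z Hz)); auto.
Qed.

Lemma smooth_pred (V : C -> Prop) (f : C -> R) :
  open V -> (forall k, Ck_on (S k) V f) -> smooth_on V f.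
Proof. intros HV H k. apply Ck_pred; auto. Qed.

Lemma smooth_const (V : C -> Prop) (c : R) : open V -> smooth_on V (fun _ => c).
Proof. intros HV k. now apply Ck_const. Qed.

Lemma smooth_plus (V : C -> Prop) (f g : C -> R) : open V ->
  smooth_on V f -> smooth_on V g -> smooth_on V (fun z => f z + g z).
Proof. intros HV Hf Hg k. apply Ck_plus; auto. Qed.

Lemma smooth_mult (V : C -> Prop) (f g : C -> R) : open V ->
  smooth_on V f -> smooth_on V g -> smooth_on V (fun z => f z * g z).
Proof. intros HV Hf Hg k. apply Ck_mult; auto. Qed.

Lemma smooth_inv (V : C -> Prop) (f : C -> R) : open V ->
  (forall z, V z -> f z <> 0) -> smooth_on V f -> smooth_on V (fun z => / f z).
Proof. intros HV Hn Hf k. apply Ck_comp_inv; auto. Qed.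

Lemma smooth_ext (V : C -> Prop) (f g : C -> R) : open V ->
  (forall z, V z -> f z = g z) -> smooth_on V f -> smooth_on V g.
Proof. intros HV H Hf k. eapply Ck_ext; eauto. Qed.

Lemma smooth_sub (V W : C -> Prop) (f : C -> R) :
  (forall z, W z -> V z) -> smooth_on V f -> smooth_on W f.
Proof. intros H Hf k. eapply Ck_sub; eauto. Qed.

Lemma smooth_opp (V : C -> Prop) (f : C -> R) : open V ->
  smooth_on V f -> smooth_on V (fun z => - f z).
Proof.
  intros HV Hf. apply (smooth_ext V (fun z => -1 * f z)); [exact HV|intros; ring|].
  apply smooth_mult; [exact HV|now apply smooth_const|exact Hf].
Qed.

Lemma smooth_minus (V : C -> Prop) (f g : C -> R) : open V ->
  smooth_on V f -> smooth_on V g -> smooth_on V (fun z => f z - g z).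
Proof. intros HV Hf Hg. apply smooth_plus; auto. now apply smooth_opp. Qed.

Lemma smooth_div (V : C -> Prop) (f g : C -> R) : open V ->
  (forall z, V z -> g z <> 0) -> smooth_on V f -> smooth_on V g ->
  smooth_on V (fun z => f z / g z).
Proof. intros HV Hn Hf Hg. apply smooth_mult; auto. now apply smooth_inv. Qed.

Lemma smooth_pow (V : C -> Prop) (f : C -> R) (n : nat) : open V ->
  smooth_on V f -> smooth_on V (fun z => f z ^ n).
Proof.
  intros HV Hf. induction n; simpl; [now apply smooth_const|now apply smooth_mult].
Qed.

Lemma smooth_D1 (V : C -> Prop) (f : C -> R) : smooth_on V f -> smooth_on V (D1 f).
Proof. intros Hf k. apply (Hf (S k)). Qed.

Lemma smooth_D2 (V : C -> Prop) (f : C -> R) : smooth_on V f -> smooth_on V (D2 f).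
Proof. intros Hf k. apply (Hf (S k)). Qed.

Lemma smooth_pd (V : C -> Prop) (f : C -> R) (z : C) :
  smooth_on V f -> V z -> pd f z (D1 f z) (D2 f z).
Proof. intros Hf Hz. apply ex_pd, (Hf 1%nat), Hz. Qed.

Lemma smooth_continuous (V : C -> Prop) (f : C -> R) (z : C) :
  smooth_on V f -> V z -> continuous f z.
Proof. intros Hf Hz. apply (Hf 0%nat), Hz. Qed.

Lemma smooth_comp_deriv (V : C -> Prop) (F G : R -> R) (f : C -> R) : open V ->
  (forall z, V z -> is_derive F (f z) (G (f z))) ->
  smooth_on V f -> smooth_on V (fun z => G (f z)) -> smooth_on V (fun z => F (f z)).
Proof.
  intros HV HF Hf HG. apply smooth_pred; [exact HV|].
  intros k. apply (Ck_comp_deriv k V F G); auto.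
Qed.

Lemma smooth_ln (V : C -> Prop) (f : C -> R) : open V ->
  (forall z, V z -> 0 < f z) -> smooth_on V f -> smooth_on V (fun z => ln (f z)).
Proof.
  intros HV Hp Hf. apply (smooth_comp_deriv V ln Rinv); auto.
  - intros z Hz. apply is_derive_ln, Hp, Hz.
  - apply smooth_inv; auto. intros z Hz. specialize (Hp z Hz). lra.
Qed.

Lemma smooth_atan (V : C -> Prop) (f : C -> R) : open V ->
  smooth_on V f -> smooth_on V (fun z => atan (f z)).
Proof.
  intros HV Hf. apply (smooth_comp_deriv V atan (fun x => / (1 + x * x))); auto.
  - intros z Hz. apply is_derive_atan.
  - apply smooth_inv; [exact HV|intros z Hz; nra|].
    apply smooth_plus; [exact HV|now apply smooth_const|now apply smooth_mult].
Qed.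

Lemma smooth_exp (V : C -> Prop) (f : C -> R) : open V ->
  smooth_on V f -> smooth_on V (fun z => exp (f z)).
Proof.
  intros HV Hf k. induction k as [|k IH].
  - intros z Hz. apply (continuous_comp f exp); [apply (Hf 0%nat), Hz|].
    apply continuity_pt_filterlim, derivable_continuous_pt, derivable_pt_exp.
  - apply (Ck_comp_deriv k V exp exp); auto. intros z _. apply is_derive_exp.
Qed.

(** Each clause of [Ck_on] concerns one point and derivatives of the globally defined [f], so it can
    be checked with a different set at every point. *)
Lemma smooth_local (V : C -> Prop) (f : C -> R) :
  (forall z, V z -> exists W, W z /\ smooth_on W f) -> smooth_on V f.
Proof.
  intros H k. revert f H. induction k as [|k IH]; intros f H.
  - intros z Hz. destruct (H z Hz) as [W [Wz HW]]. apply (HW 0%nat), Wz.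
  - split; [|split; apply IH].
    + intros z Hz. destruct (H z Hz) as [W [Wz HW]]. apply (HW 1%nat), Wz.
    + intros z Hz. destruct (H z Hz) as [W [Wz HW]]. exists W. split; [exact Wz|now apply smooth_D1].
    + intros z Hz. destruct (H z Hz) as [W [Wz HW]]. exists W. split; [exact Wz|now apply smooth_D2].
Qed.

Lemma smooth_Schwarz (V : C -> Prop) (f : C -> R) (z : C) :
  open V -> V z -> smooth_on V f -> D1 (D2 f) z = D2 (D1 f) z.
Proof.
  intros HV Hz Hf. destruct z as [x y].
  assert (c12 := smooth_continuous V _ _ (smooth_D1 _ _ (smooth_D2 _ _ Hf)) Hz).
  assert (c21 := smooth_continuous V _ _ (smooth_D2 _ _ (smooth_D1 _ _ Hf)) Hz).
  apply (Schwarz (fun s t => f (s, t)) x y).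
  - apply locally_2d_locally. apply (filter_imp V); [|exact (HV _ Hz)].
    intros w Hw.
    destruct (Hf 2%nat) as [E [[E1 _] [E2 _]]].
    destruct (E w Hw) as [? ?]. destruct (E1 w Hw) as [? ?]. destruct (E2 w Hw) as [? ?].
    repeat split; assumption.
  - apply continuity_2d_pt_filterlim.
    apply (filterlim_ext (D1 (D2 f))); [intros [? ?]; reflexivity|exact c12].
  - apply continuity_2d_pt_filterlim.
    apply (filterlim_ext (D2 (D1 f))); [intros [? ?]; reflexivity|exact c21].
Qed.

(** * Functions with vanishing gradient *)

Lemma Derive_zero_const (f : R -> R) (a b : R) :
  (forall t, Rmin a b <= t <= Rmax a b -> is_derive f t 0) -> f a = f b.
Proof.
  intros H. destruct (MVT_gen f a b (fun _ => 0)) as [c [_ E]].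
  - intros x Hx. apply H; lra.
  - intros x Hx. apply continuity_pt_filterlim.
    apply (ex_derive_continuous (K := R_AbsRing) (V := R_NormedModule)).
    eexists. apply H, Hx.
  - lra.
Qed.

(** Balls of the product space are squares, so a horizontal segment followed by a vertical one joins
    any point to the centre without leaving the ball. *)
Lemma zero_gradient_locally_const (V : C -> Prop) (f : C -> R) (z : C) :
  open V -> V z -> (forall w, V w -> pd f w 0 0) -> locally z (fun w => f w = f z).
Proof.
  intros HV Hz Hf. destruct (HV z Hz) as [e He]. exists e. intros w [B1 B2].
  destruct z as [x y], w as [x' y']. simpl in B1, B2.
  assert (Hb : forall a b t, ball a e b -> Rmin b a <= t <= Rmax b a -> ball a e t).
  { intros a b t. unfold ball; simpl; unfold AbsRing_ball, abs, minus, plus, opp; simpl.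
    intros Hb. apply Rabs_def2 in Hb. unfold Rmin, Rmax. destruct (Rle_dec b a);
    intros Ht; apply Rabs_def1; lra. }
  transitivity (f (x, y')).
  - apply (Derive_zero_const (fun t => f (t, y'))). intros t Ht.
    apply (Hf (t, y')), He. split; simpl; [now apply (Hb x x')|exact B2].
  - apply (Derive_zero_const (fun t => f (x, t))). intros t Ht.
    apply (Hf (x, t)), He. split; simpl; [apply ball_center|now apply (Hb y y')].
Qed.

(** As [f] is locally constant, the part of [U] where it equals [f z] and the part where it does not
    are both open; connectedness leaves only the first. *)
Lemma zero_gradient_const (U : C -> Prop) (f : C -> R) : open U -> connected U ->
  (forall w, U w -> pd f w 0 0) -> forall z w, U z -> U w -> f z = f w.
Proof.
  intros HU HC Hf z w Hz Hw.
  assert (L : forall x, U x -> locally x (fun y => U y /\ f y = f x)).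
  { intros x Hx. apply filter_and; [apply HU, Hx|].
    eapply zero_gradient_locally_const; eauto. }
  destruct (HC (fun x => U x /\ f x = f z) (fun x => U x /\ f x <> f z)) as [H|H].
  - intros x [Hx E]. generalize (L x Hx); apply filter_imp. intros y [? ->]. auto.
  - intros x [Hx E]. generalize (L x Hx); apply filter_imp. intros y [? ->]. auto.
  - intros x Hx. destruct (Req_dec (f x) (f z)); auto.
  - intros x Hx [[_ ?] [_ ?]]. auto.
  - symmetry. apply (H w Hw).
  - destruct (H z Hz) as [_ N]. now elim N.
Qed.

Lemma open_pos (V : C -> Prop) (f : C -> R) : open V ->
  (forall z, V z -> continuous f z) -> open (fun z => V z /\ 0 < f z).
Proof.
  intros HV Hf z [Hz Hp]. apply filter_and; [apply HV, Hz|].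
  apply (Hf z Hz (fun t => 0 < t)). now apply (open_gt 0 (f z)).
Qed.

Lemma open_inter (V W : C -> Prop) : open V -> open W -> open (fun z => V z /\ W z).
Proof. intros HV HW. now apply open_and. Qed.

(** * Conformal maps to the sphere *)

Lemma V3_eq (p q : V3) : vx p = vx q -> vy p = vy q -> vz p = vz q -> p = q.
Proof. destruct p as [[? ?] ?], q as [[? ?] ?]. unfold vx, vy, vz; simpl. congruence. Qed.

Ltac vec := unfold dot, vadd, vscal, vx, vy, vz in *; simpl in *.

Lemma dot_comm (p q : V3) : dot p q = dot q p.
Proof. unfold dot; ring. Qed.
Lemma dot_addl (p q r : V3) : dot (vadd p q) r = dot p r + dot q r.
Proof. vec; ring. Qed.
Lemma dot_addr (p q r : V3) : dot r (vadd p q) = dot r p + dot r q.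
Proof. vec; ring. Qed.
Lemma dot_scall (a : R) (p q : V3) : dot (vscal a p) q = a * dot p q.
Proof. vec; ring. Qed.
Lemma dot_scalr (a : R) (p q : V3) : dot p (vscal a q) = a * dot p q.
Proof. vec; ring. Qed.

(** * Orthogonal frames and differentiation of inner products *)

Definition orthogonal_frame (E : R) (a b y : V3) : Prop :=
  0 < E /\ dot a a = E /\ dot b b = E /\ dot y y = 1 /\
  dot a b = 0 /\ dot a y = 0 /\ dot b y = 0.

Lemma frame_zero (E : R) (a b y w : V3) : orthogonal_frame E a b y ->
  dot w a = 0 -> dot w b = 0 -> dot w y = 0 -> w = (0, 0, 0).
Proof.
  intros [HE [Haa [Hbb [Hyy [Hab [Hay Hby]]]]]] Ha Hb Hy.
  destruct a as [[a1 a2] a3], b as [[b1 b2] b3], y as [[y1 y2] y3], w as [[w1 w2] w3].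
  vec.
  (* The determinant of the three frame vectors. Its square is their Gram determinant, which equals
     [E * E]. *)
  pose (D := a1 * (b2 * y3 - b3 * y2) - a2 * (b1 * y3 - b3 * y1) + a3 * (b1 * y2 - b2 * y1)).
  assert (HD : D * D = E * E).
  { transitivity ((a1*a1+a2*a2+a3*a3) * ((b1*b1+b2*b2+b3*b3) * (y1*y1+y2*y2+y3*y3)
       - (b1*y1+b2*y2+b3*y3) * (b1*y1+b2*y2+b3*y3))
     - (a1*b1+a2*b2+a3*b3) * ((a1*b1+a2*b2+a3*b3) * (y1*y1+y2*y2+y3*y3)
       - (b1*y1+b2*y2+b3*y3) * (a1*y1+a2*y2+a3*y3))
     + (a1*y1+a2*y2+a3*y3) * ((a1*b1+a2*b2+a3*b3) * (b1*y1+b2*y2+b3*y3)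
       - (b1*b1+b2*b2+b3*b3) * (a1*y1+a2*y2+a3*y3))).
    - unfold D; ring.
    - rewrite Haa, Hbb, Hyy, Hab, Hay, Hby. ring. }
  assert (D0 : D <> 0) by nra.
  assert (W : forall x, D * x = 0 -> x = 0).
  { intros x Hx. apply Rmult_integral in Hx. tauto. }
  (* Cramer's rule: [D] times a coordinate of [w] is a combination of the three vanishing inner
     products. *)
  f_equal; [f_equal|]; apply W.
  - transitivity ((w1*a1+w2*a2+w3*a3) * (b2*y3-b3*y2) + (w1*b1+w2*b2+w3*b3) * (y2*a3-y3*a2)
                  + (w1*y1+w2*y2+w3*y3) * (a2*b3-a3*b2)); [unfold D; ring|].
    rewrite Ha, Hb, Hy; ring.
  - transitivity ((w1*a1+w2*a2+w3*a3) * (b3*y1-b1*y3) + (w1*b1+w2*b2+w3*b3) * (y3*a1-y1*a3)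
                  + (w1*y1+w2*y2+w3*y3) * (a3*b1-a1*b3)); [unfold D; ring|].
    rewrite Ha, Hb, Hy; ring.
  - transitivity ((w1*a1+w2*a2+w3*a3) * (b1*y2-b2*y1) + (w1*b1+w2*b2+w3*b3) * (y1*a2-y2*a1)
                  + (w1*y1+w2*y2+w3*y3) * (a1*b2-a2*b1)); [unfold D; ring|].
    rewrite Ha, Hb, Hy; ring.
Qed.

(** The difference of the two sides is orthogonal to the whole frame, so [frame_zero] applies. *)
Lemma frame_decomp (E : R) (a b y w : V3) : orthogonal_frame E a b y ->
  w = vadd (vscal (dot w a / E) a) (vadd (vscal (dot w b / E) b) (vscal (dot w y) y)).
Proof.
  intros HF. assert (HF' := HF).
  destruct HF' as [HE [Haa [Hbb [Hyy [Hab [Hay Hby]]]]]].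
  assert (Z : vadd w (vscal (-1)
    (vadd (vscal (dot w a / E) a) (vadd (vscal (dot w b / E) b) (vscal (dot w y) y))))
    = (0, 0, 0)).
  { apply (frame_zero E a b y); [exact HF| | |];
      rewrite dot_addl, dot_scall, !dot_addl, !dot_scall, ?Haa, ?Hbb, ?Hyy, ?Hab, ?Hay, ?Hby,
        ?(dot_comm b a), ?(dot_comm y a), ?(dot_comm y b), ?Hab, ?Hay, ?Hby; field; lra. }
  apply (f_equal (fun v => vadd v
    (vadd (vscal (dot w a / E) a) (vadd (vscal (dot w b / E) b) (vscal (dot w y) y))))) in Z.
  etransitivity; [|etransitivity; [exact Z|]]; apply V3_eq; unfold vadd, vscal, vx, vy, vz; simpl; ring.
Qed.

Definition smooth3_on (V : C -> Prop) (F : C -> V3) : Prop :=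
  smooth_on V (fun z => vx (F z)) /\ smooth_on V (fun z => vy (F z)) /\
  smooth_on V (fun z => vz (F z)).

Lemma smooth3_vD1 (V : C -> Prop) (F : C -> V3) : smooth3_on V F -> smooth3_on V (vD1 F).
Proof. intros [H1 [H2 H3]]. repeat split; now apply smooth_D1. Qed.

Lemma smooth3_vD2 (V : C -> Prop) (F : C -> V3) : smooth3_on V F -> smooth3_on V (vD2 F).
Proof. intros [H1 [H2 H3]]. repeat split; now apply smooth_D2. Qed.

Lemma smooth3_vadd (V : C -> Prop) (F G : C -> V3) : open V ->
  smooth3_on V F -> smooth3_on V G -> smooth3_on V (fun z => vadd (F z) (G z)).
Proof.
  intros HV [H1 [H2 H3]] [G1 [G2 G3]]. repeat split; unfold vadd, vx, vy, vz; simpl;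
    apply smooth_plus; assumption.
Qed.

Lemma smooth3_vscal (V : C -> Prop) (f : C -> R) (F : C -> V3) : open V ->
  smooth_on V f -> smooth3_on V F -> smooth3_on V (fun z => vscal (f z) (F z)).
Proof.
  intros HV Hf [H1 [H2 H3]]. repeat split; unfold vscal, vx, vy, vz; simpl;
    apply smooth_mult; assumption.
Qed.

Lemma smooth_dot (V : C -> Prop) (F G : C -> V3) : open V ->
  smooth3_on V F -> smooth3_on V G -> smooth_on V (fun z => dot (F z) (G z)).
Proof.
  intros HV [H1 [H2 H3]] [G1 [G2 G3]]. unfold dot.
  repeat apply smooth_plus; try apply smooth_mult; assumption.
Qed.

Lemma pd_dot (V : C -> Prop) (F G : C -> V3) (z : C) :
  V z -> smooth3_on V F -> smooth3_on V G ->
  pd (fun w => dot (F w) (G w)) z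
    (dot (vD1 F z) (G z) + dot (F z) (vD1 G z))
    (dot (vD2 F z) (G z) + dot (F z) (vD2 G z)).
Proof.
  intros Hz [H1 [H2 H3]] [G1 [G2 G3]]. unfold dot.
  eapply pd_eq;
    [apply pd_plus; [apply pd_plus|]; apply pd_mult; eapply smooth_pd; eassumption| |];
    unfold vD1, vD2, vx, vy, vz; simpl; ring.
Qed.

(** The product rule applied to a relation that holds on all of [V]. Most geometric identities below
    arise by differentiating such a relation. *)
Lemma D_dot_eq (V : C -> Prop) (F G : C -> V3) (f : C -> R) (z : C) : open V -> V z ->
  smooth3_on V F -> smooth3_on V G -> (forall w, V w -> dot (F w) (G w) = f w) ->
  dot (vD1 F z) (G z) + dot (F z) (vD1 G z) = D1 f z /\
  dot (vD2 F z) (G z) + dot (F z) (vD2 G z) = D2 f z.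
Proof.
  intros HV Hz HF HG Hc.
  destruct (pd_D _ _ _ _ (pd_dot V F G z Hz HF HG)) as [<- <-].
  apply D_ext_loc. apply (filter_imp V); [exact Hc|exact (HV z Hz)].
Qed.

Lemma D_const (c : R) (z : C) : D1 (fun _ => c) z = 0 /\ D2 (fun _ => c) z = 0.
Proof. apply pd_D, pd_const. Qed.

Lemma vD_comm (V : C -> Prop) (F : C -> V3) (z : C) : open V -> V z ->
  smooth3_on V F -> vD1 (vD2 F) z = vD2 (vD1 F) z.
Proof.
  intros HV Hz [H1 [H2 H3]].
  apply V3_eq; apply (smooth_Schwarz V); assumption.
Qed.

Definition flat_laplacian (f : C -> R) (z : C) : R := D1 (D1 f) z + D2 (D2 f) z.

Lemma flat_laplacian_ext (V : C -> Prop) (f g : C -> R) (z : C) : open V -> V z ->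
  (forall w, V w -> f w = g w) -> flat_laplacian f z = flat_laplacian g z.
Proof.
  intros HV Hz H. unfold flat_laplacian.
  assert (L : forall w, V w -> D1 f w = D1 g w /\ D2 f w = D2 g w).
  { intros w Hw. apply D_ext_loc, (filter_imp V); [exact H|exact (HV w Hw)]. }
  f_equal; apply D_ext_loc, (filter_imp V); try (exact (HV z Hz)); apply L.
Qed.

Lemma smooth_flat_laplacian (V : C -> Prop) (f : C -> R) : open V -> smooth_on V f ->
  smooth_on V (flat_laplacian f).
Proof.
  intros HV Hf. apply smooth_plus; auto using smooth_D1, smooth_D2.
Qed.

(** In dimension two the conformal factor cancels inside the divergence, and only the outer factor
    [/ m] survives. The function [F] allows the argument to be rewritten where the equation for it
    is known, namely on [V]. *)
Lemma laplacian_conformal (V : C -> Prop) (s : C -> form) (m f F : C -> R) (z : C) :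
  open V -> V z -> (forall w, V w -> s w = Form (m w) 0 (m w)) -> (forall w, V w -> 0 < m w) ->
  (forall w, V w -> f w = F w) -> laplacian s f z = flat_laplacian F z / m z.
Proof.
  intros HV Hz Hs Hm Hf.
  assert (Q : forall w, V w -> sqrt (fdet (s w)) = m w).
  { intros w Hw. rewrite (Hs w Hw). unfold fdet; simpl.
    replace (_ - _) with (m w * m w) by ring. apply sqrt_square. specialize (Hm w Hw). lra. }
  assert (L : forall w, V w -> D1 f w = D1 F w /\ D2 f w = D2 F w).
  { intros w Hw. apply D_ext_loc, (filter_imp V); [exact Hf|exact (HV w Hw)]. }
  unfold laplacian, flat_laplacian. rewrite (Q z Hz).
  unfold Rdiv. rewrite Rmult_comm. f_equal.
  f_equal; apply D_ext_loc, (filter_imp V); try (exact (HV z Hz)); intros w Hw;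
    rewrite (Q w Hw), (Hs w Hw); simpl; destruct (L w Hw) as [-> ->];
    specialize (Hm w Hw); field; lra.
Qed.

(** The form in which the hypothesis on [g] is used in the differential geometry: it mentions only
    the sphere-valued map, so it makes sense where [g] is infinite. *)
Definition conformal_sphere_map (V : C -> Prop) (Y : C -> V3) : Prop :=
  smooth3_on V Y /\
  forall z, V z -> dot (Y z) (Y z) = 1 /\ 0 < dot (vD1 Y z) (vD1 Y z) /\
    dot (vD2 Y z) (vD2 Y z) = dot (vD1 Y z) (vD1 Y z) /\ dot (vD1 Y z) (vD2 Y z) = 0.

Lemma conformal_frame (V : C -> Prop) (Y : C -> V3) (z : C) : open V -> V z ->
  conformal_sphere_map V Y ->
  orthogonal_frame (dot (vD1 Y z) (vD1 Y z)) (vD1 Y z) (vD2 Y z) (Y z).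
Proof.
  intros HV Hz [HY H]. destruct (H z Hz) as [Y1 [EP [E2 E12]]].
  destruct (D_dot_eq V Y Y (fun _ => 1) z HV Hz HY HY (fun w Hw => proj1 (H w Hw))) as [A B].
  destruct (D_const 1 z) as [d1 d2]. rewrite d1 in A. rewrite d2 in B.
  rewrite (dot_comm (Y z)) in A, B.
  repeat split; auto; lra.
Qed.

(* Differentiating the conformality relations shows that the Laplacian of [Y] is
   normal to the sphere. *)
Lemma sphere_map_laplacian (V : C -> Prop) (Y : C -> V3) (z : C) : open V -> V z ->
  conformal_sphere_map V Y ->
  vadd (vD1 (vD1 Y) z) (vD2 (vD2 Y) z) = vscal (-2 * dot (vD1 Y z) (vD1 Y z)) (Y z).
Proof.
  intros HV Hz HC. assert (HC' := HC). destruct HC' as [HY H].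
  assert (H1 := smooth3_vD1 _ _ HY). assert (H2 := smooth3_vD2 _ _ HY).
  assert (FR := conformal_frame V Y z HV Hz HC).
  set (E := dot (vD1 Y z) (vD1 Y z)) in *.
  destruct (D_dot_eq V (vD1 Y) Y (fun _ => 0) z HV Hz H1 HY) as [A1 _].
  { intros w Hw. apply (conformal_frame V Y w HV Hw HC). }
  destruct (D_dot_eq V (vD2 Y) Y (fun _ => 0) z HV Hz H2 HY) as [_ A2].
  { intros w Hw. apply (conformal_frame V Y w HV Hw HC). }
  destruct (D_dot_eq V (vD1 Y) (vD2 Y) (fun _ => 0) z HV Hz H1 H2) as [B1 B2].
  { intros w Hw. apply (H w Hw). }
  destruct (D_dot_eq V (vD2 Y) (vD2 Y) (fun w => dot (vD1 Y w) (vD1 Y w)) z HV Hz H2 H2) as [C1 C2].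
  { intros w Hw. apply (H w Hw). }
  destruct (pd_D _ _ _ _ (pd_dot V (vD1 Y) (vD1 Y) z Hz H1 H1)) as [E1 E2].
  rewrite E1 in C1. rewrite E2 in C2.
  destruct (D_const 0 z) as [d1 d2]. rewrite d1 in A1, B1. rewrite d2 in A2, B2.
  rewrite (vD_comm V Y z HV Hz HY) in *.
  destruct FR as [EP [Haa [Hbb [Hyy [Hab [Hay Hby]]]]]].
  assert (FR := conformal_frame V Y z HV Hz HC). fold E in FR.
  rewrite (frame_decomp E _ _ _ (vadd _ _) FR), !dot_addl.
  rewrite !(dot_comm (vD2 Y z) (vD2 (vD1 Y) z)), !(dot_comm (vD1 Y z) (vD2 (vD1 Y) z)),
    !(dot_comm (vD1 Y z) (vD2 (vD2 Y) z)), !(dot_comm (vD2 Y z) (vD2 (vD2 Y) z)),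
    !(dot_comm (vD1 Y z) (vD1 (vD1 Y) z)) in *.
  replace (dot (vD1 (vD1 Y) z) (vD1 Y z) + dot (vD2 (vD2 Y) z) (vD1 Y z)) with 0 by lra.
  replace (dot (vD1 (vD1 Y) z) (vD2 Y z) + dot (vD2 (vD2 Y) z) (vD2 Y z)) with 0 by lra.
  replace (dot (vD1 (vD1 Y) z) (Y z) + dot (vD2 (vD2 Y) z) (Y z)) with (-2 * E) by (fold E in A1; lra).
  apply V3_eq; unfold vadd, vscal, vx, vy, vz; simpl; field; lra.
Qed.

Lemma flat_laplacian_scal (V : C -> Prop) (k : R) (f : C -> R) (z : C) : open V -> V z ->
  smooth_on V f -> flat_laplacian (fun w => k * f w) z = k * flat_laplacian f z.
Proof.
  intros HV Hz Hf.
  assert (P : forall f, smooth_on V f -> forall w, V w ->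
    D1 (fun w => k * f w) w = k * D1 f w /\ D2 (fun w => k * f w) w = k * D2 f w).
  { intros f0 Hf0 w Hw. apply pd_D. eapply pd_eq;
      [apply pd_mult; [apply pd_const|apply (smooth_pd V); [exact Hf0|exact Hw]]| |];
      cbv beta; ring. }
  unfold flat_laplacian. rewrite Rmult_plus_distr_l.
  destruct (P _ (smooth_D1 _ _ Hf) z Hz) as [<- _].
  destruct (P _ (smooth_D2 _ _ Hf) z Hz) as [_ <-].
  f_equal; apply D_ext_loc, (filter_imp V); try (exact (HV z Hz)); intros w Hw; apply P; assumption.
Qed.

(** * Curvatures of eta and X *)

Lemma form_eq (a b c a' b' c' : R) : a = a' -> b = b' -> c = c' -> Form a b c = Form a' b' c'.
Proof. congruence. Qed.

Section Surface.
Variables (U : C -> Prop) (g : C -> Csphere) (h : C -> R).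
Hypothesis HU : open U.
Hypothesis HC : conformal_sphere_map U (Ymap g).
Hypothesis Hh : smooth_on U h.

Let Y := Ymap g.
Let E z := dot (vD1 Y z) (vD1 Y z).

Definition Ffun (z : C) : R := flat_laplacian h z / f11 (formL g z) + 2 * h z.

Lemma E_pos (z : C) : U z -> 0 < E z.
Proof. intros Hz. apply (proj2 HC z Hz). Qed.

Lemma smooth_E : smooth_on U E.
Proof. apply smooth_dot; auto; apply smooth3_vD1, HC. Qed.

Lemma smooth_eta : smooth3_on U (eta g h).
Proof.
  destruct HC as [HY _]. apply smooth3_vadd; [exact HU| |now apply smooth3_vscal].
  apply smooth3_vscal; [exact HU| |].
  - apply smooth_inv; [exact HU| |exact smooth_E].
    intros z Hz. apply Rgt_not_eq, E_pos, Hz.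
  - apply smooth3_vadd; [exact HU| |]; apply smooth3_vscal; auto using smooth_D1, smooth_D2,
      smooth3_vD1, smooth3_vD2.
Qed.

Lemma smooth_Ffun : smooth_on U Ffun.
Proof.
  apply smooth_plus; [exact HU| |].
  - apply smooth_div; [exact HU| |now apply smooth_flat_laplacian|exact smooth_E].
    intros z Hz. apply Rgt_not_eq, E_pos, Hz.
  - apply smooth_mult; auto. now apply smooth_const.
Qed.

Lemma eta_dots (z : C) : U z ->
  dot (eta g h z) (Y z) = h z /\ dot (eta g h z) (vD1 Y z) = D1 h z /\
  dot (eta g h z) (vD2 Y z) = D2 h z.
Proof.
  intros Hz. assert (F := conformal_frame U Y z HU Hz HC).
  destruct F as [EP [Haa [Hbb [Hyy [Hab [Hay Hby]]]]]].
  unfold eta, gradL. simpl. fold Y.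
  rewrite !dot_addl, !dot_scall, !dot_addl, !dot_scall, Hbb, Hyy, Hay, Hby, Hab,
    (dot_comm (vD2 Y z) (vD1 Y z)), (dot_comm (Y z) (vD1 Y z)), (dot_comm (Y z) (vD2 Y z)),
    Hab, Hay, Hby.
  repeat split; field; lra.
Qed.

Lemma Sfun_eq (z : C) : U z -> Sfun g h z = (D1 h z ^ 2 + D2 h z ^ 2) / E z + h z ^ 2.
Proof.
  intros Hz. destruct (eta_dots z Hz) as [A [B1 B2]].
  unfold Sfun.
  rewrite (frame_decomp _ _ _ _ (eta g h z) (conformal_frame U Y z HU Hz HC)) at 2.
  rewrite !dot_addr, !dot_scalr, A, B1, B2. unfold E. field.
  apply Rgt_not_eq, (E_pos z Hz).
Qed.

Definition a11 (z : C) : R := dot (vD1 (eta g h) z) (vD1 Y z).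
Definition a12 (z : C) : R := dot (vD1 (eta g h) z) (vD2 Y z).
Definition a22 (z : C) : R := dot (vD2 (eta g h) z) (vD2 Y z).

(** Obtained by differentiating <eta, Y> = h and <eta, Y_,i> = h_,i. The first relation gives
    tangency of d eta, the commuting mixed derivatives of [h] and of [Y] give symmetry, and Lap Y =
    - 2 E Y, paired with [eta], gives the trace. *)
Lemma a_facts (z : C) : U z ->
  dot (vD1 (eta g h) z) (Y z) = 0 /\ dot (vD2 (eta g h) z) (Y z) = 0 /\
  dot (vD2 (eta g h) z) (vD1 Y z) = a12 z /\ a11 z + a22 z = E z * Ffun z.
Proof.
  intros Hz. assert (HY := proj1 HC). fold Y in HY.
  assert (H1 := smooth3_vD1 _ _ HY). assert (H2 := smooth3_vD2 _ _ HY).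
  assert (He := smooth_eta).
  destruct (D_dot_eq U (eta g h) Y h z HU Hz He HY) as [A1 A2].
  { intros w Hw. apply (eta_dots w Hw). }
  destruct (D_dot_eq U (eta g h) (vD1 Y) (D1 h) z HU Hz He H1) as [B1 B2].
  { intros w Hw. apply (eta_dots w Hw). }
  destruct (D_dot_eq U (eta g h) (vD2 Y) (D2 h) z HU Hz He H2) as [C1 C2].
  { intros w Hw. apply (eta_dots w Hw). }
  destruct (eta_dots z Hz) as [e [e1 e2]].
  rewrite e1 in A1. rewrite e2 in A2.
  assert (S1 := smooth_Schwarz U h z HU Hz Hh).
  assert (S2 := vD_comm U Y z HU Hz HY).
  assert (L := sphere_map_laplacian U Y z HU Hz HC).
  apply (f_equal (dot (eta g h z))) in L. rewrite dot_addr, dot_scalr, e in L.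
  unfold a11, a12, a22, Ffun, flat_laplacian. simpl. fold Y. fold (E z) in L |- *.
  split; [lra|]. split; [lra|]. rewrite S2, S1 in C1. split; [lra|].
  field_simplify; [|apply Rgt_not_eq, (E_pos z Hz)].
  lra.
Qed.

Lemma deta (z : C) : U z ->
  vD1 (eta g h) z = vadd (vscal (a11 z / E z) (vD1 Y z)) (vscal (a12 z / E z) (vD2 Y z)) /\
  vD2 (eta g h) z = vadd (vscal (a12 z / E z) (vD1 Y z)) (vscal (a22 z / E z) (vD2 Y z)).
Proof.
  intros Hz. destruct (a_facts z Hz) as [A1 [A2 [A3 _]]].
  assert (F := conformal_frame U Y z HU Hz HC).
  split.
  - etransitivity; [exact (frame_decomp _ _ _ _ _ F)|].
    rewrite A1; apply V3_eq; unfold a11, a12, a22, E, vadd, vscal, vx, vy, vz; simpl; ring.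
  - etransitivity; [exact (frame_decomp _ _ _ _ _ F)|].
    rewrite A2, A3; apply V3_eq; unfold a11, a12, a22, E, vadd, vscal, vx, vy, vz; simpl; ring.
Qed.

(** If the determinant vanished, the rows of the adjugate matrix would give vanishing combinations
    of the two partial derivatives. The immersion property then forces all four entries to be 0,
    hence [vD1 X z] to vanish, a contradiction. *)
Lemma immersion_det (X : C -> V3) (z : C) (p q r s : R) (a b : V3) :
  immersion_on U X -> U z ->
  vD1 X z = vadd (vscal p a) (vscal q b) -> vD2 X z = vadd (vscal r a) (vscal s b) ->
  p * s - q * r <> 0.
Proof.
  intros HX Hz H1 H2 H0. assert (I := HX z Hz). rewrite H1, H2 in I.
  destruct (I s (- q)) as [E1 E2].
  { apply V3_eq; [transitivity ((p * s - q * r) * vx a)|transitivity ((p * s - q * r) * vy a)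
      |transitivity ((p * s - q * r) * vz a)]; try (rewrite H0; unfold vx, vy, vz; simpl; ring);
      unfold vadd, vscal, vx, vy, vz; simpl; ring. }
  destruct (I (- r) p) as [E3 E4].
  { apply V3_eq; [transitivity ((p * s - q * r) * vx b)|transitivity ((p * s - q * r) * vy b)
      |transitivity ((p * s - q * r) * vz b)]; try (rewrite H0; unfold vx, vy, vz; simpl; ring);
      unfold vadd, vscal, vx, vy, vz; simpl; ring. }
  destruct (I 1 0) as [E5 _]; [|lra].
  assert (q = 0) as -> by lra. assert (p = 0) as -> by lra.
  apply V3_eq; unfold vadd, vscal, vx, vy, vz; simpl; ring.
Qed.

Lemma formIII_Y (z : C) : U z -> formIII Y z = Form (E z) 0 (E z).
Proof.
  intros Hz. destruct (proj2 HC z Hz) as [_ [_ [E2 E12]]]. fold Y in E2, E12.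
  unfold formIII, formI. rewrite E2, E12. reflexivity.
Qed.

Lemma laguerre_H_over_K (z : C) : immersion_on U (eta g h) -> U z ->
  mean_curv (eta g h) Y z / gauss_curv (eta g h) Y z = - / 2 * Ffun z.
Proof.
  intros HI Hz. destruct (deta z Hz) as [d1 d2].
  assert (D := immersion_det _ z _ _ _ _ _ _ HI Hz d1 d2).
  destruct (a_facts z Hz) as [_ [_ [A3 A4]]].
  destruct (conformal_frame U Y z HU Hz HC) as [EP [Haa [Hbb [Hyy [Hab [Hay Hby]]]]]].
  fold (E z) in EP, Haa, Hbb.
  (* Regularity of [eta] makes the matrix a invertible. The determinant of I is the square of det a
     divided by E^2, so every denominator in H and K is nonzero. *)
  assert (D' : a11 z * a22 z - a12 z * a12 z <> 0).
  { intros D0. apply D. apply (Rmult_eq_reg_l (E z * E z)); [|nra].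
    rewrite <- (Rmult_0_r (E z * E z)) in D0. field_simplify; [|lra].
    replace (a11 z * a22 z - a12 z ^ 2) with (a11 z * a22 z - a12 z * a12 z) by ring. lra. }
  assert (II : formII (eta g h) Y z = Form (- a11 z) (- a12 z) (- a22 z)).
  { unfold formII. apply form_eq; f_equal; rewrite dot_comm; [reflexivity| |reflexivity].
    exact A3. }
  assert (I : formI (eta g h) z = Form ((a11 z ^ 2 + a12 z ^ 2) / E z)
     ((a11 z + a22 z) * a12 z / E z) ((a12 z ^ 2 + a22 z ^ 2) / E z)).
  { unfold formI. rewrite d1, d2.
    apply form_eq; rewrite ?dot_addl, ?dot_addr, ?dot_scall, ?dot_scalr, ?dot_addr, ?dot_scalr, Hbb, Hab,
      (dot_comm (vD2 Y z) (vD1 Y z)), Hab; fold (E z); field; lra. }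
  unfold mean_curv, gauss_curv. rewrite I, II. unfold fdet; simpl.
  apply (Rmult_eq_reg_l (E z)); [|lra].
  transitivity (- / 2 * (a11 z + a22 z)); [|rewrite A4; field].
  assert (N : (a11 z * a22 z - a12 z * a12 z) * (a11 z * a22 z - a12 z * a12 z) <> 0)
    by now apply Rmult_integral_contrapositive_currified.
  field. repeat split; try lra; intros K; apply N; rewrite <- K; ring.
Qed.

Lemma laguerre_iff : immersion_on U (eta g h) ->
  (laguerre_minimal U (eta g h) Y <-> forall z, U z -> flat_laplacian Ffun z = 0).
Proof.
  intros HI.
  assert (Q : forall z, U z -> laplacian (formIII Y)
     (fun w => mean_curv (eta g h) Y w / gauss_curv (eta g h) Y w) z
     = - / 2 * flat_laplacian Ffun z / E z).
  { intros z Hz. rewrite (laplacian_conformal U _ E _ (fun w => - / 2 * Ffun w) z HU Hz).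
    - f_equal. apply (flat_laplacian_scal U); [exact HU|exact Hz|apply smooth_Ffun].
    - exact formIII_Y.
    - exact E_pos.
    - intros w Hw. now apply laguerre_H_over_K. }
  split.
  - intros H z Hz. specialize (H z Hz). rewrite (Q z Hz) in H.
    assert (P := E_pos z Hz).
    replace (flat_laplacian Ffun z) with (-2 * E z * (- / 2 * flat_laplacian Ffun z / E z))
      by (field; lra).
    rewrite H; ring.
  - intros H z Hz. rewrite (Q z Hz), (H z Hz). field. apply Rgt_not_eq, E_pos, Hz.
Qed.

(** * The surface [X], its Gauss map and its spherical curvatures *)

Variable c : R.
Hypothesis Hc : c <> 0.
Hypothesis Hn : forall z, U z -> h z <> 0.

Let S := Sfun g h.
Let N := Nmap g h.
Let X := Xmap g c h.

Lemma S_pos (z : C) : U z -> 0 < S z.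
Proof.
  intros Hz. unfold S. rewrite (Sfun_eq z Hz). specialize (Hn z Hz).
  assert (P := E_pos z Hz). assert (0 <= (D1 h z ^ 2 + D2 h z ^ 2) / E z); [|nra].
  apply Rmult_le_pos; [nra|]. left. now apply Rinv_0_lt_compat.
Qed.

Lemma smooth_S : smooth_on U S.
Proof. apply smooth_dot; auto; apply smooth_eta. Qed.

Lemma smooth_reflected (m : C -> R) : smooth_on U m ->
  smooth3_on U (fun z => vadd (Y z) (vscal (- (2 * m z / S z)) (eta g h z))).
Proof.
  intros Hm. apply smooth3_vadd; [exact HU|apply HC|].
  apply smooth3_vscal; [exact HU| |apply smooth_eta].
  apply smooth_opp; [exact HU|]. apply smooth_div; [exact HU| | |apply smooth_S].
  - intros z Hz. apply Rgt_not_eq, S_pos, Hz.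
  - apply smooth_mult; auto. now apply smooth_const.
Qed.

(* [F1], [F2] are the images of [Y_{,1}], [Y_{,2}] under the reflection in the plane
   orthogonal to [eta], which maps [Y] to [N]. *)
Let F1 z := vadd (vD1 Y z) (vscal (- (2 * D1 h z / S z)) (eta g h z)).
Let F2 z := vadd (vD2 Y z) (vscal (- (2 * D2 h z / S z)) (eta g h z)).

Lemma dS (z : C) : U z ->
  pd S z (2 * (D1 h z * a11 z + D2 h z * a12 z) / E z)
         (2 * (D1 h z * a12 z + D2 h z * a22 z) / E z).
Proof.
  intros Hz. destruct (eta_dots z Hz) as [_ [e1 e2]]. destruct (deta z Hz) as [d1 d2].
  eapply pd_eq; [apply (pd_dot U _ _ z Hz smooth_eta smooth_eta)| |];
    rewrite ?d1, ?d2, dot_addl, dot_addr, !dot_scall, !dot_scalr, e1, e2,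
      !(dot_comm _ (eta g h z)), e1, e2; field; apply Rgt_not_eq, E_pos, Hz.
Qed.

(** [m = h] gives the Gauss map and [m = h + c] gives [X]. These two functions differ by a constant,
    so one computation serves both: in the reflected frame the differential is the identity plus [k]
    times the matrix a. *)
Lemma d_reflected (m : C -> R) (z : C) : U z -> smooth_on U m ->
  D1 m z = D1 h z -> D2 m z = D2 h z ->
  let k := - (2 * m z / (S z * E z)) in
  let Z := fun z => vadd (Y z) (vscal (- (2 * m z / S z)) (eta g h z)) in
  vD1 Z z = vadd (vscal (1 + k * a11 z) (F1 z)) (vscal (k * a12 z) (F2 z)) /\
  vD2 Z z = vadd (vscal (k * a12 z) (F1 z)) (vscal (1 + k * a22 z) (F2 z)).
Proof.
  intros Hz Hm m1 m2 k Z.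
  destruct (deta z Hz) as [d1 d2].
  assert (PE := E_pos z Hz). assert (PS := S_pos z Hz).
  (* The computation for a single coordinate, [y] of the sphere map and [e] of [eta]. *)
  assert (key : forall y e : C -> R, smooth_on U y -> smooth_on U e ->
    D1 e z = a11 z / E z * D1 y z + a12 z / E z * D2 y z ->
    D2 e z = a12 z / E z * D1 y z + a22 z / E z * D2 y z ->
    pd (fun w => y w + - (2 * m w / S w) * e w) z
      ((1 + k * a11 z) * (D1 y z + - (2 * D1 h z / S z) * e z)
       + k * a12 z * (D2 y z + - (2 * D2 h z / S z) * e z))
      (k * a12 z * (D1 y z + - (2 * D1 h z / S z) * e z)
       + (1 + k * a22 z) * (D2 y z + - (2 * D2 h z / S z) * e z))).
  { intros y e Hy He e1 e2. eapply pd_eq.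
    - apply pd_plus; [apply (smooth_pd U y z Hy Hz)|].
      apply pd_mult; [|apply (smooth_pd U e z He Hz)].
      apply pd_opp, pd_div; [lra| |apply (dS z Hz)].
      apply pd_mult; [apply pd_const|apply (smooth_pd U m z Hm Hz)].
    - cbv beta. rewrite e1, m1. unfold k. field. lra.
    - cbv beta. rewrite e2, m2. unfold k. field. lra. }
  assert (HY := proj1 HC). assert (He := smooth_eta).
  destruct (pd_D _ _ _ _ (key _ _ (proj1 HY) (proj1 He) (f_equal vx d1) (f_equal vx d2))).
  destruct (pd_D _ _ _ _ (key _ _ (proj1 (proj2 HY)) (proj1 (proj2 He)) (f_equal vy d1) (f_equal vy d2))).
  destruct (pd_D _ _ _ _ (key _ _ (proj2 (proj2 HY)) (proj2 (proj2 He)) (f_equal vz d1) (f_equal vz d2))).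
  split; apply V3_eq; assumption.
Qed.

Lemma reflected_frame (z : C) : U z -> orthogonal_frame (E z) (F1 z) (F2 z) (N z).
Proof.
  intros Hz. destruct (eta_dots z Hz) as [e [e1 e2]].
  destruct (conformal_frame U Y z HU Hz HC) as [EP [Haa [Hbb [Hyy [Hab [Hay Hby]]]]]].
  fold (E z) in EP, Hbb.
  assert (PS := S_pos z Hz).
  assert (e' := e). assert (e1' := e1). assert (e2' := e2).
  rewrite dot_comm in e', e1', e2'. change (dot (vD1 Y z) (vD1 Y z) = E z) in Haa.
  assert (SS : dot (eta g h z) (eta g h z) = S z) by reflexivity.
  unfold orthogonal_frame, F1, F2, N, Nmap. fold S. fold Y.
  rewrite ?dot_addl, ?dot_scall, ?dot_addr, ?dot_scalr, ?Haa, ?Hbb, ?Hyy, ?Hay, ?Hby, ?Hab,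
    ?SS, ?e, ?e1, ?e2, ?e', ?e1', ?e2'.
  repeat split; try field; lra.
Qed.

(** The second identity is h = - c / (R + 1) solved for R. It shows that 1 + R = - c / h never
    vanishes, so that [sigma] will be a genuine metric. *)
Lemma X_N_dots (z : C) : U z ->
  support X N z - 1 = 2 * h z * c / S z /\ radius X N z = - (h z + c) / h z.
Proof.
  intros Hz. destruct (eta_dots z Hz) as [e _].
  destruct (conformal_frame U Y z HU Hz HC) as [_ [_ [_ [Hyy _]]]].
  assert (PS := S_pos z Hz). specialize (Hn z Hz).
  assert (e' := e). rewrite dot_comm in e'.
  assert (SS : dot (eta g h z) (eta g h z) = S z) by reflexivity.
  assert (A : support X N z - 1 = 2 * h z * c / S z).
  { unfold support, X, N, Xmap, Nmap. fold S. fold Y.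
    rewrite ?dot_addl, ?dot_scall, ?dot_addr, ?dot_scalr, Hyy, ?SS, ?e, ?e'.
    field; lra. }
  split; [exact A|]. unfold radius. rewrite A.
  unfold X, Xmap. fold S. fold Y.
  rewrite ?dot_addl, ?dot_scall, ?dot_addr, ?dot_scalr, Hyy, ?SS, ?e, ?e'.
  field. repeat split; lra.
Qed.

Let R0 z := - (h z + c) / h z.
(** The factor [k] of [d_reflected] is [- b] for the Gauss map and [R0 * b] for [X]. *)
Let b z := 2 * h z / (S z * E z).

Lemma dN (z : C) : U z ->
  vD1 N z = vadd (vscal (1 - b z * a11 z) (F1 z)) (vscal (- (b z * a12 z)) (F2 z)) /\
  vD2 N z = vadd (vscal (- (b z * a12 z)) (F1 z)) (vscal (1 - b z * a22 z) (F2 z)).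
Proof.
  intros Hz. destruct (d_reflected h z Hz Hh eq_refl eq_refl) as [H1 H2].
  unfold b. split; [etransitivity; [exact H1|]|etransitivity; [exact H2|]]; f_equal; f_equal; ring.
Qed.

Lemma dX (z : C) : U z ->
  vD1 X z = vadd (vscal (1 + R0 z * (b z * a11 z)) (F1 z)) (vscal (R0 z * (b z * a12 z)) (F2 z)) /\
  vD2 X z = vadd (vscal (R0 z * (b z * a12 z)) (F1 z)) (vscal (1 + R0 z * (b z * a22 z)) (F2 z)).
Proof.
  intros Hz. assert (PE := E_pos z Hz). assert (PS := S_pos z Hz). assert (n := Hn z Hz).
  assert (D : pd (fun w => h w + c) z (D1 h z) (D2 h z)).
  { eapply pd_eq; [apply pd_plus; [apply (smooth_pd U h z Hh Hz)|apply pd_const]| |]; ring. }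
  destruct (pd_D _ _ _ _ D) as [D1' D2'].
  destruct (d_reflected (fun w => h w + c) z Hz) as [H1 H2]; auto.
  { apply smooth_plus; auto. now apply smooth_const. }
  unfold b, R0. split; [etransitivity; [exact H1|]|etransitivity; [exact H2|]];
    f_equal; f_equal; field; lra.
Qed.

(** In dX + R dN the terms containing the matrix a cancel. What remains is 1 + R times the reflected
    frame, whose vectors are orthogonal with squared length [E]. *)
Lemma sigma_eq (z : C) : U z ->
  Defs.sigma X N z = Form ((1 + R0 z) ^ 2 * E z) 0 ((1 + R0 z) ^ 2 * E z).
Proof.
  intros Hz. destruct (dX z Hz) as [x1 x2]. destruct (dN z Hz) as [n1 n2].
  destruct (reflected_frame z Hz) as [EP [Haa [Hbb [_ [Hab _]]]]].
  assert (Hba := Hab). rewrite dot_comm in Hba.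
  unfold Defs.sigma, formI, formII, formIII, formI, fadd, fscal. simpl.
  destruct (X_N_dots z Hz) as [_ ->]. fold (R0 z). rewrite x1, x2, n1, n2.
  rewrite ?dot_addl, ?dot_scall, ?dot_addr, ?dot_scalr, Haa, Hbb, Hab, Hba.
  apply form_eq; ring.
Qed.

(** [s1 + s2] is symmetric in the principal curvatures, so only their sum 2 H and product K enter.
    The product formula needs H^2 - K to be nonnegative, since [sqrt] is 0 on negative numbers. *)
Lemma spherical_mean_curv_eq (z : C) : immersion_on U X -> U z ->
  spherical_mean_curv X N z = b z * (a11 z + a22 z) / 2.
Proof.
  intros HI Hz. destruct (dX z Hz) as [x1 x2]. destruct (dN z Hz) as [n1 n2].
  destruct (reflected_frame z Hz) as [EP [Haa [Hbb [_ [Hab _]]]]].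
  assert (Hba := Hab). rewrite dot_comm in Hba.
  assert (D := immersion_det _ z _ _ _ _ _ _ HI Hz x1 x2).
  assert (HR : 1 + R0 z <> 0).
  { unfold R0. intros K. apply (f_equal (Rmult (h z))) in K. field_simplify in K; [|auto]. lra. }
  (* With the symmetric matrix P of entries [p], [q], [r], the differentials of [N] and [X] in the
     reflected frame are 1 - P and 1 + R P, and [Dt] is the determinant of the latter. *)
  set (p := b z * a11 z) in *. set (q := b z * a12 z) in *. set (r := b z * a22 z) in *.
  set (R := R0 z) in *. set (e := E z) in *.
  set (Dt := (1 + R * p) * (1 + R * r) - R * q * (R * q)) in *.
  assert (HH : mean_curv X N z =
    - ((1 + R * r) * (1 - p) + (1 + R * p) * (1 - r) + 2 * R * q ^ 2) / (2 * Dt)).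
  { unfold mean_curv, formI, formII, fdet. simpl. rewrite x1, x2, n1, n2.
    rewrite ?dot_addl, ?dot_scall, ?dot_addr, ?dot_scalr, Haa, Hbb, Hab, Hba.
    match goal with |- _ / (2 * ?d) = _ =>
      replace d with (e ^ 2 * Dt ^ 2) by (unfold Dt; ring) end.
    apply (Rmult_eq_reg_r (2 * (e ^ 2 * Dt ^ 2)));
      [|apply Rmult_integral_contrapositive_currified; [lra|];
        apply Rmult_integral_contrapositive_currified; apply pow_nonzero; lra].
    field_simplify; [unfold Dt; ring|lra|split; lra]. }
  assert (HK : gauss_curv X N z = ((1 - p) * (1 - r) - q ^ 2) / Dt).
  { unfold gauss_curv, formI, formII, fdet. simpl. rewrite x1, x2, n1, n2.
    rewrite ?dot_addl, ?dot_scall, ?dot_addr, ?dot_scalr, Haa, Hbb, Hab, Hba.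
    match goal with |- _ / ?d = _ =>
      replace d with (e ^ 2 * Dt ^ 2) by (unfold Dt; ring) end.
    apply (Rmult_eq_reg_r (e ^ 2 * Dt ^ 2));
      [|apply Rmult_integral_contrapositive_currified; apply pow_nonzero; lra].
    field_simplify; [unfold Dt; ring|lra|split; lra]. }
  (* The discriminant is a sum of squares, built from the trace-free part of P. *)
  assert (HD : mean_curv X N z ^ 2 - gauss_curv X N z =
    (1 + R) ^ 2 * ((p - r) ^ 2 + 4 * q ^ 2) * (/ (2 * Dt)) ^ 2).
  { rewrite HH, HK. unfold Dt in *. field. exact D. }
  assert (HP : 0 <= mean_curv X N z ^ 2 - gauss_curv X N z).
  { rewrite HD. apply Rmult_le_pos; [apply Rmult_le_pos|]; try apply pow2_ge_0.
    generalize (pow2_ge_0 (p - r)) (pow2_ge_0 q). lra. }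
  assert (Hk : k1 X N z * k2 X N z = gauss_curv X N z).
  { unfold k1, k2. transitivity (mean_curv X N z ^ 2 -
      sqrt (mean_curv X N z ^ 2 - gauss_curv X N z) * sqrt (mean_curv X N z ^ 2 - gauss_curv X N z));
      [ring|]. rewrite sqrt_sqrt by exact HP. ring. }
  assert (Hs : k1 X N z + k2 X N z = 2 * mean_curv X N z) by (unfold k1, k2; ring).
  unfold spherical_mean_curv, s1, s2. destruct (X_N_dots z Hz) as [_ ->]. fold (R0 z). fold R.
  (* The product of the denominators of [s1] and [s2] is nonzero, hence so is each of them. *)
  assert (HQ : (1 - k1 X N z * R) * (1 - k2 X N z * R) = (1 + R) ^ 2 / Dt).
  { transitivity (1 - (k1 X N z + k2 X N z) * R + (k1 X N z * k2 X N z) * R ^ 2); [ring|].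
    rewrite Hs, Hk, HH, HK. apply (Rmult_eq_reg_r Dt); [|exact D].
    field_simplify; [unfold Dt; ring|lra|lra]. }
  assert (HQ0 : (1 - k1 X N z * R) * (1 - k2 X N z * R) <> 0).
  { rewrite HQ. apply Rmult_integral_contrapositive_currified;
      [now apply pow_nonzero|now apply Rinv_neq_0_compat]. }
  assert (1 - k1 X N z * R <> 0 /\ 1 - k2 X N z * R <> 0) as [Q1 Q2].
  { split; intros K; apply HQ0; rewrite K; ring. }
  replace (b z * (a11 z + a22 z)) with (p + r) by (unfold p, r; ring).
  transitivity (((2 + (k1 X N z + k2 X N z) * (1 - R) - 2 * (k1 X N z * k2 X N z) * R)
     / ((1 - k1 X N z * R) * (1 - k2 X N z * R))) / 2); [field; split; assumption|].
  rewrite HQ, Hs, Hk, HH, HK. f_equal.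
  apply (Rmult_eq_reg_r ((1 + R) ^ 2)); [|now apply pow_nonzero].
  field_simplify; [unfold Dt; field; exact D|split; assumption].
Qed.

Lemma H2_iff : immersion_on U X ->
  (H2_surface U X N <-> forall z, U z -> flat_laplacian Ffun z = 0).
Proof.
  intros HI.
  assert (HR : forall z, U z -> 0 < (1 + R0 z) ^ 2 * E z).
  { intros z Hz. apply Rmult_lt_0_compat; [|now apply E_pos].
    assert (n := Hn z Hz). apply pow2_gt_0. unfold R0. intros K.
    apply (f_equal (Rmult (h z))) in K. field_simplify in K; [|auto]. lra. }
  assert (Q : forall z, U z -> laplacian (Defs.sigma X N)
     (fun w => spherical_mean_curv X N w / (support X N w - 1)) z
     = / (2 * c) * flat_laplacian Ffun z / ((1 + R0 z) ^ 2 * E z)).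
  { intros z Hz.
    rewrite (laplacian_conformal U _ (fun z => (1 + R0 z) ^ 2 * E z) _
      (fun w => / (2 * c) * Ffun w) z HU Hz sigma_eq HR).
    - f_equal. apply (flat_laplacian_scal U); [exact HU|exact Hz|apply smooth_Ffun].
    - intros w Hw. rewrite (spherical_mean_curv_eq w HI Hw).
      destruct (X_N_dots w Hw) as [-> _]. destruct (a_facts w Hw) as [_ [_ [_ ->]]].
      unfold b. assert (P1 := S_pos w Hw). assert (P2 := E_pos w Hw). assert (n := Hn w Hw).
      field. repeat split; lra. }
  split.
  - intros H z Hz. specialize (H z Hz). rewrite (Q z Hz) in H.
    assert (P := HR z Hz).
    replace (flat_laplacian Ffun z) with (2 * c * ((1 + R0 z) ^ 2 * E z) *
      (/ (2 * c) * flat_laplacian Ffun z / ((1 + R0 z) ^ 2 * E z)));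
      [rewrite H; ring|].
    set (m := (1 + R0 z) ^ 2 * E z) in *. field; lra.
  - intros H z Hz. rewrite (Q z Hz), (H z Hz). assert (P := HR z Hz).
    set (m := (1 + R0 z) ^ 2 * E z) in *. field; lra.
Qed.
End Surface.

(** * The differential equation *)

Definition log_stereo (y : R) : R := / 2 * ln ((1 - y) / (1 + y)).

Lemma exp_log_stereo (y : R) : -1 < y < 1 -> exp (2 * log_stereo y) = (1 - y) / (1 + y).
Proof.
  intros Hy. unfold log_stereo. rewrite <- Rmult_assoc, Rinv_r, Rmult_1_l by lra.
  apply exp_ln. apply Rdiv_lt_0_compat; lra.
Qed.

(** Here 1 + exp (2 u) = 2 / (1 + y), so the quotient becomes a combination of 1, u, y and u y. *)
Lemma h_rot_log_stereo (a2 a3 c1 c2 y : R) : -1 < y < 1 ->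
  let u := log_stereo y in
  h_rot a2 a3 c1 c2 u = ((1 + y) * (a2 + c1 * u) + (1 - y) * (a3 + c2 * u)) / 2.
Proof.
  intros Hy u. unfold h_rot, u. rewrite exp_log_stereo by exact Hy. field. lra.
Qed.

Section Parallel.
Variables (V : C -> Prop) (u : C -> R).
Hypothesis HV : open V.
Hypothesis Hu : smooth_on V u.
Hypothesis Hreg : forall z, V z -> 0 < D1 u z ^ 2 + D2 u z ^ 2.
Hypothesis Hharm : forall z, V z -> flat_laplacian u z = 0.

(** The substitute for f = phi(u): the factor [k] plays the role of phi'(u) and the last equation
    that of Lap f = phi''(u) |grad u|^2, which relies on u being harmonic. As grad k is again
    parallel to grad u, the lemma can be applied to [k] in turn. *)
Lemma parallel_gradient (f : C -> R) : smooth_on V f ->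
  (forall z, V z -> D1 f z * D2 u z = D2 f z * D1 u z) ->
  exists k : C -> R, smooth_on V k /\ forall z, V z ->
    D1 f z = k z * D1 u z /\ D2 f z = k z * D2 u z /\
    D1 k z * D2 u z = D2 k z * D1 u z /\
    flat_laplacian f z = D1 k z * D1 u z + D2 k z * D2 u z.
Proof.
  intros Hf Hp.
  pose (k := fun z => (D1 f z * D1 u z + D2 f z * D2 u z) / (D1 u z ^ 2 + D2 u z ^ 2)).
  assert (f1 := smooth_D1 _ _ Hf). assert (f2 := smooth_D2 _ _ Hf).
  assert (u1 := smooth_D1 _ _ Hu). assert (u2 := smooth_D2 _ _ Hu).
  assert (Hk : smooth_on V k).
  { apply smooth_div; [exact HV| | |].
    - intros z Hz. apply Rgt_not_eq, Hreg, Hz.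
    - apply smooth_plus; auto using smooth_mult.
    - apply smooth_plus; auto using smooth_pow. }
  exists k. split; [exact Hk|].
  assert (K : forall z, V z -> D1 f z = k z * D1 u z /\ D2 f z = k z * D2 u z).
  { intros z Hz. assert (P := Hreg z Hz). assert (Q := Hp z Hz). unfold k.
    split; apply (Rmult_eq_reg_r (D1 u z ^ 2 + D2 u z ^ 2)); try lra; field_simplify; try lra.
    - replace (D1 u z * D2 u z * D2 f z) with (D2 f z * D1 u z * D2 u z) by ring.
      rewrite <- Q. ring.
    - replace (D1 f z * D1 u z * D2 u z) with (D1 f z * D2 u z * D1 u z) by ring.
      replace (D1 u z * D2 u z * D1 f z) with (D1 f z * D2 u z * D1 u z) by ring.
      rewrite Q. ring. }
  intros z Hz. destruct (K z Hz) as [K1 K2].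
  assert (d1 : pd (fun w => k w * D1 u w) z (D1 k z * D1 u z + k z * D1 (D1 u) z)
                  (D2 k z * D1 u z + k z * D2 (D1 u) z)).
  { apply pd_mult; apply (smooth_pd V); assumption. }
  assert (d2 : pd (fun w => k w * D2 u w) z (D1 k z * D2 u z + k z * D1 (D2 u) z)
                  (D2 k z * D2 u z + k z * D2 (D2 u) z)).
  { apply pd_mult; apply (smooth_pd V); assumption. }
  apply pd_D in d1. apply pd_D in d2. destruct d1 as [d11 d12], d2 as [d21 d22].
  assert (L1 : D1 (D1 f) z = D1 (fun w => k w * D1 u w) z /\ D2 (D1 f) z = D2 (fun w => k w * D1 u w) z).
  { apply D_ext_loc, (filter_imp V); [apply K|exact (HV z Hz)]. }
  assert (L2 : D1 (D2 f) z = D1 (fun w => k w * D2 u w) z /\ D2 (D2 f) z = D2 (fun w => k w * D2 u w) z).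
  { apply D_ext_loc, (filter_imp V); [apply K|exact (HV z Hz)]. }
  destruct L1 as [L11 L12], L2 as [L21 L22].
  (* Commuting second derivatives of [f] and of [u], together with grad f = k grad u, make grad k
     parallel to grad u. *)
  assert (S1 := smooth_Schwarz V f z HV Hz Hf). assert (S2 := smooth_Schwarz V u z HV Hz Hu).
  assert (H0 := Hharm z Hz). unfold flat_laplacian in *.
  repeat split; [exact K1|exact K2| |].
  - rewrite S2 in d21. lra.
  - rewrite L11, L22, d11, d22.
    replace (D1 (D1 u) z) with (- D2 (D2 u) z) by lra. ring.
Qed.
End Parallel.

(** * The height on the sphere and its harmonic reparametrization *)

Section Sphere.
Variables (V : C -> Prop) (g : C -> Csphere) (h : C -> R).
Hypothesis HV : open V.
Hypothesis HC : conformal_sphere_map V (Ymap g).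
Hypothesis Hh : smooth_on V h.

Let Y := Ymap g.
Let y z := vz (Y z).
Let u z := log_stereo (y z).
Let E z := dot (vD1 Y z) (vD1 Y z).
Hypothesis Hy : forall z, V z -> -1 < y z < 1.

Lemma smooth_height : smooth_on V y.
Proof. apply HC. Qed.

(** The first identity is the third coordinate of the expansion of e3 in the frame of [Y]: 1 = |grad
    y|^2 / E + y^2. The second is the third coordinate of Lap Y = - 2 E Y. *)
Lemma height_gradient (z : C) : V z ->
  D1 y z ^ 2 + D2 y z ^ 2 = E z * (1 - y z ^ 2) /\ flat_laplacian y z = -2 * E z * y z.
Proof.
  intros Hz. assert (F := conformal_frame V Y z HV Hz HC). split.
  - assert (D := frame_decomp _ _ _ _ (0, 0, 1) F).
    assert (EP := proj1 F). fold (E z) in D, EP.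
    apply (f_equal (fun v => vz v)) in D. unfold vadd, vscal, dot, vx, vy, vz in D. simpl in D.
    unfold y, vz in *. unfold D1, D2 in *. field_simplify in D; [|lra..].
    set (p := Derive _ _) in *. set (q := Derive _ _) in *. set (s := snd (Y z)) in *.
    apply (f_equal (Rmult (E z))) in D. field_simplify in D; [|lra..]. nra.
  - exact (f_equal vz (sphere_map_laplacian V Y z HV Hz HC)).
Qed.

Lemma D_log (z : C) : V z -> pd u z (- D1 y z / (1 - y z ^ 2)) (- D2 y z / (1 - y z ^ 2)).
Proof.
  intros Hz. assert (B := Hy z Hz).
  assert (is_derive log_stereo (y z) (- / (1 - y z ^ 2))).
  { unfold log_stereo. auto_derive.
    - split; [lra|split; [|exact I]]. apply Rdiv_lt_0_compat; lra.
    - field. repeat split; try lra. nra. }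
  eapply pd_eq; [apply (pd_comp log_stereo y); [eassumption|apply (smooth_pd V); [apply smooth_height|exact Hz]]| |];
    field; nra.
Qed.

Lemma smooth_log : smooth_on V u.
Proof.
  assert (S := smooth_height).
  apply smooth_mult; [exact HV|now apply smooth_const|]. apply smooth_ln; [exact HV| |].
  - intros z Hz. specialize (Hy z Hz). apply Rdiv_lt_0_compat; lra.
  - apply smooth_div; [exact HV| | |].
    + intros z Hz. specialize (Hy z Hz). lra.
    + apply smooth_minus; auto. now apply smooth_const.
    + apply smooth_plus; auto. now apply smooth_const.
Qed.

(** Up to sign [u] is the Mercator latitude. As grad u = - grad y / (1 - y^2), the numerator of Lap
    u is a multiple of (1 - y^2) Lap y + 2 y |grad y|^2, which vanishes by [height_gradient]. *)
Lemma log_facts (z : C) : V z ->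
  D1 y z = - (1 - y z ^ 2) * D1 u z /\ D2 y z = - (1 - y z ^ 2) * D2 u z /\
  (D1 u z ^ 2 + D2 u z ^ 2) * (1 - y z ^ 2) = E z /\ flat_laplacian u z = 0.
Proof.
  intros Hz. assert (B := Hy z Hz). assert (0 < 1 - y z ^ 2) by nra.
  destruct (pd_D _ _ _ _ (D_log z Hz)) as [e1 e2].
  destruct (height_gradient z Hz) as [G L].
  rewrite e1, e2. split; [field; lra|]. split; [field; lra|]. split.
  - transitivity ((D1 y z ^ 2 + D2 y z ^ 2) / (1 - y z ^ 2)); [field; lra|].
    rewrite G. field; lra.
  - assert (P : forall f, smooth_on V f -> pd (fun w => - f w / (1 - y w ^ 2)) z
      ((- D1 f z * (1 - y z ^ 2) - f z * (2 * y z * D1 y z)) / (1 - y z ^ 2) ^ 2)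
      ((- D2 f z * (1 - y z ^ 2) - f z * (2 * y z * D2 y z)) / (1 - y z ^ 2) ^ 2)).
    { intros f Hf. assert (Y1 := smooth_pd V y z smooth_height Hz).
      eapply pd_eq; [apply pd_div; [lra|apply pd_opp, (smooth_pd V f z Hf Hz)|
        apply pd_minus; [apply pd_const|apply (pd_ext (fun w => y w * y w)); [intros; ring|apply pd_mult; exact Y1]]]| |];
        cbv beta; field; lra. }
    unfold flat_laplacian.
    assert (L1 : D1 (D1 u) z = D1 (fun w => - D1 y w / (1 - y w ^ 2)) z).
    { apply D_ext_loc, (filter_imp V); [|exact (HV z Hz)].
      intros w Hw. apply (pd_D _ _ _ _ (D_log w Hw)). }
    assert (L2 : D2 (D2 u) z = D2 (fun w => - D2 y w / (1 - y w ^ 2)) z).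
    { apply D_ext_loc, (filter_imp V); [|exact (HV z Hz)].
      intros w Hw. apply (pd_D _ _ _ _ (D_log w Hw)). }
    rewrite L1, L2.
    destruct (pd_D _ _ _ _ (P _ (smooth_D1 _ _ smooth_height))) as [-> _].
    destruct (pd_D _ _ _ _ (P _ (smooth_D2 _ _ smooth_height))) as [_ ->].
    unfold flat_laplacian in L.
    transitivity (- ((D1 (D1 y) z + D2 (D2 y) z) * (1 - y z ^ 2)
       + 2 * y z * (D1 y z ^ 2 + D2 y z ^ 2)) / (1 - y z ^ 2) ^ 2); [field; lra|].
    rewrite L, G. field; lra.
Qed.

Lemma log_regular (z : C) : V z -> 0 < D1 u z ^ 2 + D2 u z ^ 2.
Proof.
  intros Hz. assert (B := Hy z Hz). destruct (log_facts z Hz) as [_ [_ [G _]]].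
  assert (EP := proj1 (proj2 (proj2 HC z Hz))). fold Y in EP. fold (E z) in EP.
  rewrite <- G in EP. assert (0 < 1 - y z ^ 2) by nra.
  apply (Rmult_lt_reg_r (1 - y z ^ 2)); lra.
Qed.

Lemma pd_affine_log (a c : R) (z : C) : V z -> pd (fun w => a + c * u w) z (c * D1 u z) (c * D2 u z).
Proof.
  intros Hz. eapply pd_eq; [apply pd_plus; [apply pd_const|apply pd_mult; [apply pd_const|apply (smooth_pd V u z smooth_log Hz)]]| |];
    cbv beta; ring.
Qed.

(* On the sphere [u] is harmonic, the height satisfies [Lap y = - 2 E y] and the gradients
   satisfy [<grad y, grad u> = - E], so [Ffun] is an affine function of [u]. *)
Lemma h_rot_harmonic (a2 a3 c1 c2 : R) :
  (forall z, V z -> h z = h_rot a2 a3 c1 c2 (u z)) ->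
  forall z, V z -> flat_laplacian (Ffun g h) z = 0.
Proof.
  intros Hrot.
  assert (He : forall z, V z -> h z =
     ((1 + y z) * (a2 + c1 * u z) + (1 - y z) * (a3 + c2 * u z)) / 2).
  { intros z Hz. rewrite (Hrot z Hz). apply (h_rot_log_stereo a2 a3 c1 c2 (y z)). now apply Hy. }
  assert (Py : forall z, V z -> pd y z (D1 y z) (D2 y z)).
  { intros z Hz. apply (smooth_pd V); [apply smooth_height|exact Hz]. }
  assert (Pu : forall z, V z -> pd u z (D1 u z) (D2 u z)).
  { intros z Hz. apply (smooth_pd V); [apply smooth_log|exact Hz]. }
  (* The partial derivatives of the expression in [He] with respect to y and u, so that dh = A dy +
     B du. *)
  pose (A := fun z => (a2 - a3 + (c1 - c2) * u z) / 2).
  pose (B := fun z => (c1 * (1 + y z) + c2 * (1 - y z)) / 2).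
  assert (PA : forall z, V z -> pd A z ((c1 - c2) / 2 * D1 u z) ((c1 - c2) / 2 * D2 u z)).
  { intros z Hz. eapply pd_eq; [apply pd_div; [lra|apply (pd_affine_log _ _ z Hz)|apply pd_const]| |];
      cbv beta; field. }
  assert (PB : forall z, V z -> pd B z ((c1 - c2) / 2 * D1 y z) ((c1 - c2) / 2 * D2 y z)).
  { intros z Hz. eapply pd_eq; [apply pd_div; [lra|
      apply pd_plus; (apply pd_mult; [apply pd_const|]);
      [apply pd_plus; [apply pd_const|apply (Py z Hz)]|apply pd_minus; [apply pd_const|apply (Py z Hz)]]
      |apply pd_const]| |];
      cbv beta; field. }
  assert (Dh : forall z, V z -> D1 h z = D1 y z * A z + D1 u z * B z /\
                                D2 h z = D2 y z * A z + D2 u z * B z).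
  { intros z Hz. apply pd_D.
    apply (pd_ext_loc (fun z => ((1 + y z) * (a2 + c1 * u z) + (1 - y z) * (a3 + c2 * u z)) / 2)).
    - apply (filter_imp V); [|exact (HV z Hz)]. intros w Hw. symmetry. now apply He.
    - eapply pd_eq; [apply pd_div; [lra|apply pd_plus; (apply pd_mult; [|apply (pd_affine_log _ _ z Hz)]);
        [apply pd_plus; [apply pd_const|apply (Py z Hz)]|apply pd_minus; [apply pd_const|apply (Py z Hz)]]
        |apply pd_const]| |];
      cbv beta; unfold A, B; field. }
  assert (HF : forall z, V z -> Ffun g h z = (a2 + a3 - c1 + c2) + (c1 + c2) * u z).
  { intros z Hz. unfold Ffun. simpl. fold Y. fold (E z).
    destruct (height_gradient z Hz) as [_ Ly].
    destruct (log_facts z Hz) as [y1 [y2 [Gu Lu]]].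
    assert (EP := proj1 (proj2 (proj2 HC z Hz))). fold Y in EP. fold (E z) in EP.
    (* dA and dB are (c1 - c2) / 2 times du and dy, so the two product terms add up to (c1 - c2)
       <grad y, grad u>. *)
    assert (L : flat_laplacian h z = flat_laplacian y z * A z + flat_laplacian u z * B z
       + (c1 - c2) * (D1 y z * D1 u z + D2 y z * D2 u z)).
    { assert (S1 := smooth_height). assert (S2 := smooth_log).
      assert (L1 : pd (fun w => D1 y w * A w + D1 u w * B w) z
        (D1 (D1 y) z * A z + D1 (D1 u) z * B z + (c1 - c2) * (D1 y z * D1 u z))
        (D2 (D1 y) z * A z + D2 (D1 u) z * B z + (c1 - c2) / 2 * (D1 y z * D2 u z + D2 y z * D1 u z))).
      { eapply pd_eq; [apply pd_plus; apply pd_mult;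
          [apply (smooth_pd V _ z (smooth_D1 _ _ S1) Hz)|apply (PA z Hz)
          |apply (smooth_pd V _ z (smooth_D1 _ _ S2) Hz)|apply (PB z Hz)]| |]; field. }
      assert (L2 : pd (fun w => D2 y w * A w + D2 u w * B w) z
        (D1 (D2 y) z * A z + D1 (D2 u) z * B z + (c1 - c2) / 2 * (D1 y z * D2 u z + D2 y z * D1 u z))
        (D2 (D2 y) z * A z + D2 (D2 u) z * B z + (c1 - c2) * (D2 y z * D2 u z))).
      { eapply pd_eq; [apply pd_plus; apply pd_mult;
          [apply (smooth_pd V _ z (smooth_D2 _ _ S1) Hz)|apply (PA z Hz)
          |apply (smooth_pd V _ z (smooth_D2 _ _ S2) Hz)|apply (PB z Hz)]| |]; field. }
      apply pd_D in L1. apply pd_D in L2. unfold flat_laplacian.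
      replace (D1 (D1 h) z) with (D1 (fun w => D1 y w * A w + D1 u w * B w) z).
      replace (D2 (D2 h) z) with (D2 (fun w => D2 y w * A w + D2 u w * B w) z).
      - rewrite (proj1 L1), (proj2 L2). ring.
      - apply D_ext_loc, (filter_imp V); [|exact (HV z Hz)]. intros w Hw. symmetry. now apply Dh.
      - apply D_ext_loc, (filter_imp V); [|exact (HV z Hz)]. intros w Hw. symmetry. now apply Dh. }
    rewrite L, Ly, Lu, y1, y2, (He z Hz).
    replace (- (1 - y z ^ 2) * D1 u z * D1 u z + - (1 - y z ^ 2) * D2 u z * D2 u z)
      with (- E z) by (rewrite <- Gu; ring).
    unfold A. field. lra. }
  intros z Hz. rewrite (flat_laplacian_ext V _ (fun w => (a2 + a3 - c1 + c2) + (c1 + c2) * u w) z HV Hz HF).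
  rewrite <- (Rmult_0_r (c1 + c2)), <- (proj2 (proj2 (proj2 (log_facts z Hz)))).
  rewrite <- (flat_laplacian_scal V _ _ z HV Hz smooth_log).
  assert (e : forall w, V w -> D1 (fun w => (a2 + a3 - c1 + c2) + (c1 + c2) * u w) w
     = D1 (fun w => (c1 + c2) * u w) w /\ D2 (fun w => (a2 + a3 - c1 + c2) + (c1 + c2) * u w) w
     = D2 (fun w => (c1 + c2) * u w) w).
  { intros w Hw. destruct (pd_D _ _ _ _ (pd_affine_log (a2 + a3 - c1 + c2) (c1 + c2) w Hw)) as [-> ->].
    assert (Q := pd_affine_log 0 (c1 + c2) w Hw).
    apply (pd_ext _ (fun w => (c1 + c2) * u w)) in Q; [|intros; ring].
    apply pd_D in Q. destruct Q as [-> ->]. split; reflexivity. }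
  unfold flat_laplacian. f_equal; apply D_ext_loc, (filter_imp V); try exact (HV z Hz); apply e.
Qed.

Lemma rotational_harmonic_h (HU : connected V) :
  (forall z, V z -> D1 h z * D2 y z = D2 h z * D1 y z) ->
  (forall z, V z -> flat_laplacian (Ffun g h) z = 0) ->
  exists a2 a3 c1 c2 : R, forall z, V z -> h z = h_rot a2 a3 c1 c2 (u z).
Proof.
  intros Hpar HF.
  (* [connected] admits the empty set, for which any constants serve. *)
  destruct (classic (exists z, V z)) as [[z0 Hz0]|Hemp].
  2: { exists 0, 0, 0, 0. intros z Hz. elim Hemp. now exists z. }
  assert (Su := smooth_log). assert (Sy := smooth_height).
  assert (Hharm : forall z, V z -> flat_laplacian u z = 0) by (intros z Hz; apply (log_facts z Hz)).
  (* [k], [k'] and later [l] stand for the u-derivatives h', h'' and F'. *)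
  destruct (parallel_gradient V u HV Su log_regular Hharm h Hh) as [k [Sk Hk]].
  { intros z Hz. destruct (log_facts z Hz) as [y1 [y2 _]]. assert (P := Hpar z Hz).
    rewrite y1, y2 in P. specialize (Hy z Hz). assert (N : 1 - y z ^ 2 <> 0) by nra.
    apply (Rmult_eq_reg_l (- (1 - y z ^ 2))); lra. }
  destruct (parallel_gradient V u HV Su log_regular Hharm k Sk) as [k' [Sk' Hk']].
  { intros z Hz. apply (Hk z Hz). }
  (* This is F = h'' cosh^2 u + 2 h, since 1 / (1 - y^2) = cosh^2 u. *)
  assert (Fe : forall z, V z -> Ffun g h z = k' z / (1 - y z ^ 2) + 2 * h z).
  { intros z Hz. unfold Ffun. simpl. fold Y. fold (E z). f_equal.
    destruct (Hk z Hz) as [_ [_ [_ ->]]]. destruct (Hk' z Hz) as [-> [-> _]].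
    destruct (log_facts z Hz) as [_ [_ [<- _]]].
    assert (R := log_regular z Hz). specialize (Hy z Hz). field. split; nra. }
  assert (SF := smooth_Ffun V g h HV HC Hh).
  destruct (parallel_gradient V u HV Su log_regular Hharm (Ffun g h) SF) as [l [Sl Hl]].
  { intros z Hz. assert (B := Hy z Hz). assert (N : 1 - y z ^ 2 <> 0) by nra.
    destruct (log_facts z Hz) as [y1 [y2 _]].
    assert (P : pd (Ffun g h) z
       ((D1 k' z * (1 - y z ^ 2) + k' z * (2 * y z * D1 y z)) / (1 - y z ^ 2) ^ 2 + 2 * D1 h z)
       ((D2 k' z * (1 - y z ^ 2) + k' z * (2 * y z * D2 y z)) / (1 - y z ^ 2) ^ 2 + 2 * D2 h z)).
    { apply (pd_ext_loc (fun z => k' z / (1 - y z ^ 2) + 2 * h z)).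
      { apply (filter_imp V); [|exact (HV z Hz)]. intros w Hw. symmetry. now apply Fe. }
      assert (Y1 := smooth_pd V y z Sy Hz).
      eapply pd_eq; [apply pd_plus; [apply pd_div; [exact N|apply (smooth_pd V k' z Sk' Hz)|
        apply pd_minus; [apply pd_const|apply (pd_ext (fun w => y w * y w)); [intros; ring|apply pd_mult; exact Y1]]]
        |apply pd_mult; [apply pd_const|apply (smooth_pd V h z Hh Hz)]]| |];
        cbv beta; field; exact N. }
    apply pd_D in P. destruct P as [-> ->]. rewrite y1, y2.
    destruct (Hk z Hz) as [-> [-> _]]. destruct (Hk' z Hz) as [_ [_ [Q _]]].
    rewrite !Rmult_plus_distr_r. unfold Rdiv.
    transitivity ((D1 k' z * D2 u z) * / (1 - y z ^ 2)
      + (k' z * (2 * y z * - (1 - y z ^ 2)) / (1 - y z ^ 2) ^ 2 + 2 * k z) * D1 u z * D2 u z);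
      [field; exact N|]. rewrite Q. field. exact N. }
  (* grad l is parallel to grad u, and harmonicity of F makes it orthogonal to grad u; so it
     vanishes. *)
  assert (Cl : forall z, V z -> l z = l z0).
  { intros z Hz. apply (zero_gradient_const V); auto. intros w Hw.
    destruct (Hl w Hw) as [_ [_ [P Q]]]. rewrite (HF w Hw) in Q.
    assert (G := log_regular w Hw).
    eapply pd_eq; [apply (smooth_pd V l w Sl Hw)| |];
      apply (Rmult_eq_reg_r (D1 u w ^ 2 + D2 u w ^ 2)); try lra.
    - transitivity (D1 u w * (D1 l w * D1 u w) + D2 u w * (D1 l w * D2 u w)); [ring|].
      rewrite P. transitivity (D1 u w * (D1 l w * D1 u w + D2 l w * D2 u w)); [ring|].
      rewrite <- Q. ring.
    - transitivity (D1 u w * (D2 l w * D1 u w) + D2 u w * (D2 l w * D2 u w)); [ring|].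
      rewrite <- P. transitivity (D2 u w * (D1 l w * D1 u w + D2 l w * D2 u w)); [ring|].
      rewrite <- Q. ring. }
  set (al := l z0) in *.
  set (be := Ffun g h z0 - al * u z0).
  assert (Fa : forall z, V z -> Ffun g h z = be + al * u z).
  { intros z Hz. cut (Ffun g h z - (0 + al * u z) = Ffun g h z0 - (0 + al * u z0)); [unfold be; lra|].
    apply (zero_gradient_const V (fun z => Ffun g h z - (0 + al * u z))); auto.
    intros w Hw. destruct (Hl w Hw) as [L1 [L2 _]]. rewrite (Cl w Hw) in L1, L2.
    eapply pd_eq; [apply pd_minus; [apply (smooth_pd V _ w SF Hw)|apply (pd_affine_log _ _ w Hw)]| |];
      lra. }
  assert (Ke : forall z, V z -> k' z = (be + al * u z - 2 * h z) * (1 - y z ^ 2)).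
  { intros z Hz. rewrite <- (Fa z Hz), (Fe z Hz). field. specialize (Hy z Hz). nra. }
  assert (Pu : forall z, V z -> pd u z (D1 u z) (D2 u z)).
  { intros z Hz. apply (smooth_pd V u z Su Hz). }
  assert (Py : forall z, V z -> pd y z (- (1 - y z ^ 2) * D1 u z) (- (1 - y z ^ 2) * D2 u z)).
  { intros z Hz. destruct (log_facts z Hz) as [y1 [y2 _]]. rewrite <- y1, <- y2.
    apply (smooth_pd V y z Sy Hz). }
  (* F is affine in u, so F / 2 is a particular solution. The difference w = h - F / 2 satisfies the
     homogeneous equation w'' = - 2 (1 - y^2) w. *)
  assert (Pw : forall z, V z -> pd (fun z => h z - / 2 * (be + al * u z)) z
     ((k z - / 2 * al) * D1 u z) ((k z - / 2 * al) * D2 u z)).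
  { intros z Hz. destruct (Hk z Hz) as [h1 [h2 _]].
    eapply pd_eq; [apply pd_minus; [apply (smooth_pd V h z Hh Hz)|apply pd_mult; [apply pd_const|apply (pd_affine_log _ _ z Hz)]]| |];
      cbv beta; rewrite ?h1, ?h2; ring. }
  assert (Pk : forall z, V z -> pd (fun z => k z - / 2 * al) z
     (-2 * (h z - / 2 * (be + al * u z)) * (1 - y z ^ 2) * D1 u z)
     (-2 * (h z - / 2 * (be + al * u z)) * (1 - y z ^ 2) * D2 u z)).
  { intros z Hz. destruct (Hk' z Hz) as [h1 [h2 _]]. rewrite (Ke z Hz) in h1, h2.
    eapply pd_eq; [apply pd_minus; [apply (smooth_pd V k z Sk Hz)|apply pd_const]| |];
      rewrite ?h1, ?h2; field. }
  (* With [t = - y], which is [tanh u], the functions [t] and [u t - 1] of [u] have Wronskian 1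
     and span the solutions of [w'' = - 2 (1 - t^2) w]; [A] and [B] are the coefficients of [w]. *)
  pose (w := fun z => h z - / 2 * (be + al * u z)).
  pose (w' := fun z => k z - / 2 * al).
  pose (A := fun z => w z * (- y z + u z * (1 - y z * y z)) - w' z * (- (u z * y z) - 1)).
  pose (B := fun z => - (w z * (1 - y z * y z)) - w' z * y z).
  assert (CA : forall z, V z -> A z = A z0).
  { intros z Hz. apply (zero_gradient_const V); auto. intros x Hx.
    assert (p1 := Pw x Hx). assert (p2 := Pk x Hx). assert (p3 := Py x Hx). assert (p4 := Pu x Hx).
    fold w in p1. fold w' in p2.
    eapply pd_eq; [apply pd_minus; apply pd_mult; [exact p1| |exact p2|];
      [apply pd_plus; [apply pd_opp, p3|apply pd_mult; [exact p4|apply pd_minus; [apply pd_const|apply pd_mult; exact p3]]]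
      |apply pd_minus; [apply pd_opp, pd_mult; [exact p4|exact p3]|apply pd_const]]| |];
      cbv beta; unfold w, w'; ring. }
  assert (CB : forall z, V z -> B z = B z0).
  { intros z Hz. apply (zero_gradient_const V); auto. intros x Hx.
    assert (p1 := Pw x Hx). assert (p2 := Pk x Hx). assert (p3 := Py x Hx). assert (p4 := Pu x Hx).
    fold w in p1. fold w' in p2.
    eapply pd_eq; [apply pd_minus; [apply pd_opp|]; apply pd_mult; [exact p1| |exact p2|exact p3];
      apply pd_minus; [apply pd_const|apply pd_mult; exact p3]| |];
      cbv beta; unfold w, w'; ring. }
  (* With t = - y one has w = A t + B (u t - 1). The constants come from comparing the coefficients
     of 1, t, u and u t with [h_rot_log_stereo]. *)
  exists (be / 2 - B z0 - A z0), (be / 2 - B z0 + A z0), (al / 2 - B z0), (al / 2 + B z0).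
  intros z Hz. unfold u. rewrite h_rot_log_stereo by now apply Hy. fold (u z).
  rewrite <- (CA z Hz), <- (CB z Hz). unfold A, B, w, w'. field.
Qed.
End Sphere.

(** * Rotational surfaces *)

(* The derivative at the identity of the rotations about the e3-axis. *)
Definition rot3 (p : V3) : V3 := (- vy p, vx p, 0).

Definition vDdir (a b : R) (F : C -> V3) (z : C) : V3 :=
  vadd (vscal a (vD1 F z)) (vscal b (vD2 F z)).

Lemma smooth1_derive (J : R -> Prop) (m : R -> R) (x : R) : smooth1_on J m -> J x ->
  is_derive m x (Derive m x) /\ is_derive (Derive m) x (Derive (Derive m) x).
Proof.
  intros Hm Hx. split; apply Derive_correct; [apply (Hm 1%nat x Hx)|apply (Hm 2%nat x Hx)].
Qed.

(** The direction (a, b) is the coordinate field of the angle v. The normal is not known in rotated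
    form; its derivative is determined by differentiating its orthogonality to the surface and its
    unit length. The conclusion no longer mentions the chart or the profile. *)
Lemma rotational_field (U : C -> Prop) (X N : C -> V3) : open U -> smooth3_on U N ->
  immersion_on U X ->
  (forall z, U z -> dot (N z) (N z) = 1 /\ dot (vD1 X z) (N z) = 0 /\ dot (vD2 X z) (N z) = 0) ->
  rotational U X ->
  forall z, U z -> exists a b : R, ~ (a = 0 /\ b = 0) /\
    vDdir a b X z = rot3 (X z) /\ vDdir a b N z = rot3 (N z).
Proof.
  intros HU SN HI HN HR z0 Hz0.
  destruct (HR z0 Hz0) as [V [u [v [J [m [n [Vz0 [VU [[HV [Su [Sv [Jac _]]]] [_ [HJ [Sm [Sn HX]]]]]]]]]]]]].
  (* [A] and [B] are the derivatives of the rotated curve with respect to u and v. *)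
  pose (A := fun w => (Derive m (u w) * cos (v w), Derive m (u w) * sin (v w), Derive n (u w)) : V3).
  pose (B := fun w => (- (m (u w) * sin (v w)), m (u w) * cos (v w), 0) : V3).
  assert (dcos : forall x, is_derive cos x (- sin x)) by (intros; auto_derive; [exact I|ring]).
  assert (dsin : forall x, is_derive sin x (cos x)) by (intros; auto_derive; [exact I|ring]).
  assert (Pu : forall w, V w -> pd u w (D1 u w) (D2 u w)).
  { intros w Hw. now apply (smooth_pd V). }
  assert (Pc : forall w, V w -> pd (fun w => cos (v w)) w (- sin (v w) * D1 v w) (- sin (v w) * D2 v w)).
  { intros w Hw. apply pd_comp; [apply dcos|now apply (smooth_pd V)]. }
  assert (Ps : forall w, V w -> pd (fun w => sin (v w)) w (cos (v w) * D1 v w) (cos (v w) * D2 v w)).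
  { intros w Hw. apply pd_comp; [apply dsin|now apply (smooth_pd V)]. }
  assert (dX : forall w, V w ->
    vD1 X w = vadd (vscal (D1 u w) (A w)) (vscal (D1 v w) (B w)) /\
    vD2 X w = vadd (vscal (D2 u w) (A w)) (vscal (D2 v w) (B w))).
  { intros w Hw. destruct (smooth1_derive J m (u w) Sm (HJ w Hw)) as [m1 _].
    destruct (smooth1_derive J n (u w) Sn (HJ w Hw)) as [n1 _].
    assert (Pm := pd_comp m u w _ _ _ m1 (Pu w Hw)).
    assert (Pn := pd_comp n u w _ _ _ n1 (Pu w Hw)).
    assert (L : forall p : V3 -> R, locally w (fun x => p (m (u x) * cos (v x), m (u x) * sin (v x), n (u x)) = p (X x))).
    { intros p. apply (filter_imp V); [|exact (HV w Hw)]. intros x Hx. now rewrite (HX x Hx). }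
    destruct (pd_D _ _ _ _ (pd_ext_loc _ _ _ _ _ (L vx) (pd_mult _ _ _ _ _ _ _ Pm (Pc w Hw)))) as [x1 x2].
    destruct (pd_D _ _ _ _ (pd_ext_loc _ _ _ _ _ (L vy) (pd_mult _ _ _ _ _ _ _ Pm (Ps w Hw)))) as [y1 y2].
    destruct (pd_D _ _ _ _ (pd_ext_loc _ _ _ _ _ (L vz) Pn)) as [e1 e2].
    split; apply V3_eq; unfold vD1, vD2, vadd, vscal, A, B, vx, vy, vz in *; simpl.
    - etransitivity; [exact x1|ring].
    - etransitivity; [exact y1|ring].
    - etransitivity; [exact e1|ring].
    - etransitivity; [exact x2|ring].
    - etransitivity; [exact y2|ring].
    - etransitivity; [exact e2|ring]. }
  (* An immersion excludes points on the axis, where [B] vanishes, and stationary points of the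
     profile, where [A] vanishes. *)
  assert (AB : forall w, V w ->
     dot (N w) (A w) = 0 /\ m (u w) <> 0 /\ - vx (N w) * sin (v w) + vy (N w) * cos (v w) = 0 /\
     0 < dot (A w) (A w)).
  { intros w Hw. destruct (HN w (VU w Hw)) as [_ [N1 N2]]. destruct (dX w Hw) as [e1 e2].
    assert (j := Jac w Hw).
    rewrite e1, dot_addl, !dot_scall, (dot_comm (A w)) in N1. rewrite e2, dot_addl, !dot_scall, (dot_comm (A w)) in N2.
    assert (I := HI w (VU w Hw)). rewrite e1, e2 in I.
    assert (NA : dot (N w) (A w) = 0).
    { apply (Rmult_eq_reg_l (D1 u w * D2 v w - D2 u w * D1 v w)); [|exact j].
      transitivity (D2 v w * (D1 u w * dot (N w) (A w) + D1 v w * dot (B w) (N w))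
        - D1 v w * (D2 u w * dot (N w) (A w) + D2 v w * dot (B w) (N w))); [ring|].
      rewrite N1, N2; ring. }
    assert (NB : dot (B w) (N w) = 0).
    { apply (Rmult_eq_reg_l (D1 u w * D2 v w - D2 u w * D1 v w)); [|exact j].
      transitivity (D1 u w * (D2 u w * dot (N w) (A w) + D2 v w * dot (B w) (N w))
        - D2 u w * (D1 u w * dot (N w) (A w) + D1 v w * dot (B w) (N w))); [ring|].
      rewrite N1, N2; ring. }
    assert (mn : m (u w) <> 0).
    { intros m0. destruct (I (- D2 u w) (D1 u w)) as [z1 z2].
      - apply V3_eq; unfold A, B, vadd, vscal, vx, vy, vz; simpl; rewrite ?m0; ring.
      - apply j. rewrite z2. replace (D2 u w) with 0 by lra. ring. }
    split; [exact NA|]. split; [exact mn|]. split.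
    - apply (Rmult_eq_reg_l (m (u w))); [|exact mn]. rewrite Rmult_0_r, <- NB.
      unfold dot, B, vx, vy, vz; simpl; ring.
    - destruct (Req_dec (Derive m (u w)) 0) as [m0|m0].
      2: { unfold dot, A, vx, vy, vz; simpl.
           assert (cs := sin2_cos2 (v w)). unfold Rsqr in cs. nra. }
      destruct (Req_dec (Derive n (u w)) 0) as [n0|n0].
      2: { unfold dot, A, vx, vy, vz; simpl. rewrite m0. nra. }
      exfalso. destruct (I (D2 v w) (- D1 v w)) as [z1 z2].
      + apply V3_eq; unfold A, B, vadd, vscal, vx, vy, vz; simpl; rewrite ?m0, ?n0; ring.
      + apply j. rewrite z1. replace (D1 v w) with 0 by lra. ring. }
  set (j := D1 u z0 * D2 v z0 - D2 u z0 * D1 v z0).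
  assert (Hj := Jac z0 Vz0). fold j in Hj.
  (* The vector on which du is 0 and dv is 1. *)
  exists (- D2 u z0 / j), (D1 u z0 / j).
  destruct (dX z0 Vz0) as [e1 e2]. destruct (AB z0 Vz0) as [NA [mn [NT PA]]].
  assert (ju : - D2 u z0 / j * D1 u z0 + D1 u z0 / j * D2 u z0 = 0) by (field; exact Hj).
  assert (jv : - D2 u z0 / j * D1 v z0 + D1 u z0 / j * D2 v z0 = 1) by (unfold j; field; exact Hj).
  set (a := - D2 u z0 / j) in *. set (b := D1 u z0 / j) in *.
  split; [intros [a0 b0]; rewrite a0, b0 in jv; lra|]. split.
  { unfold vDdir. rewrite e1, e2, (HX z0 Vz0). unfold rot3, vx, vy, vz; simpl.
    apply V3_eq; unfold A, B, vadd, vscal, vx, vy, vz; simpl.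
    - transitivity ((a * D1 u z0 + b * D2 u z0) * (Derive m (u z0) * cos (v z0))
        + (a * D1 v z0 + b * D2 v z0) * - (m (u z0) * sin (v z0))); [ring|rewrite ju, jv; ring].
    - transitivity ((a * D1 u z0 + b * D2 u z0) * (Derive m (u z0) * sin (v z0))
        + (a * D1 v z0 + b * D2 v z0) * (m (u z0) * cos (v z0))); [ring|rewrite ju, jv; ring].
    - transitivity ((a * D1 u z0 + b * D2 u z0) * Derive n (u z0)); [ring|rewrite ju; ring]. }
  destruct SN as [SNx [SNy SNz]].
  assert (Nx := smooth_pd U _ z0 SNx Hz0). assert (Ny := smooth_pd U _ z0 SNy Hz0).
  assert (Nz := smooth_pd U _ z0 SNz Hz0).
  assert (N1 : vD1 N z0 = (D1 (fun z => vx (N z)) z0, D1 (fun z => vy (N z)) z0, D1 (fun z => vz (N z)) z0))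
    by reflexivity.
  assert (N2 : vD2 N z0 = (D2 (fun z => vx (N z)) z0, D2 (fun z => vy (N z)) z0, D2 (fun z => vz (N z)) z0))
    by reflexivity.
  set (n1x := D1 (fun z => vx (N z)) z0) in *. set (n1y := D1 (fun z => vy (N z)) z0) in *.
  set (n1z := D1 (fun z => vz (N z)) z0) in *. set (n2x := D2 (fun z => vx (N z)) z0) in *.
  set (n2y := D2 (fun z => vy (N z)) z0) in *. set (n2z := D2 (fun z => vz (N z)) z0) in *.
  clearbody n1x n1y n1z n2x n2y n2z.
  destruct (smooth1_derive J m (u z0) Sm (HJ z0 Vz0)) as [_ m2].
  destruct (smooth1_derive J n (u z0) Sn (HJ z0 Vz0)) as [_ n2].
  assert (Pm := pd_comp _ u z0 _ _ _ m2 (Pu z0 Vz0)).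
  assert (Pn := pd_comp _ u z0 _ _ _ n2 (Pu z0 Vz0)).
  assert (Zl : forall f : C -> R, (forall w, V w -> f w = 0) -> forall p q, pd f z0 p q -> p = 0 /\ q = 0).
  { intros f Hf p q Hpq. destruct (pd_D _ _ _ _ Hpq) as [<- <-].
    destruct (D_const 0 z0) as [d1 d2]. cut (D1 f z0 = D1 (fun _ => 0) z0 /\ D2 f z0 = D2 (fun _ => 0) z0);
      [rewrite d1, d2; tauto|].
    apply D_ext_loc, (filter_imp V); [exact Hf|exact (HV z0 Vz0)]. }
  (* Both orthogonality relations hold on all of [V], so their derivatives at [z0] vanish as
     well. *)
  destruct (Zl (fun w => - vx (N w) * sin (v w) + vy (N w) * cos (v w))
     (fun w Hw => proj1 (proj2 (proj2 (AB w Hw)))) _ _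
     (pd_plus _ _ _ _ _ _ _ (pd_mult _ _ _ _ _ _ _ (pd_opp _ _ _ _ Nx) (Ps z0 Vz0))
        (pd_mult _ _ _ _ _ _ _ Ny (Pc z0 Vz0)))) as [T1 T2].
  destruct (Zl (fun w => vx (N w) * (Derive m (u w) * cos (v w)) + vy (N w) * (Derive m (u w) * sin (v w))
      + vz (N w) * Derive n (u w))
     (fun w Hw => proj1 (AB w Hw)) _ _
     (pd_plus _ _ _ _ _ _ _ (pd_plus _ _ _ _ _ _ _
        (pd_mult _ _ _ _ _ _ _ Nx (pd_mult _ _ _ _ _ _ _ Pm (Pc z0 Vz0)))
        (pd_mult _ _ _ _ _ _ _ Ny (pd_mult _ _ _ _ _ _ _ Pm (Ps z0 Vz0))))
        (pd_mult _ _ _ _ _ _ _ Nz Pn))) as [A1 A2].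
  destruct (D_dot_eq U N N (fun _ => 1) z0 HU Hz0 (conj SNx (conj SNy SNz)) (conj SNx (conj SNy SNz))
     (fun w Hw => proj1 (HN w Hw))) as [M1 M2].
  destruct (D_const 1 z0) as [c1' c2']. rewrite c1' in M1. rewrite c2' in M2.
  rewrite (dot_comm (N z0)) in M1, M2.
  assert (sc := sin2_cos2 (v z0)). unfold Rsqr in sc.
  (* Scaling by [r] gives the angular direction the same length as [A z0], as [orthogonal_frame]
     requires. *)
  set (r := sqrt (dot (A z0) (A z0))).
  assert (rr : r * r = dot (A z0) (A z0)) by (apply sqrt_sqrt; lra).
  assert (W : vadd (vDdir a b N z0) (vscal (-1) (rot3 (N z0))) = (0, 0, 0)).
  { apply (frame_zero (dot (A z0) (A z0)) (A z0) (vscal r (- sin (v z0), cos (v z0), 0)) (N z0)).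
    - split; [exact PA|]. split; [reflexivity|]. split.
      { rewrite dot_scall, dot_scalr, <- Rmult_assoc, rr. unfold dot at 2; unfold vx, vy, vz; simpl.
        transitivity (dot (A z0) (A z0) * (sin (v z0) * sin (v z0) + cos (v z0) * cos (v z0))); [ring|].
        rewrite sc; ring. }
      split; [apply (HN z0 Hz0)|]. split.
      { rewrite dot_scalr. unfold dot, A, vx, vy, vz; simpl; ring. }
      split; [rewrite dot_comm; exact NA|].
      rewrite dot_scall. transitivity (r * (- vx (N z0) * sin (v z0) + vy (N z0) * cos (v z0)));
        [unfold dot, vx, vy, vz; simpl; ring|rewrite NT; ring].
    - match type of A1 with ?P = 0 => match type of A2 with ?Q = 0 =>
        transitivity (a * P + b * Q) end end; [|rewrite A1, A2; ring].
      unfold vDdir. rewrite N1, N2. unfold vadd, vscal, rot3, dot, A, vx, vy, vz; simpl.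
      match goal with |- ?L = ?R => cut (R - L = 0); [lra|] end.
      set (nx := fst (fst (N z0))). set (ny := snd (fst (N z0))). set (nz := snd (N z0)).
      match goal with |- ?L = 0 => transitivity
       ((a * D1 u z0 + b * D2 u z0) * (Derive (Derive m) (u z0) * (nx * cos (v z0) + ny * sin (v z0)) + nz * Derive (Derive n) (u z0))
        + (a * D1 v z0 + b * D2 v z0 - 1) * (Derive m (u z0) * (- nx * sin (v z0) + ny * cos (v z0)))) end;
        [ring|rewrite ju, jv; ring].
    - rewrite dot_scalr. apply Rmult_eq_0_compat_l.
      match type of T1 with ?P = 0 => match type of T2 with ?Q = 0 =>
        transitivity (a * P + b * Q) end end; [|rewrite T1, T2; ring].
      unfold vDdir. rewrite N1, N2. unfold vadd, vscal, rot3, dot, vx, vy, vz; simpl.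
      set (nx := fst (fst (N z0))). set (ny := snd (fst (N z0))).
      match goal with |- ?L = ?R => cut (L - R = 0); [lra|] end.
      match goal with |- ?L = 0 => transitivity
       ((a * D1 v z0 + b * D2 v z0 - 1) * (nx * cos (v z0) + ny * sin (v z0))) end;
        [ring|rewrite jv; ring].
    - unfold vDdir. rewrite !dot_addl, !dot_scall.
      replace (dot (vD1 N z0) (N z0)) with 0 by lra. replace (dot (vD2 N z0) (N z0)) with 0 by lra.
      unfold rot3, dot, vx, vy, vz; simpl; ring. }
  apply V3_eq;
    [apply (f_equal vx) in W|apply (f_equal vy) in W|apply (f_equal vz) in W];
    unfold vadd, vscal, vx, vy, vz in *; simpl in *; lra.
Qed.

(** * Invariance of [Y] and [h] under the infinitesimal rotation *)

Section Gauss.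
Variables (U : C -> Prop) (g : C -> Csphere) (h : C -> R).
Hypothesis HU : open U.
Hypothesis HC : conformal_sphere_map U (Ymap g).
Hypothesis Hh : smooth_on U h.

(** At the heights 1 and -1 the rotation field [rot3] vanishes, whereas a conformal map sends a
    nonzero direction to a nonzero vector. The third component of [rot3] is 0, so (a, b) annihilates
    both dh and dy, and the two gradients are parallel. *)
Lemma rotation_invariant_data (z : C) (a b : R) : U z -> ~ (a = 0 /\ b = 0) ->
  vDdir a b (Ymap g) z = rot3 (Ymap g z) -> a * D1 h z + b * D2 h z = 0 ->
  -1 < vz (Ymap g z) < 1 /\
  D1 h z * D2 (fun w => vz (Ymap g w)) z = D2 h z * D1 (fun w => vz (Ymap g w)) z.
Proof.
  intros Hz Hab HY H0.
  destruct (conformal_frame U _ z HU Hz HC) as [EP [Haa [Hbb [Hyy [Hxy _]]]]].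
  split.
  - assert (P : 0 < vx (Ymap g z) ^ 2 + vy (Ymap g z) ^ 2).
    { destruct (Req_dec (vx (Ymap g z) ^ 2 + vy (Ymap g z) ^ 2) 0) as [e|e]; [|nra].
      exfalso. apply Hab.
      assert (D : dot (vDdir a b (Ymap g) z) (vDdir a b (Ymap g) z) = 0).
      { rewrite HY. unfold rot3, dot, vx, vy, vz in *; simpl in *. nra. }
      unfold vDdir in D. rewrite dot_addl, !dot_addr, !dot_scall, !dot_scalr, Hbb,
        (dot_comm (vD2 _ _) (vD1 _ _)), Hxy in D.
      assert (a * a + b * b = 0) by (apply (Rmult_eq_reg_r (dot (vD1 (Ymap g) z) (vD1 (Ymap g) z))); lra).
      split; nra. }
    unfold dot in Hyy. split; nra.
  - apply (f_equal vz) in HY. unfold vDdir, rot3, vadd, vscal, vD1, vD2, vx, vy, vz in *; simpl in *.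
    destruct (Req_dec a 0) as [a0|a0]; [destruct (Req_dec b 0) as [b0|b0]; [tauto|]|].
    + subst a. apply (Rmult_eq_reg_l b); [|exact b0].
      transitivity (b * D2 h z * D1 (fun w => snd (Ymap g w)) z + D1 h z * (0 * D1 (fun w => snd (Ymap g w)) z + b * D2 (fun w => snd (Ymap g w)) z)
        - D1 (fun w => snd (Ymap g w)) z * (0 * D1 h z + b * D2 h z)); [ring|].
      rewrite HY, H0. ring.
    + apply (Rmult_eq_reg_l a); [|exact a0].
      transitivity (a * D2 h z * D1 (fun w => snd (Ymap g w)) z + D2 (fun w => snd (Ymap g w)) z * (a * D1 h z + b * D2 h z)
        - D2 h z * (a * D1 (fun w => snd (Ymap g w)) z + b * D2 (fun w => snd (Ymap g w)) z)); [ring|].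
      rewrite HY, H0. ring.
Qed.

Lemma dot_rot3 (p q : V3) : dot p (rot3 q) = - dot (rot3 p) q.
Proof. unfold dot, rot3, vx, vy, vz; simpl; ring. Qed.

(** Along the direction (a, b), dh = <eta, dY> = <eta, rot Y> = - <rot eta, Y> = - <d eta, Y> = 0,
    because [rot3] is skew-symmetric and [Y] is normal to [eta]. *)
Lemma rotational_eta_data : immersion_on U (eta g h) -> rotational U (eta g h) ->
  forall z, U z -> -1 < vz (Ymap g z) < 1 /\
    D1 h z * D2 (fun w => vz (Ymap g w)) z = D2 h z * D1 (fun w => vz (Ymap g w)) z.
Proof.
  intros HI HR z Hz.
  destruct (rotational_field U (eta g h) (Ymap g) HU (proj1 HC) HI) with (z := z)
    as [a [b [Hab [Hx HY]]]]; auto.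
  { intros w Hw. destruct (a_facts U g h HU HC Hh w Hw) as [A1 [A2 _]].
    split; [apply (proj2 HC w Hw)|split; assumption]. }
  apply (rotation_invariant_data z a b); auto.
  destruct (eta_dots U g h HU HC z Hz) as [_ [<- <-]].
  rewrite <- !dot_scalr, <- dot_addr. fold (vDdir a b (Ymap g) z).
  rewrite HY, dot_rot3, <- Hx. unfold vDdir.
  destruct (a_facts U g h HU HC Hh z Hz) as [A1 [A2 _]].
  rewrite dot_addl, !dot_scall, A1, A2. ring.
Qed.

Variable c : R.
Hypothesis Hc : c <> 0.
Hypothesis Hn : forall z, U z -> h z <> 0.

(** |X|^2 and <X, N> are unchanged along the rotation and determine [h], so [h] is unchanged too.
    Then c Y = (h + c) N - h X transfers the rotation from [X] and [N] to [Y]. *)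
Lemma rotational_X_data : immersion_on U (Xmap g c h) -> rotational U (Xmap g c h) ->
  forall z, U z -> -1 < vz (Ymap g z) < 1 /\
    D1 h z * D2 (fun w => vz (Ymap g w)) z = D2 h z * D1 (fun w => vz (Ymap g w)) z.
Proof.
  intros HI HR z Hz.
  assert (SN : smooth3_on U (Nmap g h)) by (apply (smooth_reflected U g h); assumption).
  assert (SX : smooth3_on U (Xmap g c h)).
  { apply (smooth_reflected U g h HU HC Hh Hn (fun z => h z + c)).
    apply smooth_plus; auto. now apply smooth_const. }
  destruct (rotational_field U (Xmap g c h) (Nmap g h) HU SN HI) with (z := z)
    as [a [b [Hab [Hx HN]]]]; auto.
  { intros w Hw. destruct (dX U g h HU HC Hh c Hn w Hw) as [-> ->].
    destruct (reflected_frame U g h HU HC Hn w Hw) as [_ [_ [_ [NN [_ [F1 F2]]]]]].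
    split; [exact NN|]. rewrite !dot_addl, !dot_scall, F1, F2. split; ring. }
  assert (YXN : forall w, U w -> vscal c (Ymap g w) =
     vadd (vscal (h w + c) (Nmap g h w)) (vscal (- h w) (Xmap g c h w))).
  { intros w Hw. assert (PS : 0 < Sfun g h w) by exact (S_pos U g h HU HC Hn w Hw).
    unfold Xmap, Nmap. set (s := Sfun g h w) in *. set (e := eta g h w). set (y := Ymap g w). clearbody s e y.
    apply V3_eq; unfold vadd, vscal, vx, vy, vz; simpl; field; lra. }
  assert (h0 : a * D1 h z + b * D2 h z = 0).
  { destruct (D_dot_eq U (Xmap g c h) (Xmap g c h) _ z HU Hz SX SX (fun w _ => eq_refl)) as [P1 P2].
    destruct (D_dot_eq U (Xmap g c h) (Nmap g h) _ z HU Hz SX SN (fun w _ => eq_refl)) as [Q1 Q2].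
    pose (P := fun w => dot (Xmap g c h w) (Xmap g c h w)).
    pose (Q := fun w => dot (Xmap g c h w) (Nmap g h w)).
    fold P in P1, P2. fold Q in Q1, Q2.
    assert (p0 : a * D1 P z + b * D2 P z = 0).
    { rewrite <- P1, <- P2.
      transitivity (2 * dot (Xmap g c h z) (vDdir a b (Xmap g c h) z)).
      - unfold vDdir. rewrite dot_addr, !dot_scalr, !(dot_comm _ (Xmap g c h z)). ring.
      - rewrite Hx. unfold dot, rot3, vx, vy, vz; simpl; ring. }
    assert (q0 : a * D1 Q z + b * D2 Q z = 0).
    { rewrite <- Q1, <- Q2.
      transitivity (dot (vDdir a b (Xmap g c h) z) (Nmap g h z) + dot (Xmap g c h z) (vDdir a b (Nmap g h) z)).
      - unfold vDdir. rewrite dot_addr, dot_addl, !dot_scalr, !dot_scall. ring.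
      - rewrite Hx, HN, dot_rot3. ring. }
    (* The formula for the radius, cleared of denominators. The coefficient P - 2 Q + 1 of h is |X -
       N|^2; it cannot vanish, since then Q would be 1. *)
    assert (K : forall w, U w -> Q w - 1 <> 0 /\ h w * (P w - 2 * Q w + 1) - 2 * c * (Q w - 1) = 0).
    { intros w Hw. destruct (X_N_dots U g h HU HC c Hc Hn w Hw) as [e1 e2].
      unfold radius in e2. rewrite e1 in e2. unfold support in e1. fold (Q w) in e1. fold (P w) in e2.
      assert (PS : 0 < Sfun g h w) by exact (S_pos U g h HU HC Hn w Hw). assert (n := Hn w Hw).
      assert (q : 2 * h w * c / Sfun g h w <> 0).
      { unfold Rdiv. repeat apply Rmult_integral_contrapositive_currified; try lra.
        apply Rinv_neq_0_compat; lra. }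
      rewrite e1. split; [exact q|].
      assert (e3 : P w = 1 + 2 * (2 * h w * c / Sfun g h w) * (h w + c) / h w).
      { set (s := 2 * h w * c / Sfun g h w) in *.
        assert (e5 : 1 - P w = - (h w + c) / h w * (2 * s)) by (rewrite <- e2; field; exact q).
        transitivity (1 - (1 - P w)); [ring|]. rewrite e5. field. exact n. }
      assert (e4 : Q w = 1 + 2 * h w * c / Sfun g h w) by lra.
      rewrite e3, e4. set (s := 2 * h w * c / Sfun g h w). field. exact n. }
    assert (PP := smooth_pd U P z (smooth_dot U _ _ HU SX SX) Hz).
    assert (PQ := smooth_pd U Q z (smooth_dot U _ _ HU SX SN) Hz).
    assert (Ph := smooth_pd U h z Hh Hz).
    assert (D : pd (fun w => h w * (P w - 2 * Q w + 1) - 2 * c * (Q w - 1)) z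
      (D1 h z * (P z - 2 * Q z + 1) + h z * (D1 P z - 2 * D1 Q z) - 2 * c * D1 Q z)
      (D2 h z * (P z - 2 * Q z + 1) + h z * (D2 P z - 2 * D2 Q z) - 2 * c * D2 Q z)).
    { eapply pd_eq; [apply pd_minus; [apply pd_mult; [exact Ph|apply pd_plus; [apply pd_minus; [exact PP|
        apply pd_mult; [apply pd_const|exact PQ]]|apply pd_const]]|apply pd_mult; [apply pd_const|
        apply pd_minus; [exact PQ|apply pd_const]]]| |]; cbv beta; ring. }
    apply pd_D in D. destruct D as [d1 d2].
    assert (L : locally z (fun w => h w * (P w - 2 * Q w + 1) - 2 * c * (Q w - 1) = 0)).
    { apply (filter_imp U); [|exact (HU z Hz)]. intros w Hw. apply (K w Hw). }
    destruct (D_ext_loc _ (fun _ => 0) z L) as [l1 l2]. destruct (D_const 0 z) as [z1 z2].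
    assert (l1' := eq_trans (eq_sym d1) (eq_trans l1 z1)).
    assert (l2' := eq_trans (eq_sym d2) (eq_trans l2 z2)).
    destruct (K z Hz) as [K1 K2].
    apply (Rmult_eq_reg_r (P z - 2 * Q z + 1)).
    - transitivity (a * (D1 h z * (P z - 2 * Q z + 1) + h z * (D1 P z - 2 * D1 Q z) - 2 * c * D1 Q z)
        + b * (D2 h z * (P z - 2 * Q z + 1) + h z * (D2 P z - 2 * D2 Q z) - 2 * c * D2 Q z)
        - h z * (a * D1 P z + b * D2 P z) + (2 * h z + 2 * c) * (a * D1 Q z + b * D2 Q z)); [ring|].
      rewrite l1', l2', p0, q0. ring.
    - intros K3. rewrite K3 in K2. apply K1. apply (Rmult_eq_reg_l (2 * c)); lra. }
  apply (rotation_invariant_data z a b); auto.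
  (* The derivative of c Y = (h + c) N - h X along (a, b), for one coordinate; the terms with dh
     drop out by [h0]. *)
  assert (key : forall y n x : C -> R, smooth_on U n -> smooth_on U x ->
    (forall w, U w -> c * y w = (h w + c) * n w + - h w * x w) ->
    c * (a * D1 y z + b * D2 y z) =
      (h z + c) * (a * D1 n z + b * D2 n z) - h z * (a * D1 x z + b * D2 x z)).
  { intros y n x Sn Sx e.
    assert (D : pd y z (/ c * (D1 h z * n z + (h z + c) * D1 n z - D1 h z * x z - h z * D1 x z))
                       (/ c * (D2 h z * n z + (h z + c) * D2 n z - D2 h z * x z - h z * D2 x z))).
    { apply (pd_ext_loc (fun w => / c * ((h w + c) * n w + - h w * x w))).
      - apply (filter_imp U); [|exact (HU z Hz)]. intros w Hw. rewrite <- (e w Hw). field. exact Hc.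
      - assert (Ph := smooth_pd U h z Hh Hz).
        eapply pd_eq; [apply pd_mult; [apply pd_const|apply pd_plus; apply pd_mult;
          [apply pd_plus; [exact Ph|apply pd_const]|apply (smooth_pd U n z Sn Hz)
          |apply pd_opp; exact Ph|apply (smooth_pd U x z Sx Hz)]]| |]; cbv beta; ring. }
    apply pd_D in D. destruct D as [-> ->].
    transitivity ((a * D1 h z + b * D2 h z) * (n z - x z) + (h z + c) * (a * D1 n z + b * D2 n z) - h z * (a * D1 x z + b * D2 x z));
      [field; exact Hc|rewrite h0; ring]. }
  destruct SN as [N1 [N2 N3]]. destruct SX as [X1 [X2 X3]].
  assert (kx := key (fun w => vx (Ymap g w)) _ _ N1 X1 (fun w Hw => f_equal vx (YXN w Hw))).
  assert (ky := key (fun w => vy (Ymap g w)) _ _ N2 X2 (fun w Hw => f_equal vy (YXN w Hw))).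
  assert (kz := key (fun w => vz (Ymap g w)) _ _ N3 X3 (fun w Hw => f_equal vz (YXN w Hw))).
  assert (Ex := f_equal vx (YXN z Hz)). assert (Ey := f_equal vy (YXN z Hz)).
  assert (Nx := f_equal vx HN). assert (Ny := f_equal vy HN). assert (Nz := f_equal vz HN).
  assert (Xx := f_equal vx Hx). assert (Xy := f_equal vy Hx). assert (Xz := f_equal vz Hx).
  unfold vDdir, rot3, vadd, vscal, vD1, vD2, vx, vy, vz in *; cbn [fst snd] in *.
  rewrite Nx, Xx in kx. rewrite Ny, Xy in ky. rewrite Nz, Xz in kz.
  f_equal; [f_equal|]; apply (Rmult_eq_reg_l c); try exact Hc; lra.
Qed.
End Gauss.

(** * Holomorphic maps *)

(** Complex differentiability refers to the neighbourhoods given by the absolute value of C, the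
    rest of the proof to those of the product; [locally_C] identifies the two. *)
Lemma is_C_derive_eps (f : C -> C) (z l : C) : is_derive f z l <->
  forall e : posreal, locally z (fun w => Cmod (f w - f z - (w - z) * l)%C <= e * Cmod (w - z)%C).
Proof.
  split.
  - intros [_ H] e. apply locally_C.
    exact (H z (fun P HP => HP) e).
  - intros H. split; [apply is_linear_scal_l|].
    intros x Hx. apply (is_filter_lim_locally_unique (V := AbsRing_NormedModule C_AbsRing)) in Hx. subst x.
    intros e. specialize (H e). apply locally_C in H. exact H.
Qed.

Lemma is_R_derive_eps (f : R -> R) (x l : R) :
  (forall e : posreal, locally x (fun t => Rabs (f t - f x - (t - x) * l) <= e * Rabs (t - x))) ->
  is_derive f x l.
Proof.
  intros H. split; [apply (is_linear_scal_l (K := R_AbsRing) (V := R_NormedModule))|].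
  intros y Hy. apply (is_filter_lim_locally_unique (V := AbsRing_NormedModule R_AbsRing)) in Hy. subst y. exact H.
Qed.

Lemma Cmod_sqr (w : C) : Cmod w ^ 2 = Re w ^ 2 + Im w ^ 2.
Proof. unfold Cmod, Re, Im. rewrite pow2_sqrt; [reflexivity|]. generalize (pow2_ge_0 (fst w)) (pow2_ge_0 (snd w)); lra. Qed.

Lemma Re_le_Cmod (w : C) : Rabs (Re w) <= Cmod w.
Proof.
  apply Rsqr_incr_0; [|apply Rabs_pos|apply Cmod_ge_0].
  rewrite <- Rsqr_abs, !Rsqr_pow2, Cmod_sqr. generalize (pow2_ge_0 (Im w)). lra.
Qed.

Lemma Im_le_Cmod (w : C) : Rabs (Im w) <= Cmod w.
Proof.
  apply Rsqr_incr_0; [|apply Rabs_pos|apply Cmod_ge_0].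
  rewrite <- Rsqr_abs, !Rsqr_pow2, Cmod_sqr. generalize (pow2_ge_0 (Re w)). lra.
Qed.

Lemma Cmod_le_sum (w : C) : Cmod w <= Rabs (Re w) + Rabs (Im w).
Proof.
  apply Rsqr_incr_0; [|apply Cmod_ge_0|generalize (Rabs_pos (Re w)) (Rabs_pos (Im w)); lra].
  rewrite !Rsqr_pow2, Cmod_sqr, <- (pow2_abs (Re w)), <- (pow2_abs (Im w)).
  generalize (Rabs_pos (Re w)) (Rabs_pos (Im w)). nra.
Qed.

Lemma Cmod_horizontal (a : R) : Cmod (a, 0) = Rabs a.
Proof.
  unfold Cmod; simpl. rewrite <- sqrt_Rsqr_abs. f_equal. unfold Rsqr; ring.
Qed.

Lemma Cmod_vertical (a : R) : Cmod (0, a) = Rabs a.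
Proof.
  unfold Cmod; simpl. rewrite <- sqrt_Rsqr_abs. f_equal. unfold Rsqr; ring.
Qed.

Lemma C_derive_pd (f : C -> C) (z : C) : ex_derive f z ->
  pd (fun w => Re (f w)) z (Re (C_derive f z)) (- Im (C_derive f z)) /\
  pd (fun w => Im (f w)) z (Im (C_derive f z)) (Re (C_derive f z)).
Proof.
  intros H. assert (D := C_derive_correct f z 0%C H).
  set (l := C_derive f z) in *. clearbody l.
  assert (K := proj1 (is_C_derive_eps f z l) D).
  assert (L : forall e : posreal,
    locally (fst z) (fun t => Cmod (f (t, snd z) - f z - ((t - fst z)%R, 0%R) * l)%C <= e * Rabs (t - fst z)) /\
    locally (snd z) (fun t => Cmod (f (fst z, t) - f z - (0%R, (t - snd z)%R) * l)%C <= e * Rabs (t - snd z))).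
  { intros e. destruct (locally_lines z _ (K e)) as [L1 L2]. split.
    - generalize L1. apply filter_imp. intros t Ht.
      replace ((t, snd z) - z)%C with ((t - fst z, 0) : C) in Ht.
      + now rewrite Cmod_horizontal in Ht.
      + destruct z; unfold Cminus, Cplus, Copp; simpl. f_equal; ring.
    - generalize L2. apply filter_imp. intros t Ht.
      replace ((fst z, t) - z)%C with ((0, t - snd z) : C) in Ht.
      + now rewrite Cmod_vertical in Ht.
      + destruct z; unfold Cminus, Cplus, Copp; simpl. f_equal; ring. }
  destruct z as [x y]. simpl in L. unfold pd. simpl.
  split; split; apply is_R_derive_eps; intros e; destruct (L e) as [L1 L2];
    [generalize L1|generalize L2|generalize L1|generalize L2]; apply filter_imp; intros t Ht;
    (eapply Rle_trans; [|exact Ht]).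
  - eapply Rle_trans; [|apply Re_le_Cmod]. right. f_equal.
    unfold Cminus, Cplus, Copp, Cmult, Re, Im; simpl; ring.
  - eapply Rle_trans; [|apply Re_le_Cmod]. right. f_equal.
    unfold Cminus, Cplus, Copp, Cmult, Re, Im; simpl; ring.
  - eapply Rle_trans; [|apply Im_le_Cmod]. right. f_equal.
    unfold Cminus, Cplus, Copp, Cmult, Re, Im; simpl; ring.
  - eapply Rle_trans; [|apply Im_le_Cmod]. right. f_equal.
    unfold Cminus, Cplus, Copp, Cmult, Re, Im; simpl; ring.
Qed.

Lemma Cauchy_Riemann (V : C -> Prop) (f : C -> C) (z : C) : holomorphic_on V f -> V z ->
  D2 (fun w => Re (f w)) z = - D1 (fun w => Im (f w)) z /\
  D2 (fun w => Im (f w)) z = D1 (fun w => Re (f w)) z /\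
  C_derive f z = (D1 (fun w => Re (f w)) z, D1 (fun w => Im (f w)) z).
Proof.
  intros [H _] Hz. destruct (C_derive_pd f z (H z Hz)) as [P1 P2].
  apply pd_D in P1. apply pd_D in P2. destruct P1 as [-> ->], P2 as [-> ->].
  split; [reflexivity|split; [reflexivity|]]. now destruct (C_derive f z).
Qed.

(** Real and imaginary parts have total differentials, each used with error e / 2. Under the
    Cauchy-Riemann equations these combine into multiplication by one complex number. *)
Lemma Cauchy_Riemann_holomorphic (V : C -> Prop) (f : C -> C) : open V ->
  smooth_on V (fun w => Re (f w)) -> smooth_on V (fun w => Im (f w)) ->
  (forall z, V z -> D2 (fun w => Re (f w)) z = - D1 (fun w => Im (f w)) z /\
                    D2 (fun w => Im (f w)) z = D1 (fun w => Re (f w)) z) ->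
  holomorphic_on V f.
Proof.
  intros HV Hp Hq CR. split; [|split; assumption].
  intros z Hz. exists (D1 (fun w => Re (f w)) z, D1 (fun w => Im (f w)) z).
  apply is_C_derive_eps. intros e. assert (He := cond_pos e).
  assert (He2 : 0 < e / 2) by lra.
  assert (L1 := C1_linear_approx V _ z HV Hz (Hp 1%nat) (mkposreal _ He2)).
  assert (L2 := C1_linear_approx V _ z HV Hz (Hq 1%nat) (mkposreal _ He2)).
  destruct (CR z Hz) as [c1 c2]. rewrite c1 in L1. rewrite c2 in L2.
  generalize (filter_and _ _ L1 L2). apply filter_imp. simpl. intros w [B1 B2].
  eapply Rle_trans; [apply Cmod_le_sum|].
  replace (e * Cmod (w - z)) with (e / 2 * Cmod (w - z) + e / 2 * Cmod (w - z)) by field.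
  apply Rplus_le_compat; [eapply Rle_trans; [|exact B1]|eapply Rle_trans; [|exact B2]];
    right; f_equal; unfold Cminus, Cplus, Copp, Cmult, Re, Im; simpl; ring.
Qed.

(** * Stereographic images of holomorphic maps *)

Lemma conformal_sphere_map_ext (V : C -> Prop) (Y Y' : C -> V3) : open V ->
  (forall z, V z -> Y z = Y' z) -> conformal_sphere_map V Y -> conformal_sphere_map V Y'.
Proof.
  intros HV He [[S1 [S2 S3]] H]. split.
  - split; [apply (smooth_ext V _ _ HV) with (2 := S1)|split; [apply (smooth_ext V _ _ HV) with (2 := S2)
      |apply (smooth_ext V _ _ HV) with (2 := S3)]]; intros z Hz; now rewrite (He z Hz).
  - intros z Hz.
    assert (L : forall p : V3 -> R, D1 (fun w => p (Y w)) z = D1 (fun w => p (Y' w)) z /\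
                                    D2 (fun w => p (Y w)) z = D2 (fun w => p (Y' w)) z).
    { intros p. apply D_ext_loc, (filter_imp V); [|exact (HV z Hz)].
      intros w Hw. now rewrite (He w Hw). }
    replace (vD1 Y' z) with (vD1 Y z) by (apply V3_eq; apply L).
    replace (vD2 Y' z) with (vD2 Y z) by (apply V3_eq; apply L).
    rewrite <- (He z Hz). now apply H.
Qed.

Lemma conformal_sphere_map_local (U : C -> Prop) (Y : C -> V3) :
  (forall z, U z -> exists V, V z /\ conformal_sphere_map V Y) -> conformal_sphere_map U Y.
Proof.
  intros H. split.
  - split; [|split]; apply smooth_local; intros z Hz; destruct (H z Hz) as [V [Vz [[S1 [S2 S3]] _]]];
      exists V; auto.
  - intros z Hz. destruct (H z Hz) as [V [Vz [_ HV]]]. now apply HV.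
Qed.

(* [w |-> 1 / w] corresponds to the rotation by pi about the e1-axis. *)
Definition flip (p : V3) : V3 := (vx p, - vy p, - vz p).

Lemma conformal_sphere_map_flip (V : C -> Prop) (Y : C -> V3) : open V ->
  conformal_sphere_map V Y -> conformal_sphere_map V (fun z => flip (Y z)).
Proof.
  intros HV [[S1 [S2 S3]] H].
  split; [split; [exact S1|split; now apply smooth_opp]|].
  intros z Hz.
  assert (E1 : vD1 (fun z => flip (Y z)) z = flip (vD1 Y z)).
  { apply V3_eq; [reflexivity|..];
      [apply (pd_D _ _ _ _ (pd_opp _ _ _ _ (smooth_pd V _ z S2 Hz)))
      |apply (pd_D _ _ _ _ (pd_opp _ _ _ _ (smooth_pd V _ z S3 Hz)))]. }
  assert (E2 : vD2 (fun z => flip (Y z)) z = flip (vD2 Y z)).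
  { apply V3_eq; [reflexivity|..];
      [apply (pd_D _ _ _ _ (pd_opp _ _ _ _ (smooth_pd V _ z S2 Hz)))
      |apply (pd_D _ _ _ _ (pd_opp _ _ _ _ (smooth_pd V _ z S3 Hz)))]. }
  assert (F : forall p q, dot (flip p) (flip q) = dot p q).
  { intros p q. unfold flip, dot, vx, vy, vz; simpl; ring. }
  rewrite E1, E2, !F. now apply H.
Qed.

Lemma C_neq0 (w : C) : w <> 0%C <-> 0 < Re w ^ 2 + Im w ^ 2.
Proof.
  destruct w as [a b]. unfold Re, Im; simpl. split.
  - intros H. destruct (Req_dec a 0) as [->|]; [|nra]. destruct (Req_dec b 0) as [->|]; [|nra].
    now elim H.
  - intros H K. apply (f_equal Re) in K as K1. apply (f_equal Im) in K as K2.
    unfold Re, Im, RtoC in *; simpl in *. subst. lra.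
Qed.

Lemma stereo_conformal (V : C -> Prop) (f : C -> C) : open V -> holomorphic_on V f ->
  (forall z, V z -> C_derive f z <> 0%C) ->
  conformal_sphere_map V (fun z => stereo_inv (Some (f z))).
Proof.
  intros HV Hf Hd. assert (Hf' := Hf). destruct Hf' as [_ [Sp Sq]].
  set (p := fun w => Re (f w)) in *. set (q := fun w => Im (f w)) in *.
  assert (Tp : forall z, 0 < 1 + (p z * p z + q z * q z)) by (intros z; nra).
  assert (TS : smooth_on V (fun z => 1 + (p z * p z + q z * q z))).
  { apply smooth_plus; [exact HV|now apply smooth_const|].
    apply smooth_plus; [exact HV|now apply smooth_mult|now apply smooth_mult]. }
  apply (conformal_sphere_map_ext V (fun z => (2 * p z / (1 + (p z * p z + q z * q z)),
    2 * q z / (1 + (p z * p z + q z * q z)), 2 / (1 + (p z * p z + q z * q z)) - 1))); [exact HV| |].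
  { intros z Hz. unfold stereo_inv. rewrite Cmod_sqr.
    fold (p z) (q z). specialize (Tp z). apply V3_eq; unfold vx, vy, vz; simpl; field; lra. }
  split.
  { split; [|split]; unfold vx, vy, vz; simpl.
    - apply smooth_div; auto; [intros z _; specialize (Tp z); lra|].
      apply smooth_mult; auto. now apply smooth_const.
    - apply smooth_div; auto; [intros z _; specialize (Tp z); lra|].
      apply smooth_mult; auto. now apply smooth_const.
    - apply smooth_minus; [exact HV| |now apply smooth_const].
      apply smooth_div; auto; [intros z _; specialize (Tp z); lra|now apply smooth_const]. }
  intros z Hz. assert (T := Tp z).
  assert (Pp := smooth_pd V p z Sp Hz). assert (Pq := smooth_pd V q z Sq Hz).
  destruct (Cauchy_Riemann V f z Hf Hz) as [c1 [c2 c3]]. fold p q in c1, c2, c3.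
  assert (N := Hd z Hz). rewrite c3 in N. apply C_neq0 in N. unfold Re, Im in N; simpl in N.
  rewrite c1 in Pp. rewrite c2 in Pq.
  set (a := D1 p z) in *. set (b := D1 q z) in *.
  assert (PT : pd (fun z => 1 + (p z * p z + q z * q z)) z (2 * (p z * a + q z * b)) (2 * (q z * a - p z * b))).
  { eapply pd_eq; [apply pd_plus; [apply pd_const|apply pd_plus; apply pd_mult; eassumption]| |]; ring. }
  assert (Px := pd_div _ _ _ _ _ _ _ (Rgt_not_eq _ _ T) (pd_mult _ _ _ _ _ _ _ (pd_const 2 z) Pp) PT).
  assert (Py := pd_div _ _ _ _ _ _ _ (Rgt_not_eq _ _ T) (pd_mult _ _ _ _ _ _ _ (pd_const 2 z) Pq) PT).
  assert (Pz := pd_minus _ _ _ _ _ _ _ (pd_div _ _ _ _ _ _ _ (Rgt_not_eq _ _ T) (pd_const 2 z) PT) (pd_const 1 z)).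
  apply pd_D in Px. apply pd_D in Py. apply pd_D in Pz.
  destruct Px as [x1 x2], Py as [y1 y2], Pz as [z1 z2].
  match goal with |- context [vD1 ?F z] => set (Y := F) end.
  assert (E1 := V3_eq (vD1 Y z) (_, _, _) x1 y1 z1). assert (E2 := V3_eq (vD2 Y z) (_, _, _) x2 y2 z2).
  rewrite E1, E2. unfold Y. clear - T N.
  set (s := p z) in *. set (t := q z) in *. clearbody s t a b.
  (* The conformal factor 4 |f'|^2 / T^2 of the spherical metric. *)
  assert (E : dot
   (((0 * s + 2 * a) * (1 + (s * s + t * t)) - 2 * s * (2 * (s * a + t * b))) / (1 + (s * s + t * t)) ^ 2,
    ((0 * t + 2 * b) * (1 + (s * s + t * t)) - 2 * t * (2 * (s * a + t * b))) / (1 + (s * s + t * t)) ^ 2,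
    (0 * (1 + (s * s + t * t)) - 2 * (2 * (s * a + t * b))) / (1 + (s * s + t * t)) ^ 2 - 0)
   (((0 * s + 2 * a) * (1 + (s * s + t * t)) - 2 * s * (2 * (s * a + t * b))) / (1 + (s * s + t * t)) ^ 2,
    ((0 * t + 2 * b) * (1 + (s * s + t * t)) - 2 * t * (2 * (s * a + t * b))) / (1 + (s * s + t * t)) ^ 2,
    (0 * (1 + (s * s + t * t)) - 2 * (2 * (s * a + t * b))) / (1 + (s * s + t * t)) ^ 2 - 0)
    = 4 * (a ^ 2 + b ^ 2) / (1 + (s * s + t * t)) ^ 2).
  { unfold dot, vx, vy, vz; simpl. field. lra. }
  rewrite E. repeat split.
  - unfold dot, vx, vy, vz; simpl. field. lra.
  - apply Rdiv_lt_0_compat; [simpl; lra|apply pow_lt; lra].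
  - unfold dot, vx, vy, vz; simpl. field. lra.
  - unfold dot, vx, vy, vz; simpl. field. lra.
Qed.

Lemma holomorphic_sub (V W : C -> Prop) (f : C -> C) :
  (forall z, W z -> V z) -> holomorphic_on V f -> holomorphic_on W f.
Proof.
  intros HW [H [S1 S2]]. split; [intros z Hz; apply H, HW, Hz|].
  split; eapply smooth_sub; eassumption.
Qed.

(** |f'|^2 is a polynomial in partial derivatives of [f], hence continuous, so its positivity is an
    open condition. *)
Lemma holomorphic_regular (V : C -> Prop) (f : C -> C) (z0 : C) : open V -> V z0 ->
  holomorphic_on V f -> C_derive f z0 <> 0%C ->
  exists W : C -> Prop, open W /\ W z0 /\ (forall z, W z -> V z) /\
    forall z, W z -> C_derive f z <> 0%C.
Proof.
  intros HV Vz Hf Hd.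
  pose (d := fun z => D1 (fun w => Re (f w)) z ^ 2 + D1 (fun w => Im (f w)) z ^ 2).
  assert (Sd : smooth_on V d).
  { destruct Hf as [_ [Sp Sq]]. apply smooth_plus; [exact HV|..];
      apply smooth_pow; auto; now apply smooth_D1. }
  assert (E : forall z, V z -> (C_derive f z <> 0%C <-> 0 < d z)).
  { intros z Hz. rewrite C_neq0. destruct (Cauchy_Riemann V f z Hf Hz) as [_ [_ ->]]. reflexivity. }
  exists (fun z => V z /\ 0 < d z). split; [|split; [|split]].
  - apply open_pos; [exact HV|]. intros z Hz. now apply (smooth_continuous V).
  - split; [exact Vz|now apply E].
  - now intros z [Hz _].
  - intros z [Hz Hp]. now apply E.
Qed.

Lemma stereo_inv_Cinv (w : C) : w <> 0%C -> stereo_inv (Some (/ w)%C) = flip (stereo_inv (Some w)).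
Proof.
  intros Hw. apply C_neq0 in Hw. unfold stereo_inv, flip. rewrite !Cmod_sqr.
  destruct w as [a b]. unfold Cinv, Re, Im in *; simpl in *.
  assert (0 < 1 + (a * (a * 1) + b * (b * 1))) by lra.
  apply V3_eq; unfold vx, vy, vz; simpl; field;
    (split; [lra|split; [lra|]]);
    replace (_ + (a * a + - b * - b)) with ((a * a + b * b) * (1 + (a * a + b * b))) by ring;
    apply Rmult_integral_contrapositive_currified; lra.
Qed.

(** In the chart 1 / g the sphere map is the [flip] of the stereographic image of [f]. At a zero of
    [f] this says that [flip] carries the north pole to the south pole. *)
Lemma Ymap_conformal (U : C -> Prop) (g : C -> Csphere) :
  (forall z, U z -> holo_immersion_at g z) -> conformal_sphere_map U (Ymap g).
Proof.
  intros H. apply conformal_sphere_map_local. intros z0 Hz0.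
  destruct (H z0 Hz0) as [V [f [HV [Vz [Hf [Hd Hg]]]]]].
  destruct (holomorphic_regular V f z0 HV Vz Hf Hd) as [W [HW [Wz [WV Wd]]]].
  exists W. split; [exact Wz|].
  assert (SC := stereo_conformal W f HW (holomorphic_sub _ _ _ WV Hf) Wd).
  destruct Hg as [Hg|Hg].
  - apply (conformal_sphere_map_ext W (fun z => stereo_inv (Some (f z)))); auto.
    intros z Hz. unfold Ymap. now rewrite (Hg z (WV z Hz)).
  - apply (conformal_sphere_map_ext W (fun z => flip (stereo_inv (Some (f z))))); auto.
    + intros z Hz. unfold Ymap. destruct (Hg z (WV z Hz)) as [G0 G1].
      destruct (Ceq_dec (f z) 0) as [e|e].
      * rewrite (G0 e), e. unfold flip, stereo_inv. rewrite Cmod_0.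
        apply V3_eq; unfold vx, vy, vz, Re, Im; simpl; field.
      * rewrite (G1 e). symmetry. now apply stereo_inv_Cinv.
    + now apply conformal_sphere_map_flip.
Qed.

(** * Local logarithms *)

Lemma mean_value (f : R -> R) (a b : R) :
  (forall t, Rmin a b <= t <= Rmax a b -> ex_derive f t) ->
  exists t, Rmin a b <= t <= Rmax a b /\ f b - f a = Derive f t * (b - a).
Proof.
  intros H. apply MVT_gen.
  - intros x Hx. apply Derive_correct, H. lra.
  - intros x Hx. apply continuity_pt_filterlim.
    apply (ex_derive_continuous (K := R_AbsRing) (V := R_NormedModule)), H, Hx.
Qed.

Lemma ball_between (x : R) (e : posreal) (a b t : R) :
  ball x e a -> ball x e b -> Rmin a b <= t <= Rmax a b -> ball x e t.
Proof.
  unfold ball; simpl; unfold AbsRing_ball, abs, minus, plus, opp; simpl.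
  intros Ha Hb. apply Rabs_def2 in Ha. apply Rabs_def2 in Hb.
  unfold Rmin, Rmax. destruct (Rle_dec a b); intros Ht; apply Rabs_def1; lra.
Qed.

Lemma increment_on_square (f : C -> R) (z0 : C) (e : posreal) :
  (forall z, ball z0 e z -> ex_partials f z) ->
  forall z w, ball z0 e z -> ball z0 e w -> exists s t, ball z0 e s /\ ball z0 e t /\
    f w - f z = D1 f s * (fst w - fst z) + D2 f t * (snd w - snd z).
Proof.
  intros H [x y] [x' y'] [B1 B2] [B1' B2']. simpl in *.
  destruct (mean_value (fun t => f (t, y')) x x') as [s [Hs Es]].
  { intros t Ht. apply (H (t, y')). split; simpl; [|exact B2'].
    exact (ball_between _ _ _ _ _ B1 B1' Ht). }
  destruct (mean_value (fun t => f (x, t)) y y') as [t [Ht Et]].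
  { intros t Ht. apply (H (x, t)). split; simpl; [exact B1|].
    exact (ball_between _ _ _ _ _ B2 B2' Ht). }
  exists (s, y'), (x, t). split; [|split].
  - split; simpl; [exact (ball_between _ _ _ _ _ B1 B1' Hs)|exact B2'].
  - split; simpl; [exact B1|exact (ball_between _ _ _ _ _ B2 B2' Ht)].
  - unfold D1, D2; simpl. lra.
Qed.

(** A quantitative replacement for the inverse function theorem. On a small square the partial
    derivatives of [f] deviate from those at [z0] by less than d = |f'(z0)| / 4. If f z = f w, the
    increments then give 16 d^2 |w - z|^2 <= 4 d^2 |w - z|^2, so z = w. *)
Lemma holomorphic_locally_injective (V : C -> Prop) (f : C -> C) (z0 : C) : open V -> V z0 ->
  holomorphic_on V f -> C_derive f z0 <> 0%C ->
  exists W : C -> Prop, open W /\ W z0 /\ (forall z, W z -> V z) /\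
    forall z w, W z -> W w -> f z = f w -> z = w.
Proof.
  intros HV Vz Hf Hd. destruct (Cauchy_Riemann V f z0 Hf Vz) as [c1 [c2 c3]].
  rewrite c3 in Hd. apply C_neq0 in Hd.
  change (0 < D1 (fun w => Re (f w)) z0 ^ 2 + D1 (fun w => Im (f w)) z0 ^ 2) in Hd.
  destruct Hf as [_ [Sp Sq]].
  set (p := fun w => Re (f w)) in *. set (q := fun w => Im (f w)) in *.
  set (a := D1 p z0) in *. set (b := D1 q z0) in *.
  set (d := sqrt (a ^ 2 + b ^ 2) / 4).
  assert (Hd0 : 0 < d) by (unfold d; generalize (sqrt_lt_R0 _ Hd); lra).
  assert (Hdd : 16 * (d * d) = a ^ 2 + b ^ 2).
  { transitivity (sqrt (a ^ 2 + b ^ 2) * sqrt (a ^ 2 + b ^ 2)); [unfold d; field|].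
    apply sqrt_sqrt; lra. }
  assert (L : forall F : C -> R, smooth_on V F -> locally z0 (fun w => Rabs (F w - F z0) < d)).
  { intros F SF. apply (smooth_continuous V F z0 SF Vz (fun t => Rabs (t - F z0) < d)).
    exists (mkposreal d Hd0). intros t Ht. exact Ht. }
  assert (LL : locally z0 (fun w => V w /\ ((Rabs (D1 p w - a) < d /\ Rabs (D2 p w - - b) < d) /\
     (Rabs (D1 q w - b) < d /\ Rabs (D2 q w - a) < d)))).
  { assert (l2 := L _ (smooth_D2 _ _ Sp)). assert (l4 := L _ (smooth_D2 _ _ Sq)).
    rewrite c1 in l2. rewrite c2 in l4.
    apply filter_and; [apply HV, Vz|]. apply filter_and; apply filter_and;
      [apply (L _ (smooth_D1 _ _ Sp))|exact l2|apply (L _ (smooth_D1 _ _ Sq))|exact l4]. }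
  destruct LL as [e He].
  (* The interior of the square, which is open by [locally_locally]. *)
  exists (fun z => locally z (ball z0 e)). split; [|split; [|split]].
  - intros z Hz. now apply locally_locally.
  - now exists e.
  - intros z Hz. apply He. now apply locally_singleton.
  - intros z w Hz Hw E. apply locally_singleton in Hz, Hw.
    destruct (increment_on_square p z0 e) with (z := z) (w := w) as [s [t [Bs [Bt Ep]]]]; auto.
    { intros x Hx. apply (Sp 1%nat), He, Hx. }
    destruct (increment_on_square q z0 e) with (z := z) (w := w) as [s' [t' [Bs' [Bt' Eq]]]]; auto.
    { intros x Hx. apply (Sq 1%nat), He, Hx. }
    assert (p w = p z) by (unfold p; now rewrite E). assert (q w = q z) by (unfold q; now rewrite E).
    destruct (He s Bs) as [_ [[e1 _] _]]. destruct (He t Bt) as [_ [[_ e2] _]].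
    destruct (He s' Bs') as [_ [_ [e3 _]]]. destruct (He t' Bt') as [_ [_ [_ e4]]].
    apply Rabs_def2 in e1. apply Rabs_def2 in e2. apply Rabs_def2 in e3. apply Rabs_def2 in e4.
    set (dx := fst w - fst z) in *. set (dy := snd w - snd z) in *.
    set (x1 := D1 p s - a) in *. set (x2 := D2 p t - - b) in *.
    set (x3 := D1 q s' - b) in *. set (x4 := D2 q t' - a) in *.
    assert (F1 : a * dx - b * dy = - (x1 * dx + x2 * dy)) by (unfold x1, x2; lra).
    assert (F2 : b * dx + a * dy = - (x3 * dx + x4 * dy)) by (unfold x3, x4; lra).
    (* Cauchy-Schwarz for the error in one component. *)
    assert (Q : forall x y, - d < x < d -> - d < y < d ->
      (x * dx + y * dy) ^ 2 <= 2 * (d * d) * (dx ^ 2 + dy ^ 2)).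
    { intros x y Hx Hy. assert (x * x <= d * d) by nra. assert (y * y <= d * d) by nra.
      assert ((x * dx + y * dy) ^ 2 <= (x * x + y * y) * (dx ^ 2 + dy ^ 2))
        by (generalize (pow2_ge_0 (x * dy - y * dx)); nra).
      eapply Rle_trans; [eassumption|].
      apply Rmult_le_compat_r; [generalize (pow2_ge_0 dx) (pow2_ge_0 dy); lra|lra]. }
    assert (G : (a ^ 2 + b ^ 2) * (dx ^ 2 + dy ^ 2) <= 4 * (d * d) * (dx ^ 2 + dy ^ 2)).
    { transitivity ((a * dx - b * dy) ^ 2 + (b * dx + a * dy) ^ 2); [right; ring|].
      rewrite F1, F2. generalize (Q x1 x2 ltac:(lra) ltac:(lra)) (Q x3 x4 ltac:(lra) ltac:(lra)). lra. }
    rewrite <- Hdd in G.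
    assert (Z : dx ^ 2 + dy ^ 2 <= 0).
    { apply (Rmult_le_reg_l (12 * (d * d))); [nra|lra]. }
    assert (dx = 0) by nra. assert (dy = 0) by nra.
    unfold dx, dy in *. destruct z, w; simpl in *. f_equal; lra.
Qed.

Lemma polar_angle (a b : R) : 0 < a ^ 2 + b ^ 2 ->
  exists th, a = sqrt (a ^ 2 + b ^ 2) * cos th /\ b = sqrt (a ^ 2 + b ^ 2) * sin th.
Proof.
  intros H. set (r := sqrt (a ^ 2 + b ^ 2)).
  assert (Hr : 0 < r) by (apply sqrt_lt_R0; exact H).
  assert (rr : r * r = a ^ 2 + b ^ 2) by (apply sqrt_sqrt; lra).
  assert (B : -1 <= a / r <= 1).
  { split; [apply (Rmult_le_reg_r r)|apply (Rmult_le_reg_r r)]; try exact Hr;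
      field_simplify; try lra; nra. }
  assert (S : sqrt (1 - Rsqr (a / r)) = Rabs b / r).
  { transitivity (sqrt (Rsqr (b / r))).
    - f_equal. unfold Rsqr. apply (Rmult_eq_reg_r (r * r)); [|nra]. field_simplify; [|lra..]. lra.
    - rewrite sqrt_Rsqr_abs. unfold Rdiv. rewrite Rabs_mult. f_equal.
      apply Rabs_right. left. now apply Rinv_0_lt_compat. }
  destruct (Rle_dec 0 b) as [Hb|Hb].
  - exists (acos (a / r)). rewrite cos_acos, sin_acos, S, Rabs_right by lra.
    split; field; lra.
  - exists (- acos (a / r)). rewrite cos_neg, sin_neg, cos_acos, sin_acos, S, Rabs_left by lra.
    split; field; lra.
Qed.

(** A branch of log f with real part ln |f| and imaginary part [th] plus an arctangent, [th] being
    an argument of [f z0]. The domain shrinks in turn to keep the arctangent defined, the derivative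
    nonzero and the map injective. *)
Lemma log_chart (V : C -> Prop) (f : C -> C) (z0 : C) : open V -> V z0 ->
  holomorphic_on V f -> f z0 <> 0%C -> C_derive f z0 <> 0%C ->
  exists (W : C -> Prop) (zeta : C -> C), W z0 /\ (forall z, W z -> V z) /\
    conformal_chart W zeta /\ forall z, W z -> f z <> 0%C /\ f z = cexp (zeta z).
Proof.
  intros HV Vz Hf Hn Hd.
  set (p := fun w => Re (f w)). set (q := fun w => Im (f w)).
  assert (Sp : smooth_on V p) by apply Hf. assert (Sq : smooth_on V q) by apply Hf.
  apply C_neq0 in Hn. change (0 < p z0 ^ 2 + q z0 ^ 2) in Hn.
  set (a := p z0) in *. set (b := q z0) in *.
  (* [A + iB] is [f] times the conjugate of [f z0]: its values near [z0] are in the right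
     half plane, where the argument is [atan (B / A)]. *)
  pose (A := fun z => p z * a + q z * b). pose (B := fun z => q z * a - p z * b).
  assert (SA : smooth_on V A).
  { apply smooth_plus; [exact HV|..]; apply smooth_mult; auto; now apply smooth_const. }
  assert (SB : smooth_on V B).
  { apply smooth_minus; [exact HV|..]; apply smooth_mult; auto; now apply smooth_const. }
  destruct (polar_angle a b Hn) as [th [Ha Hb]].
  set (r := sqrt (a ^ 2 + b ^ 2)) in *.
  assert (Hr : 0 < r) by (apply sqrt_lt_R0; exact Hn).
  pose (W1 := fun z => V z /\ 0 < A z).
  assert (HW1 : open W1).
  { apply open_pos; [exact HV|]. intros z Hz. now apply (smooth_continuous V). }
  assert (W1z : W1 z0) by (split; [exact Vz|unfold A; fold a b; lra]).
  assert (W1V : forall z, W1 z -> V z) by (now intros z [? _]).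
  assert (SpW := smooth_sub V W1 p W1V Sp). assert (SqW := smooth_sub V W1 q W1V Sq).
  assert (SAW := smooth_sub V W1 A W1V SA). assert (SBW := smooth_sub V W1 B W1V SB).
  assert (Np : forall z, W1 z -> 0 < p z * p z + q z * q z).
  { intros z [_ Hz]. unfold A in Hz.
    destruct (Req_dec (p z) 0) as [e1|e1]; [|nra]. destruct (Req_dec (q z) 0) as [e2|e2]; [|nra].
    rewrite e1, e2 in Hz. lra. }
  pose (zeta := fun z => (/ 2 * ln (p z * p z + q z * q z), th + atan (B z / A z)) : C).
  assert (S1 : smooth_on W1 (fun z => Re (zeta z))).
  { unfold zeta, Re; simpl. apply smooth_mult; [exact HW1|now apply smooth_const|].
    apply smooth_ln; [exact HW1|exact Np|]. apply smooth_plus; auto; now apply smooth_mult. }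
  assert (S2 : smooth_on W1 (fun z => Im (zeta z))).
  { unfold zeta, Im; simpl. apply smooth_plus; [exact HW1|now apply smooth_const|].
    apply smooth_atan; [exact HW1|]. apply smooth_div; auto. intros z [_ Hz]. lra. }
  assert (AB : forall z, A z * A z + B z * B z = (p z * p z + q z * q z) * (a ^ 2 + b ^ 2)).
  { intros z. unfold A, B. ring. }
  assert (PD : forall z, W1 z -> let n := p z * p z + q z * q z in
    pd (fun z => Re (zeta z)) z ((p z * D1 p z + q z * D1 q z) / n) ((q z * D1 p z - p z * D1 q z) / n) /\
    pd (fun z => Im (zeta z)) z ((p z * D1 q z - q z * D1 p z) / n) ((p z * D1 p z + q z * D1 q z) / n)).
  { intros z Hz n. assert (Hn' := Np z Hz). fold n in Hn'. assert (HA := proj2 Hz).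
    destruct (Cauchy_Riemann V f z Hf (W1V z Hz)) as [c1 [c2 _]]. fold p q in c1, c2.
    assert (Pp := smooth_pd W1 p z SpW Hz). assert (Pq := smooth_pd W1 q z SqW Hz).
    rewrite c1 in Pp. rewrite c2 in Pq. split.
    - eapply pd_eq; [apply pd_mult; [apply pd_const|apply (pd_comp ln (fun z => p z * p z + q z * q z));
        [apply is_derive_ln; exact Hn'|apply pd_plus; apply pd_mult; eassumption]]| |];
        cbv beta; fold n; field; lra.
    - assert (PA : pd A z (D1 p z * a + D1 q z * b) (- D1 q z * a + D1 p z * b)).
      { eapply pd_eq; [apply pd_plus; (apply pd_mult; [eassumption|apply pd_const])| |]; cbv beta; ring. }
      assert (PB : pd B z (D1 q z * a - D1 p z * b) (D1 p z * a + D1 q z * b)).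
      { eapply pd_eq; [apply pd_minus; (apply pd_mult; [eassumption|apply pd_const])| |]; cbv beta; ring. }
      assert (N2 : A z * A z + B z * B z <> 0) by (rewrite AB; fold n; nra).
      eapply pd_eq; [apply pd_plus; [apply pd_const|apply (pd_comp atan (fun z => B z / A z));
        [apply is_derive_atan|apply pd_div; [lra|exact PB|exact PA]]]| |]; unfold Rsqr.
      + transitivity (((D1 q z * a - D1 p z * b) * A z - B z * (D1 p z * a + D1 q z * b)) / (A z * A z + B z * B z)).
        { field. repeat split; lra || (intros K; apply N2; rewrite <- K; ring). }
        rewrite AB. fold n. unfold A, B. field. split; lra.
      + transitivity (((D1 p z * a + D1 q z * b) * A z - B z * (- D1 q z * a + D1 p z * b)) / (A z * A z + B z * B z)).
        { field. repeat split; lra || (intros K; apply N2; rewrite <- K; ring). }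
        rewrite AB. fold n. unfold A, B. field. split; lra. }
  assert (Hz1 : holomorphic_on W1 zeta).
  { apply Cauchy_Riemann_holomorphic; auto. intros z Hz. destruct (PD z Hz) as [P1 P2].
    apply pd_D in P1. apply pd_D in P2. destruct P1 as [-> ->], P2 as [-> ->].
    assert (Hn' := Np z Hz). split; field; lra. }
  assert (Hz2 : C_derive zeta z0 <> 0%C).
  { destruct (Cauchy_Riemann W1 zeta z0 Hz1 W1z) as [_ [_ ->]]. apply C_neq0.
    change (0 < D1 (fun z => Re (zeta z)) z0 ^ 2 + D1 (fun z => Im (zeta z)) z0 ^ 2).
    destruct (PD z0 W1z) as [P1 P2]. apply pd_D in P1. apply pd_D in P2.
    destruct P1 as [-> _], P2 as [-> _].
    destruct (Cauchy_Riemann V f z0 Hf Vz) as [_ [_ c3]]. rewrite c3 in Hd. apply C_neq0 in Hd.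
    change (0 < D1 p z0 ^ 2 + D1 q z0 ^ 2) in Hd. assert (Hn' := Np z0 W1z).
    match goal with |- 0 < ?x => replace x with ((D1 p z0 ^ 2 + D1 q z0 ^ 2) / (p z0 * p z0 + q z0 * q z0)) end.
    - now apply Rdiv_lt_0_compat.
    - field. lra. }
  destruct (holomorphic_regular W1 zeta z0 HW1 W1z Hz1 Hz2) as [W2 [HW2 [W2z [W21 W2d]]]].
  destruct (holomorphic_locally_injective W2 zeta z0 HW2 W2z (holomorphic_sub _ _ _ W21 Hz1) Hz2)
    as [W3 [HW3 [W3z [W32 W3i]]]].
  exists W3, zeta. split; [exact W3z|]. split; [auto|]. split.
  - split; [exact HW3|]. split; [apply (holomorphic_sub W1); auto|]. split; auto.
  - intros z Hz. assert (Hz' : W1 z) by auto. assert (Hn' := Np z Hz'). split.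
    + apply C_neq0. change (0 < p z ^ 2 + q z ^ 2). lra.
    + assert (HA := proj2 Hz').
      (* A^2 + B^2 = |f|^2 r^2, the squared modulus of [f] times the conjugate of [f z0]; the sign
         is fixed by A > 0. *)
      assert (SQ : sqrt (1 + Rsqr (B z / A z)) = sqrt (p z * p z + q z * q z) * r / A z).
      { apply sqrt_lem_1.
        - generalize (Rle_0_sqr (B z / A z)); lra.
        - apply Rmult_le_pos; [apply Rmult_le_pos; [apply sqrt_pos|lra]|left; now apply Rinv_0_lt_compat].
        - transitivity ((sqrt (p z * p z + q z * q z) * sqrt (p z * p z + q z * q z)) * (r * r) / (A z * A z)); [field; lra|].
          rewrite sqrt_sqrt by lra. unfold r. rewrite sqrt_sqrt by lra. rewrite <- AB. unfold Rsqr. field. lra. }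
      assert (EX : exp (Re (zeta z)) = sqrt (p z * p z + q z * q z)).
      { change (Re (zeta z)) with (/ 2 * ln (p z * p z + q z * q z)).
        rewrite <- Rpower_sqrt by exact Hn'. reflexivity. }
      assert (Sp0 : 0 < sqrt (p z * p z + q z * q z)) by (apply sqrt_lt_R0; exact Hn').
      assert (rr : r * r = a ^ 2 + b ^ 2) by (apply sqrt_sqrt; lra).
      unfold cexp. rewrite EX. change (Im (zeta z)) with (th + atan (B z / A z)).
      rewrite cos_plus, sin_plus, cos_atan, sin_atan, SQ.
      set (s := sqrt (p z * p z + q z * q z)) in *.
      assert (Ca : cos th = a / r) by (apply (Rmult_eq_reg_l r); [rewrite <- Ha; field|]; lra).
      assert (Cb : sin th = b / r) by (apply (Rmult_eq_reg_l r); [rewrite <- Hb; field|]; lra).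
      rewrite Ca, Cb.
      transitivity ((p z, q z) : C); [unfold p, q; now destruct (f z)|]. f_equal.
      * transitivity ((A z * a - B z * b) / (r * r)); [rewrite rr; unfold A, B; field; lra|field; lra].
      * transitivity ((A z * b + B z * a) / (r * r)); [rewrite rr; unfold A, B; field; lra|field; lra].
Qed.

(** Needed where [g] is given as 1 / f: its logarithm is minus that of [f]. *)
Lemma conformal_chart_opp (W : C -> Prop) (zeta : C -> C) :
  conformal_chart W zeta -> conformal_chart W (fun z => - zeta z)%C.
Proof.
  intros [HW [Hh [Hd Hi]]]. assert (Hh' := Hh). destruct Hh' as [_ [Sp Sq]].
  assert (P : forall z, W z -> pd (fun w => Re (- zeta w)%C) z (- D1 (fun w => Re (zeta w)) z) (- D2 (fun w => Re (zeta w)) z)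
     /\ pd (fun w => Im (- zeta w)%C) z (- D1 (fun w => Im (zeta w)) z) (- D2 (fun w => Im (zeta w)) z)).
  { intros z Hz. split; apply pd_opp; now apply (smooth_pd W). }
  assert (Ho : holomorphic_on W (fun z => - zeta z)%C).
  { apply Cauchy_Riemann_holomorphic; [exact HW|now apply (smooth_opp W)|now apply (smooth_opp W)|].
    intros z Hz. destruct (P z Hz) as [P1 P2]. apply pd_D in P1. apply pd_D in P2.
    destruct P1 as [-> ->], P2 as [-> ->].
    destruct (Cauchy_Riemann W zeta z Hh Hz) as [-> [-> _]]. split; ring. }
  split; [exact HW|]. split; [exact Ho|]. split.
  - intros z Hz. destruct (Cauchy_Riemann W _ z Ho Hz) as [_ [_ ->]].
    destruct (P z Hz) as [P1 P2]. apply pd_D in P1. apply pd_D in P2.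
    destruct P1 as [-> _], P2 as [-> _].
    assert (N := Hd z Hz). destruct (Cauchy_Riemann W zeta z Hh Hz) as [_ [_ e]]. rewrite e in N.
    apply C_neq0 in N. apply C_neq0.
    set (x := D1 (fun w => Re (zeta w)) z) in *. set (y := D1 (fun w => Im (zeta w)) z) in *.
    unfold Re, Im in *; simpl in *. lra.
  - intros z w Hz Hw E. apply Hi; auto.
    apply (f_equal Copp) in E. ring_simplify in E. exact E.
Qed.

Lemma cexp_opp (w : C) : cexp (- w)%C = (/ cexp w)%C.
Proof.
  destruct w as [x y]. unfold cexp, Cinv, Copp, Re, Im; simpl.
  rewrite exp_Ropp, cos_neg, sin_neg. assert (P := exp_pos x).
  assert (T := sin2_cos2 y). unfold Rsqr in T.
  set (s := sin y) in *. set (c := cos y) in *. set (e := exp x) in *.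
  assert (D : e * c * (e * c * 1) + e * s * (e * s * 1) = e * e).
  { transitivity (e * e * (s * s + c * c)); [ring|rewrite T; ring]. }
  rewrite D. f_equal; field; lra.
Qed.

Lemma exponential_chart (g : C -> Csphere) (U : C -> Prop) (z0 : C) : open U -> U z0 ->
  holo_immersion_at g z0 -> g z0 <> None -> g z0 <> Some (RtoC 0) ->
  exists (W : C -> Prop) (zeta : C -> C), W z0 /\ (forall z, W z -> U z) /\
    conformal_chart W zeta /\ forall z, W z -> g z = Some (cexp (zeta z)).
Proof.
  intros HU Uz [V [f [HV [Vz [Hf [Hd Hg]]]]]] G1 G2.
  assert (V'V : forall z, V z /\ U z -> V z) by tauto.
  assert (fn : f z0 <> 0%C).
  { intros e. destruct Hg as [Hg|Hg].
    - apply G2. now rewrite (Hg z0 Vz), e.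
    - apply G1. now apply (Hg z0 Vz). }
  destruct (log_chart (fun z => V z /\ U z) f z0 (open_inter _ _ HV HU) (conj Vz Uz)
    (holomorphic_sub _ _ _ V'V Hf) fn Hd) as [W [zeta [Wz [WV [Hc He]]]]].
  destruct Hg as [Hg|Hg].
  - exists W, zeta. split; [exact Wz|]. split; [intros z Hz; apply (WV z Hz)|]. split; [exact Hc|].
    intros z Hz. rewrite (Hg z (proj1 (WV z Hz))). f_equal. apply (He z Hz).
  - exists W, (fun z => - zeta z)%C. split; [exact Wz|]. split; [intros z Hz; apply (WV z Hz)|].
    split; [now apply conformal_chart_opp|].
    intros z Hz. destruct (He z Hz) as [n e].
    rewrite (proj2 (Hg z (proj1 (WV z Hz))) n), cexp_opp, <- e. reflexivity.
Qed.

(** * Explicit profile curves *)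

Lemma exp_mult_2 (u : R) : exp (2 * u) = exp u ^ 2.
Proof. replace (2 * u) with (u + u) by ring. rewrite exp_plus. ring. Qed.

Lemma exp_mult_4 (u : R) : exp (4 * u) = exp u ^ 4.
Proof. replace (4 * u) with (2 * u + 2 * u) by ring. rewrite exp_plus, exp_mult_2. ring. Qed.

Lemma stereo_inv_cexp (w : C) : stereo_inv (Some (cexp w)) =
  (2 * exp (Re w) / (1 + exp (Re w) ^ 2) * cos (Im w),
   2 * exp (Re w) / (1 + exp (Re w) ^ 2) * sin (Im w),
   (1 - exp (Re w) ^ 2) / (1 + exp (Re w) ^ 2)).
Proof.
  unfold stereo_inv. rewrite Cmod_sqr. destruct w as [x y]. unfold cexp, Re, Im; simpl fst; simpl snd.
  replace ((exp x * cos y) ^ 2 + (exp x * sin y) ^ 2) with (exp x ^ 2).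
  - apply V3_eq; unfold vx, vy, vz; simpl; field; generalize (exp_pos x); nra.
  - transitivity (exp x ^ 2 * (Rsqr (sin y) + Rsqr (cos y))); [rewrite sin2_cos2; ring|unfold Rsqr; ring].
Qed.

Lemma cexp_height (w : C) : let y := vz (stereo_inv (Some (cexp w))) in
  -1 < y < 1 /\ log_stereo y = Re w.
Proof.
  rewrite stereo_inv_cexp. unfold vz at 1; cbn [snd]. assert (P := exp_pos (Re w)).
  set (e := exp (Re w)) in *. assert (0 < e ^ 2) by nra. cbv zeta. split.
  - split; apply (Rmult_lt_reg_r (1 + e ^ 2)); try lra; field_simplify; lra.
  - unfold log_stereo, vz; cbn [snd].
    replace ((1 - (1 - e ^ 2) / (1 + e ^ 2)) / (1 + (1 - e ^ 2) / (1 + e ^ 2))) with (e ^ 2)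
      by (field; repeat split; lra).
    unfold e. rewrite <- exp_mult_2, ln_exp. field.
Qed.

(** The derivative of [h_rot] in u, written in [exp u] alone so that the later identities are
    rational in one exponential. *)
Definition h_rot' (a2 a3 c1 c2 u : R) : R :=
  (c1 + exp u ^ 2 * (2 * (a3 + c2 * u) + c2)) / (1 + exp u ^ 2)
  - (a2 + c1 * u + exp u ^ 2 * (a3 + c2 * u)) * (2 * exp u ^ 2) / (1 + exp u ^ 2) ^ 2.

Lemma is_derive_h_rot (a2 a3 c1 c2 u : R) :
  is_derive (h_rot a2 a3 c1 c2) u (h_rot' a2 a3 c1 c2 u).
Proof.
  unfold h_rot, h_rot'. assert (P := exp_pos u). auto_derive.
  - generalize (exp_pos (2 * u)); lra.
  - rewrite exp_mult_2. field. nra.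
Qed.

(** With g = e^z the metric L is sech^2 u times the flat one. The profile of Y is (sech u, - tanh
    u), and that of Y_u divided by the conformal factor is (- sinh u, -1). The right-hand sides are
    the profile of gradL h + h Y. *)
Lemma eta_profile (a2 a3 c1 c2 u : R) : let e := exp u in
  M1t a2 a3 c1 c2 u = h_rot' a2 a3 c1 c2 u * ((1 - e ^ 2) / (2 * e))
                      + h_rot a2 a3 c1 c2 u * (2 * e / (1 + e ^ 2)) /\
  N1t a2 a3 c1 c2 u = - h_rot' a2 a3 c1 c2 u + h_rot a2 a3 c1 c2 u * ((1 - e ^ 2) / (1 + e ^ 2)).
Proof.
  intros e. unfold M1t, N1t, h_rot, h_rot'. rewrite exp_mult_2, exp_Ropp. fold e.
  assert (P : 0 < e) by apply exp_pos. split; field; nra.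
Qed.

(** The common denominator of [Mt] and [Nt]; the expressions r3, r4, r5 coincide with q6, q7, q8. *)
Definition profile_den (a2 a3 c1 c2 u : R) : R :=
  q6 a2 c1 c2 u - 2 * c1 * exp (2 * u) * q7 a2 a3 c2 u + exp (4 * u) * q8 a3 c2 u.

(** The denominator is S = |eta|^2 up to a positive factor, so it is positive wherever [eta] does
    not vanish. *)
Lemma profile_den_eq (a2 a3 c1 c2 u : R) : profile_den a2 a3 c1 c2 u =
  4 * exp u ^ 2 * (1 + exp u ^ 2) * (M1t a2 a3 c1 c2 u ^ 2 + N1t a2 a3 c1 c2 u ^ 2).
Proof.
  unfold profile_den, q6, q7, q8, M1t, N1t. rewrite exp_mult_2, exp_mult_4, exp_Ropp.
  assert (P := exp_pos u). set (e := exp u) in *. field. nra.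
Qed.

Lemma Nt_profile_den (a2 a3 c1 c2 c u : R) : Nt a2 a3 c1 c2 c u =
  (c1 ^ 2 * (1 - exp (2 * u) * (1 - 2 * u) ^ 2) + 2 * c1 * exp (2 * u) * r1 a2 a3 c2 c u
   + exp (2 * u) * r2 a2 a3 c2 c u) / profile_den a2 a3 c1 c2 u.
Proof.
  unfold Nt. f_equal. unfold profile_den, q6, q7, q8, r3, r4, r5. ring.
Qed.

(** The relation X = Y - 2 (h + c) / S eta read on profile curves. Multiplication by the
    denominator, in the form of [profile_den_eq], removes S from below and leaves identities
    rational in [exp u]. *)
Lemma X_profile (a2 a3 c1 c2 c u : R) :
  let e := exp u in let S := M1t a2 a3 c1 c2 u ^ 2 + N1t a2 a3 c1 c2 u ^ 2 in
  0 < S ->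
  Mt a2 a3 c1 c2 c u = 2 * e / (1 + e ^ 2)
    - 2 * (h_rot a2 a3 c1 c2 u + c) / S * M1t a2 a3 c1 c2 u /\
  Nt a2 a3 c1 c2 c u = (1 - e ^ 2) / (1 + e ^ 2)
    - 2 * (h_rot a2 a3 c1 c2 u + c) / S * N1t a2 a3 c1 c2 u.
Proof.
  intros e S HS. assert (P : 0 < e) by apply exp_pos.
  assert (D := profile_den_eq a2 a3 c1 c2 u). fold e in D. fold S in D.
  assert (D0 : 4 * e ^ 2 * (1 + e ^ 2) <> 0) by nra.
  split.
  - transitivity (2 * exp u * (q1 c1 c2 u * q2 a3 c1 c2 u - 2 * a2 * q3 a3 c1 c2 c u
      - 2 * c * (q4 a3 c2 u + q5 c1 u)) / profile_den a2 a3 c1 c2 u); [reflexivity|].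
    rewrite D. apply (Rmult_eq_reg_r (4 * e ^ 2 * (1 + e ^ 2) * S));
      [|apply Rmult_integral_contrapositive_currified; lra].
    transitivity (2 * e * (q1 c1 c2 u * q2 a3 c1 c2 u - 2 * a2 * q3 a3 c1 c2 c u
      - 2 * c * (q4 a3 c2 u + q5 c1 u))); [fold e; field; split; [lra|split; nra]|].
    transitivity (8 * e ^ 3 * S - 8 * e ^ 2 * (1 + e ^ 2) * (h_rot a2 a3 c1 c2 u + c) * M1t a2 a3 c1 c2 u);
      [|field; split; [lra|nra]].
    unfold S, q1, q2, q3, q4, q5, M1t, N1t, h_rot. rewrite exp_mult_2, exp_Ropp. fold e. field. nra.
  - rewrite Nt_profile_den, D. apply (Rmult_eq_reg_r (4 * e ^ 2 * (1 + e ^ 2) * S));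
      [|apply Rmult_integral_contrapositive_currified; lra].
    transitivity (c1 ^ 2 * (1 - exp (2 * u) * (1 - 2 * u) ^ 2) + 2 * c1 * exp (2 * u) * r1 a2 a3 c2 c u
       + exp (2 * u) * r2 a2 a3 c2 c u); [field; split; [lra|split; nra]|].
    transitivity (4 * e ^ 2 * (1 - e ^ 2) * S - 8 * e ^ 2 * (1 + e ^ 2) * (h_rot a2 a3 c1 c2 u + c) * N1t a2 a3 c1 c2 u);
      [|field; split; [lra|nra]].
    unfold S, r1, r2, M1t, N1t, h_rot. rewrite exp_mult_2, exp_Ropp. fold e. field. nra.
Qed.

Section Explicit.
Variables (V : C -> Prop) (g : C -> Csphere) (h : C -> R) (zeta : C -> C) (a2 a3 c1 c2 : R).
Hypothesis HZ : conformal_chart V zeta.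
Hypothesis Hgh : forall z, V z -> g z = Some (cexp (zeta z)) /\ h z = h_rot a2 a3 c1 c2 (Re (zeta z)).

(** Derivatives are taken in the original parameter, not in zeta. The resulting factor |zeta'|^2 =
    x^2 + y^2 occurs once in the conformal factor of [Y] and once in h_,1 Y_,1 + h_,2 Y_,2, and
    cancels. *)
Lemma eta_explicit (z : C) : V z ->
  eta g h z = revolve (M1t a2 a3 c1 c2) (N1t a2 a3 c1 c2) (zeta z).
Proof.
  intros Hz. destruct HZ as [HV [Hh [Hd _]]]. assert (Hh' := Hh). destruct Hh' as [_ [Su Sv]].
  set (u := fun w => Re (zeta w)) in *. set (v := fun w => Im (zeta w)) in *.
  assert (Pu := smooth_pd V u z Su Hz). assert (Pv := smooth_pd V v z Sv Hz).
  destruct (Cauchy_Riemann V zeta z Hh Hz) as [k1 [k2 k3]]. fold u v in k1, k2, k3.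
  assert (N := Hd z Hz). rewrite k3 in N. apply C_neq0 in N.
  change (0 < D1 u z ^ 2 + D1 v z ^ 2) in N. rewrite k1 in Pu. rewrite k2 in Pv.
  set (x := D1 u z) in *. set (y := D1 v z) in *.
  assert (PE := exp_pos (u z)). assert (PT : 0 < 1 + exp (u z) ^ 2) by nra.
  assert (L : forall w, V w -> Ymap g w =
     (2 * exp (u w) / (1 + exp (u w) ^ 2) * cos (v w), 2 * exp (u w) / (1 + exp (u w) ^ 2) * sin (v w),
      (1 - exp (u w) ^ 2) / (1 + exp (u w) ^ 2))).
  { intros w Hw. unfold Ymap. destruct (Hgh w Hw) as [-> _]. apply stereo_inv_cexp. }
  assert (dcos : forall t, is_derive cos t (- sin t)) by (intros; auto_derive; [exact I|ring]).
  assert (dsin : forall t, is_derive sin t (cos t)) by (intros; auto_derive; [exact I|ring]).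
  set (e := exp (u z)) in *.
  assert (P1 : pd (fun w => 2 * exp (u w) / (1 + exp (u w) ^ 2)) z
     (2 * e * (1 - e ^ 2) / (1 + e ^ 2) ^ 2 * x) (2 * e * (1 - e ^ 2) / (1 + e ^ 2) ^ 2 * - y)).
  { apply (pd_comp (fun t => 2 * exp t / (1 + exp t ^ 2)) u); [|exact Pu].
    auto_derive; [unfold e in PT; lra|fold e; field; lra]. }
  assert (P2 : pd (fun w => (1 - exp (u w) ^ 2) / (1 + exp (u w) ^ 2)) z
     (- 4 * e ^ 2 / (1 + e ^ 2) ^ 2 * x) (- 4 * e ^ 2 / (1 + e ^ 2) ^ 2 * - y)).
  { apply (pd_comp (fun t => (1 - exp t ^ 2) / (1 + exp t ^ 2)) u); [|exact Pu].
    auto_derive; [unfold e in PT; lra|fold e; field; lra]. }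
  assert (Pc := pd_comp cos v z _ _ _ (dcos (v z)) Pv).
  assert (Ps := pd_comp sin v z _ _ _ (dsin (v z)) Pv).
  assert (Ph : pd h z (h_rot' a2 a3 c1 c2 (u z) * x) (h_rot' a2 a3 c1 c2 (u z) * - y)).
  { apply (pd_ext_loc (fun w => h_rot a2 a3 c1 c2 (u w))).
    - apply (filter_imp V); [|exact (HV z Hz)]. intros w Hw. symmetry. apply (Hgh w Hw).
    - apply pd_comp; [apply is_derive_h_rot|exact Pu]. }
  assert (LL : forall p : V3 -> R, locally z (fun w => p
     (2 * exp (u w) / (1 + exp (u w) ^ 2) * cos (v w), 2 * exp (u w) / (1 + exp (u w) ^ 2) * sin (v w),
      (1 - exp (u w) ^ 2) / (1 + exp (u w) ^ 2)) = p (Ymap g w))).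
  { intros p. apply (filter_imp V); [|exact (HV z Hz)]. intros w Hw. now rewrite (L w Hw). }
  destruct (pd_D _ _ _ _ (pd_ext_loc _ _ _ _ _ (LL vx) (pd_mult _ _ _ _ _ _ _ P1 Pc))) as [x1 x2].
  destruct (pd_D _ _ _ _ (pd_ext_loc _ _ _ _ _ (LL vy) (pd_mult _ _ _ _ _ _ _ P1 Ps))) as [y1 y2].
  destruct (pd_D _ _ _ _ (pd_ext_loc _ _ _ _ _ (LL vz) P2)) as [z1 z2].
  apply pd_D in Ph. destruct Ph as [h1 h2].
  assert (E1 := V3_eq (vD1 (Ymap g) z) (_, _, _) x1 y1 z1).
  assert (E2 := V3_eq (vD2 (Ymap g) z) (_, _, _) x2 y2 z2).
  clear x1 x2 y1 y2 z1 z2 P1 P2 Pc Ps LL.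
  assert (cs := sin2_cos2 (v z)). unfold Rsqr in cs.
  assert (E11 : f11 (formL g z) = 4 * e ^ 2 * (x ^ 2 + y ^ 2) / (1 + e ^ 2) ^ 2).
  { unfold formL. simpl. rewrite E1. unfold dot, vx, vy, vz; cbn [fst snd]. fold e.
    set (s := sin (v z)) in *. set (k := cos (v z)) in *.
    transitivity ((2 * e * (1 - e ^ 2) / (1 + e ^ 2) ^ 2 * x) ^ 2 * (s * s + k * k)
       + (2 * e / (1 + e ^ 2) * y) ^ 2 * (s * s + k * k) + (- 4 * e ^ 2 / (1 + e ^ 2) ^ 2 * x) ^ 2).
    - field. lra.
    - rewrite cs. field. lra. }
  destruct (eta_profile a2 a3 c1 c2 (u z)) as [M1 N1]. fold e in M1, N1.
  unfold eta, gradL, revolve. change (Re (zeta z)) with (u z). change (Im (zeta z)) with (v z).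
  rewrite M1, N1, E11, E1, E2, h1, h2, (L z Hz), (proj2 (Hgh z Hz)). fold e. fold (u z).
  apply V3_eq; unfold vadd, vscal, vx, vy, vz; cbn [fst snd]; fold e; field; lra.
Qed.

Variable U : C -> Prop.
Hypothesis HU : open U.
Hypothesis HC : conformal_sphere_map U (Ymap g).
Hypothesis Hn : forall z, U z -> h z <> 0.
Hypothesis VU : forall z, V z -> U z.
Variable c : R.

(** The positivity locates Re (zeta z) in the open set where [Mt] and [Nt] are smooth; that set
    serves as the interval domain in [rotational]. *)
Lemma X_explicit (z : C) : V z ->
  0 < profile_den a2 a3 c1 c2 (Re (zeta z)) /\
  Xmap g c h z = revolve (Mt a2 a3 c1 c2 c) (Nt a2 a3 c1 c2 c) (zeta z).
Proof.
  intros Hz. assert (PS : 0 < Sfun g h z) by exact (S_pos U g h HU HC Hn z (VU z Hz)).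
  assert (e := eta_explicit z Hz).
  assert (cs := sin2_cos2 (Im (zeta z))). unfold Rsqr in cs.
  assert (ES : Sfun g h z = M1t a2 a3 c1 c2 (Re (zeta z)) ^ 2 + N1t a2 a3 c1 c2 (Re (zeta z)) ^ 2).
  { unfold Sfun. rewrite e. unfold revolve, dot, vx, vy, vz; cbn [fst snd].
    transitivity (M1t a2 a3 c1 c2 (Re (zeta z)) ^ 2 * (sin (Im (zeta z)) * sin (Im (zeta z)) + cos (Im (zeta z)) * cos (Im (zeta z)))
       + N1t a2 a3 c1 c2 (Re (zeta z)) ^ 2); [ring|rewrite cs; ring]. }
  split.
  - rewrite profile_den_eq, <- ES. assert (P := exp_pos (Re (zeta z))).
    apply Rmult_lt_0_compat; [nra|exact PS].
  - assert (PS' := PS). rewrite ES in PS'.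
    destruct (X_profile a2 a3 c1 c2 c (Re (zeta z)) PS') as [M N].
    unfold Xmap. rewrite e, ES. unfold revolve. rewrite M, N. unfold Ymap.
    destruct (Hgh z Hz) as [-> ->]. rewrite stereo_inv_cexp.
    set (S := M1t a2 a3 c1 c2 (Re (zeta z)) ^ 2 + N1t a2 a3 c1 c2 (Re (zeta z)) ^ 2) in *. clearbody S.
    assert (0 < 1 + exp (Re (zeta z)) ^ 2) by (generalize (exp_pos (Re (zeta z))); nra).
    apply V3_eq; unfold vadd, vscal, vx, vy, vz; cbn [fst snd]; field; lra.
Qed.
End Explicit.

(** * Smoothness of the profile functions *)

Lemma smooth_fst (V : C -> Prop) : open V -> smooth_on V fst.
Proof.
  intros HV. assert (P : forall z, D1 fst z = 1 /\ D2 fst z = 0) by (intros z; apply pd_D, pd_fst).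
  apply smooth_pred; [exact HV|]. intros k. split; [intros z _; eapply pd_ex, pd_fst|].
  split; [apply (Ck_ext k V (fun _ => 1))|apply (Ck_ext k V (fun _ => 0))]; auto;
    try (now apply Ck_const); intros z _; symmetry; apply P.
Qed.

(** A function of one variable is regarded as a function of the plane that is constant in the second
    coordinate, so the closure lemmas for [smooth_on] also yield [smooth1_on]. *)
Lemma smooth_on_smooth1 (J : R -> Prop) (f : R -> R) :
  smooth_on (fun w => J (fst w)) (fun w => f (fst w)) -> smooth1_on J f.
Proof.
  intros H.
  assert (K : forall n, smooth_on (fun w => J (fst w)) (fun w => Derive_n f n (fst w))).
  { induction n as [|n IH]; [exact H|]. exact (smooth_D1 _ _ IH). }
  intros [|n] x Hx; [exact I|].
  exact (proj1 (proj1 (K n 1%nat) (x, 0) Hx)).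
Qed.

Lemma open_fst (J : R -> Prop) : open J -> open (fun w : C => J (fst w)).
Proof.
  intros HJ [x y] Hx. destruct (HJ x Hx) as [e He]. exists e. intros [x' y'] [B _]. exact (He x' B).
Qed.

Ltac smooth_expr HV :=
  repeat first
    [ apply smooth_const; exact HV | apply smooth_fst; exact HV
    | apply smooth_plus; [exact HV|..] | apply smooth_minus; [exact HV|..]
    | apply smooth_mult; [exact HV|..] | apply smooth_opp; [exact HV|..]
    | apply smooth_pow; [exact HV|..] | apply smooth_exp; [exact HV|..] ].

Lemma smooth1_eta_profile (a2 a3 c1 c2 : R) :
  smooth1_on (fun _ => True) (M1t a2 a3 c1 c2) /\ smooth1_on (fun _ => True) (N1t a2 a3 c1 c2).
Proof.
  assert (HV : open (fun w : C => True)) by apply open_true.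
  split; apply smooth_on_smooth1; unfold M1t, N1t; apply smooth_div; [exact HV| |smooth_expr HV|smooth_expr HV
    |exact HV| |smooth_expr HV|smooth_expr HV]; intros z _; generalize (exp_pos (2 * fst z)); lra.
Qed.

Lemma smooth_profile_den (V : C -> Prop) (a2 a3 c1 c2 : R) : open V ->
  smooth_on V (fun w => profile_den a2 a3 c1 c2 (fst w)).
Proof. intros HV. unfold profile_den, q6, q7, q8. smooth_expr HV. Qed.

Lemma open_profile_den (a2 a3 c1 c2 : R) : open (fun u => 0 < profile_den a2 a3 c1 c2 u).
Proof.
  intros x Hx.
  assert (H := open_pos (fun _ : C => True) (fun w => profile_den a2 a3 c1 c2 (fst w)) open_true).
  destruct (locally_lines (x, 0) _ (H (fun z _ => smooth_continuous _ _ z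
    (smooth_profile_den (fun _ => True) a2 a3 c1 c2 open_true) I) (x, 0) (conj I Hx))) as [L _].
  generalize L. apply filter_imp. intros t [_ Ht]. exact Ht.
Qed.

Lemma smooth1_X_profile (a2 a3 c1 c2 c : R) :
  smooth1_on (fun u => 0 < profile_den a2 a3 c1 c2 u) (Mt a2 a3 c1 c2 c) /\
  smooth1_on (fun u => 0 < profile_den a2 a3 c1 c2 u) (Nt a2 a3 c1 c2 c).
Proof.
  assert (HV := open_fst _ (open_profile_den a2 a3 c1 c2)).
  assert (SD := smooth_profile_den _ a2 a3 c1 c2 HV).
  split; apply smooth_on_smooth1.
  - apply smooth_div; [exact HV|intros z Hz; apply Rgt_not_eq; exact Hz| |exact SD].
    unfold q1, q2, q3, q4, q5. smooth_expr HV.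
  - eapply smooth_ext; [exact HV|intros z _; symmetry; apply Nt_profile_den|].
    apply smooth_div; [exact HV|intros z Hz; apply Rgt_not_eq; exact Hz| |exact SD].
    unfold r1, r2. smooth_expr HV.
Qed.

Lemma conformal_real_chart (V : C -> Prop) (zeta : C -> C) : conformal_chart V zeta ->
  real_chart V (fun z => Re (zeta z)) (fun z => Im (zeta z)).
Proof.
  intros [HV [Hh [Hd Hi]]]. assert (Hh' := Hh). destruct Hh' as [_ [S1 S2]].
  split; [exact HV|]. split; [exact S1|]. split; [exact S2|]. split.
  - intros z Hz. assert (N := Hd z Hz).
    destruct (Cauchy_Riemann V zeta z Hh Hz) as [-> [-> e]]. rewrite e in N. apply C_neq0 in N.
    set (x := D1 (fun w => Re (zeta w)) z) in *. set (y := D1 (fun w => Im (zeta w)) z) in *.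
    unfold Re, Im in N; simpl in N. lra.
  - intros z w Hz Hw e1 e2. apply Hi; auto.
    destruct (zeta z), (zeta w). unfold Re, Im in *; simpl in *. congruence.
Qed.

(** * The theorem *)

(** Only zeta is local; the constants are fixed beforehand on all of [U]. Heights strictly between
    -1 and 1 mean that [g] avoids 0 and infinity, so it has local logarithms. *)
Lemma rot_data_of_height (U : C -> Prop) (g : C -> Csphere) (h : C -> R) (a2 a3 c1 c2 : R) :
  open U -> (forall z, U z -> holo_immersion_at g z) ->
  (forall z, U z -> -1 < vz (Ymap g z) < 1) ->
  (forall z, U z -> h z = h_rot a2 a3 c1 c2 (log_stereo (vz (Ymap g z)))) -> rot_data U g h.
Proof.
  intros HU Hg Hy Hh. exists a2, a3, c1, c2. intros z0 Hz0.
  assert (B := Hy z0 Hz0). unfold Ymap in B.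
  destruct (exponential_chart g U z0 HU Hz0 (Hg z0 Hz0)) as [W [zeta [Wz [WU [Hc He]]]]].
  - intros e. rewrite e in B. unfold stereo_inv, vz in B; simpl in B. lra.
  - intros e. rewrite e in B. unfold stereo_inv, vz in B; cbn [snd] in B. rewrite Cmod_0 in B.
    replace ((2 - (1 + 0 ^ 2)) / (1 + 0 ^ 2)) with 1 in B by field. lra.
  - exists W, zeta. split; [exact Wz|]. split; [exact WU|]. split; [exact Hc|].
    intros z Hz. split; [now apply He|]. rewrite (Hh z (WU z Hz)). unfold Ymap. rewrite (He z Hz).
    now rewrite (proj2 (cexp_height (zeta z))).
Qed.

(** Harmonicity is a local statement, and in each chart Re zeta is [log_stereo] of the height, so
    the chart disappears from the computation. *)
Lemma rot_data_harmonic (U : C -> Prop) (g : C -> Csphere) (h : C -> R) :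
  conformal_sphere_map U (Ymap g) -> smooth_on U h -> rot_data U g h ->
  forall z, U z -> flat_laplacian (Ffun g h) z = 0.
Proof.
  intros HC Sh [a2 [a3 [c1 [c2 H]]]] z0 Hz0.
  destruct (H z0 Hz0) as [V [zeta [Vz [VU [Hc He]]]]].
  apply (h_rot_harmonic V g h (proj1 Hc)) with (a2 := a2) (a3 := a3) (c1 := c1) (c2 := c2); auto.
  - destruct HC as [[S1 [S2 S3]] HC]. split; [|now auto].
    exact (conj (smooth_sub U V _ VU S1) (conj (smooth_sub U V _ VU S2) (smooth_sub U V _ VU S3))).
  - intros z Hz. unfold Ymap. rewrite (proj1 (He z Hz)). apply cexp_height.
  - intros z Hz. unfold Ymap. rewrite (proj2 (He z Hz)), (proj1 (He z Hz)).
    now rewrite (proj2 (cexp_height (zeta z))).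
Qed.

Lemma rot_data_rotational_eta (U : C -> Prop) (g : C -> Csphere) (h : C -> R) :
  rot_data U g h -> rotational U (eta g h).
Proof.
  intros [a2 [a3 [c1 [c2 H]]]] z0 Hz0.
  destruct (H z0 Hz0) as [V [zeta [Vz [VU [Hc He]]]]].
  exists V, (fun z => Re (zeta z)), (fun z => Im (zeta z)), (fun _ => True),
    (M1t a2 a3 c1 c2), (N1t a2 a3 c1 c2).
  destruct (smooth1_eta_profile a2 a3 c1 c2) as [SM SN].
  repeat (split; [assumption || now apply conformal_real_chart || apply open_true || easy|]).
  intros z Hz. now apply (eta_explicit V g h zeta a2 a3 c1 c2 Hc He).
Qed.

Lemma rot_data_rotational_X (U : C -> Prop) (g : C -> Csphere) (h : C -> R) (c : R) : open U ->
  conformal_sphere_map U (Ymap g) -> (forall z, U z -> h z <> 0) ->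
  rot_data U g h -> rotational U (Xmap g c h).
Proof.
  intros HU HC Hn [a2 [a3 [c1 [c2 H]]]] z0 Hz0.
  destruct (H z0 Hz0) as [V [zeta [Vz [VU [Hc He]]]]].
  assert (X := X_explicit V g h zeta a2 a3 c1 c2 Hc He U HU HC Hn VU c).
  exists V, (fun z => Re (zeta z)), (fun z => Im (zeta z)),
    (fun u => 0 < profile_den a2 a3 c1 c2 u), (Mt a2 a3 c1 c2 c), (Nt a2 a3 c1 c2 c).
  destruct (smooth1_X_profile a2 a3 c1 c2 c) as [SM SN].
  split; [exact Vz|]. split; [exact VU|]. split; [now apply conformal_real_chart|].
  split; [apply open_profile_den|]. split; [intros z Hz; now apply X|].
  split; [exact SM|]. split; [exact SN|]. intros z Hz. now apply X.
Qed.

Theorem theorem5p1 :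
  forall (U : C -> Prop) (g : C -> Csphere) (c : R) (h : C -> R),
    open U -> connected U ->
    (forall z, U z -> holo_immersion_at g z) ->
    c <> 0 ->
    smooth_on U h ->
    (forall z, U z -> h z <> 0) ->
    (immersion_on U (Xmap g c h) ->
       (rotational U (Xmap g c h) /\ H2_surface U (Xmap g c h) (Nmap g h)
        <-> rot_data U g h)) /\
    (immersion_on U (eta g h) ->
       (rotational U (eta g h) /\ laguerre_minimal U (eta g h) (Ymap g)
        <-> rot_data U g h)) /\
    (forall (a2 a3 c1 c2 : R) (V : C -> Prop) (zeta : C -> C),
       (forall z, V z -> U z) -> conformal_chart V zeta ->
       (forall z, V z -> g z = Some (cexp (zeta z)) /\
                         h z = h_rot a2 a3 c1 c2 (Re (zeta z))) ->
       forall z, V z ->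
         Xmap g c h z = revolve (Mt a2 a3 c1 c2 c) (Nt a2 a3 c1 c2 c) (zeta z) /\
         eta g h z = revolve (M1t a2 a3 c1 c2) (N1t a2 a3 c1 c2) (zeta z)).
Proof.
  intros U g c h HU HUc Hg Hc Sh Hn.
  assert (HC := Ymap_conformal U g Hg).
  split; [|split].
  - intros HI. rewrite (H2_iff U g h HU HC Sh c Hc Hn HI). split.
    + intros [HR HF]. assert (D := rotational_X_data U g h HU HC Sh c Hc Hn HI HR).
      destruct (rotational_harmonic_h U g h HU HC Sh (fun z Hz => proj1 (D z Hz)) HUc
        (fun z Hz => proj2 (D z Hz)) HF) as [a2 [a3 [c1 [c2 E]]]].
      apply (rot_data_of_height U g h a2 a3 c1 c2 HU Hg); [apply D|exact E].
    + intros HD. split; [now apply rot_data_rotational_X|now apply rot_data_harmonic].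
  - intros HI. rewrite (laguerre_iff U g h HU HC Sh HI). split.
    + intros [HR HF]. assert (D := rotational_eta_data U g h HU HC Sh HI HR).
      destruct (rotational_harmonic_h U g h HU HC Sh (fun z Hz => proj1 (D z Hz)) HUc
        (fun z Hz => proj2 (D z Hz)) HF) as [a2 [a3 [c1 [c2 E]]]].
      apply (rot_data_of_height U g h a2 a3 c1 c2 HU Hg); [apply D|exact E].
    + intros HD. split; [now apply rot_data_rotational_eta|now apply rot_data_harmonic].
  - intros a2 a3 c1 c2 V zeta VU HZ He z Hz. split.
    + now apply (X_explicit V g h zeta a2 a3 c1 c2 HZ He U HU HC Hn VU c).
    + now apply (eta_explicit V g h zeta a2 a3 c1 c2 HZ He).
Qed.
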